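(* (1) For every integer $j$ let $$f_{1,j}(\tau)=2E_2(\tau)-\frac{3+(-1)^j\sqrt{-3}}{6}E_2(\tau/2)-\frac{3-(-1)^j\sqrt{-3}}{6}E_2((\tau+1)/2).$$ Then for all integers $j$ and $\tau\in\mathcal{H}$: $f_{1,j}^3(\tau)=F_{1,j}(\tau)$, $f_{1,j}(\tau)f_{1,j+1}(\tau)=E_4(\tau)$, $f_{1,j}\big(((-1)^j+\sqrt{-3})/2\big)=0$, $f_{1,j}(\tau+1)=f_{1,j+1}(\tau)$, and $f_{1,j}(-1/\tau)=\frac{-1-(-1)^j\sqrt{-3}}{2}\,\tau^2f_{1,j+1}(\tau)$. (2) For every integer $j$ let $$g_{1,j}(\tau)=\frac32E_2(\tau)-\frac14\sum_{\substack{0\le m\le 2\\ m\not\equiv j\pmod 3}}E_2((\tau+m)/3).$$ Then for all integers $j$ and $\tau\in\mathcal{H}$: $g_{1,j}^2(\tau)=G_{1,j}(\tau)$, $g_{1,j}(\tau)g_{1,j+1}(\tau)g_{1,j+2}(\tau)=E_6(\tau)$, $g_{1,j}(-j+\sqrt{-1})=0$, $g_{1,j}(\tau+1)=g_{1,j+1}(\tau)$, and $g_{1,j}(-1/\tau)=\varepsilon_j\tau^2g_{1,j}(\tau)$, where $\varepsilon_j=1$ if $3\mid j$ and $\varepsilon_j=-1$ if $3\nmid j$.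
   Context: $\mathcal{H}$ is the upper half-plane, $q=e^{2\pi i\tau}$. $\eta(\tau)=q^{1/24}\prod_{n\ge1}(1-q^n)$; $E_2=1-24\sum_{n\ge1}\sigma_1(n)q^n$, $E_4=1+240\sum_{n\ge1}\sigma_3(n)q^n$, $E_6=1-504\sum_{n\ge1}\sigma_5(n)q^n$. $\rho=(-1+\sqrt{-3})/2$, $\sqrt{-a}=i\sqrt a$ for $a>0$. $F_{1,j}=E_6-(-1)^j\sqrt{-1728}\,\eta^{12}$ and $G_{1,j}=E_4-12\rho^j\eta^8$.
   Formalization: The first identity of (1) is proved as f_{1,j}^3 = F_{1,j+1} = E_6 + (-1)^j sqrt(-1728) eta^12; the printed f_{1,j}^3 = F_{1,j} is false for every j, since the q^{1/2} coefficients are 24(-1)^j sqrt(-3) and -24(-1)^j sqrt(-3). *)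

(* Defs.v *)
From Stdlib Require Import Reals ZArith List.
From Coquelicot Require Import Coquelicot.

Open Scope C_scope.

(* The limit of a convergent complex sequence; a junk value otherwise.
   [C_R_CompleteNormedModule] carries the product topology of R * R. *)
Definition Clim (u : nat -> C) : C :=
  iota (fun l : C_R_CompleteNormedModule => filterlim u eventually (locally l)).

Lemma Clim_unique (u : nat -> C) (l : C) :
  filterlim u eventually (locally (l : C_R_CompleteNormedModule)) -> Clim u = l.
Proof.
  intros H.
  exact (iota_filterlim_locally (V := C_R_CompleteNormedModule) u l H).
Qed.

Definition Cexp (z : C) : C := RtoC (exp (Re z)) * (cos (Im z), sin (Im z)).

Definition CpowerZ (z : C) (n : Z) : C :=
  match n with
  | Z0 => 1
  | Zpos p => z ^ Pos.to_nat p
  | Zneg p => / (z ^ Pos.to_nat p)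
  end.

(* [sqrt_neg a] is the square root of [- a] for [0 < a], namely [i * sqrt a]. *)
Definition sqrt_neg (a : R) : C := Ci * RtoC (sqrt a).

Definition qexp (tau : C) : C := Cexp (2 * RtoC PI * Ci * tau).

Definition sigma (k n : nat) : nat :=
  list_sum (map (fun d => Nat.pow d k)
    (filter (fun d => Nat.eqb (Nat.modulo n d) 0) (seq 1 n))).

(* [\sum_(n >= 1) sigma_k(n) q^n]; the summation index is shifted by one. *)
Definition sigma_series (k : nat) (tau : C) : C :=
  Clim (sum_n (fun n => RtoC (INR (sigma k (S n))) * qexp tau ^ S n)).

Definition E2 (tau : C) : C := 1 - 24 * sigma_series 1 tau.
Definition E4 (tau : C) : C := 1 + 240 * sigma_series 3 tau.
Definition E6 (tau : C) : C := 1 - 504 * sigma_series 5 tau.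

(* [q^(1/24)] means [exp (2 pi i tau / 24)], not a root chosen from [q]. *)
Definition eta (tau : C) : C :=
  qexp (tau / 24) *
  Clim (fun N => fold_right Cmult 1 (map (fun n => 1 - qexp tau ^ n) (seq 1 N))).

Definition rho : C := (-1 + sqrt_neg 3) / 2.

Definition F1 (j : Z) (tau : C) : C :=
  E6 tau - CpowerZ (-1) j * sqrt_neg 1728 * eta tau ^ 12.

Definition G1 (j : Z) (tau : C) : C :=
  E4 tau - 12 * CpowerZ rho j * eta tau ^ 8.

Definition f1 (j : Z) (tau : C) : C :=
  2 * E2 tau
  - (3 + CpowerZ (-1) j * sqrt_neg 3) / 6 * E2 (tau / 2)
  - (3 - CpowerZ (-1) j * sqrt_neg 3) / 6 * E2 ((tau + 1) / 2).

Definition g1 (j : Z) (tau : C) : C :=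
  3 / 2 * E2 tau
  - 1 / 4 * fold_right Cplus 0
      (map (fun m : Z => E2 ((tau + RtoC (IZR m)) / 3))
        (filter (fun m : Z => negb (Z.eqb (Z.modulo m 3) (Z.modulo j 3)))
          (0 :: 1 :: 2 :: nil)%Z)).

Definition epsilon (j : Z) : C := if Znumtheory.Zdivide_dec 3 j then 1 else -1.

(* Main.v *)
(* The identities are proved coefficientwise, the transformation laws analytically.

   For the identities, [x^a/(1-x^a) * x^b/(1-x^b)] equals
   [x^(a+b)/(1-x^(a+b)) * (1 + x^a/(1-x^a) + x^b/(1-x^b))]; summing this against the forms
   [I = a^2+ab+b^2], [I^2], [I^3] and [(ab(a+b))^2] yields Ramanujan's differential equations for
   [E2, E4, E6], a system whose formal solutions are determined by the first two coefficients of
   [E2].  They imply [E4^3 - E6^2 = 1728 eta^24].  At level two let [a, b] be the formal cube roots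
   of [E6 +- sqrt(-1728) eta^12], so that [ab = E4].  They satisfy first-order equations, with which
   [2 E2 + rho a + rho^2 b], as a series in [q^(1/2)], again solves Ramanujan's system; by
   uniqueness it is [E2(tau/2)], and [f] is read off as [a] or [b].  At level three the same
   argument applies to the square roots [g_j] of [E4 - 12 rho^j eta^8] and to
   [3 E2 + 2 (g_j - g_k - g_l) = E2((tau+j)/3)].

   The law for [E2(-1/tau)] is Eisenstein's double-sum argument, with the partial fractions of
   [1/sin^2] and [cot] obtained from their duplication formulas and Tannery's theorem.  Together
   with the Hecke relations expressing [E2(2 tau)] and [E2(3 tau)] it gives the behaviour of [f]
   and [g] under [tau -> -1/tau]; the zeros are forced at the elliptic fixed points. *)

Require Import Defs.
From Stdlib Require Import Reals ZArith Lra Lia Psatz FunctionalExtensionality List.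
From Coquelicot Require Import Coquelicot.

Open Scope C_scope.

(** * Formal power series *)

Definition fps := nat -> C.

Declare Scope fps_scope.
Delimit Scope fps_scope with fps.
Bind Scope fps_scope with fps.

Definition shift (a : fps) : fps := fun n => a (S n).
Definition fadd (a b : fps) : fps := fun n => a n + b n.
Definition fopp (a : fps) : fps := fun n => - a n.
Definition fsub (a b : fps) : fps := fun n => a n - b n.
Definition fcst (c : C) : fps := fun n => match n with O => c | S _ => 0 end.

(* The Cauchy product, by the recursion [a * b = a_0 b + x (shift a * b)]. *)
Fixpoint fmul_coef (a b : fps) (n : nat) : C :=
  match n with
  | O => a O * b O
  | S m => a O * b (S m) + fmul_coef (shift a) b m
  end.
Definition fmul (a b : fps) : fps := fmul_coef a b.

Fixpoint fpow (a : fps) (n : nat) : fps :=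
  match n with O => fcst 1 | S m => fmul a (fpow a m) end.

Definition fZ (z : Z) : fps := fcst (IZR z).

Infix "+" := fadd : fps_scope.
Infix "-" := fsub : fps_scope.
Infix "*" := fmul : fps_scope.
Notation "- a" := (fopp a) : fps_scope.
Infix "^" := fpow : fps_scope.

Open Scope fps_scope.

Lemma fps_ext (a b : fps) : (forall n, a n = b n) -> a = b.
Proof. intros H; apply functional_extensionality; exact H. Qed.

Lemma coef_add (a b : fps) n : (a + b) n = (a n + b n)%C.
Proof. reflexivity. Qed.
Lemma coef_sub (a b : fps) n : (a - b) n = (a n - b n)%C.
Proof. reflexivity. Qed.
Lemma coef_opp (a : fps) n : (- a) n = (- a n)%C.
Proof. reflexivity. Qed.
Lemma coef_mul0 (a b : fps) : (a * b) 0%nat = (a 0%nat * b 0%nat)%C.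
Proof. reflexivity. Qed.
Lemma coef_mulS (a b : fps) n :
  (a * b) (S n) = (a 0%nat * b (S n) + (shift a * b)%fps n)%C.
Proof. reflexivity. Qed.
Lemma coef_mul1 (a b : fps) :
  (a * b) 1%nat = (a 0%nat * b 1%nat + a 1%nat * b 0%nat)%C.
Proof. reflexivity. Qed.

Lemma fmul_scal_coef (c : C) (a : fps) n : (fcst c * a) n = (c * a n)%C.
Proof.
  destruct n as [|n]; [reflexivity|].
  rewrite coef_mulS. simpl.
  assert (E : forall m, (shift (fcst c) * a) m = 0).
  { assert (G : forall m (z : fps), (forall k, z k = 0) -> (z * a) m = 0).
    { induction m as [|m IH]; intros z Hz.
      - rewrite coef_mul0, Hz; ring.
      - rewrite coef_mulS, Hz, IH; [ring|]. intros k; apply Hz. }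
    intros m; apply G; reflexivity. }
  rewrite E; ring.
Qed.

Lemma coef_addl (a b c : fps) n : ((a + b) * c) n = ((a * c)%fps n + (b * c)%fps n)%C.
Proof.
  revert a b; induction n as [|n IH]; intros a b.
  - rewrite !coef_mul0, coef_add; ring.
  - rewrite !coef_mulS.
    change (shift (a + b)) with (shift a + shift b).
    rewrite IH, coef_add; ring.
Qed.

Lemma coef_mulSr (a b : fps) n :
  (a * b) (S n) = (a (S n) * b 0%nat + (a * shift b)%fps n)%C.
Proof.
  revert a; induction n as [|n IH]; intros a.
  - rewrite coef_mul1, coef_mul0; unfold shift; ring.
  - rewrite (coef_mulS a b), (coef_mulS a (shift b)), IH. unfold shift; ring.
Qed.

Lemma fmul_comm (a b : fps) : a * b = b * a.
Proof.
  apply fps_ext; intros n; revert a b; induction n as [|n IH]; intros a b.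
  - rewrite !coef_mul0; ring.
  - rewrite coef_mulS, coef_mulSr, IH; ring.
Qed.

Lemma shift_mul (a b : fps) : shift (a * b) = fcst (a 0%nat) * shift b + shift a * b.
Proof.
  apply fps_ext; intros n; unfold shift at 1.
  rewrite coef_mulS, coef_add, fmul_scal_coef; reflexivity.
Qed.

Lemma fscal_mul_coef (c : C) (a b : fps) n : (fcst c * a * b) n = (c * (a * b)%fps n)%C.
Proof.
  revert a; induction n as [|n IH]; intros a.
  - rewrite !coef_mul0; simpl; ring.
  - rewrite !coef_mulS, fmul_scal_coef.
    replace (shift (fcst c * a)) with (fcst c * shift a).
    + rewrite IH; ring.
    + apply fps_ext; intros k; unfold shift; rewrite !fmul_scal_coef; reflexivity.
Qed.

Lemma fmul_assoc (a b c : fps) : a * (b * c) = a * b * c.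
Proof.
  apply fps_ext; intros n; revert a b; induction n as [|n IH]; intros a b.
  - rewrite !coef_mul0; ring.
  - rewrite (coef_mulS a), (coef_mulS (a * b)), shift_mul, coef_addl, fscal_mul_coef,
      <- IH, (coef_mulS b), coef_mul0. ring.
Qed.

Lemma fmul_1_l (a : fps) : fcst 1 * a = a.
Proof. apply fps_ext; intros n; rewrite fmul_scal_coef; ring. Qed.

Lemma fps_ring : ring_theory (fcst 0) (fcst 1) fadd fmul fsub fopp (@eq fps).
Proof.
  constructor; intros.
  - apply fps_ext; intros [|n]; unfold fadd; simpl; ring.
  - apply fps_ext; intros n; unfold fadd; ring.
  - apply fps_ext; intros n; unfold fadd; ring.
  - apply fmul_1_l.
  - apply fmul_comm.
  - apply fmul_assoc.
  - apply fps_ext; intros n; rewrite coef_add; apply coef_addl.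
  - apply fps_ext; intros n; unfold fsub, fadd, fopp; ring.
  - apply fps_ext; intros [|n]; unfold fadd, fopp; simpl; ring.
Qed.

Lemma fcst_add (c e : C) : fcst (c + e)%C = fcst c + fcst e.
Proof. apply fps_ext; intros [|n]; unfold fadd; simpl; ring. Qed.
Lemma fcst_sub (c e : C) : fcst (c - e)%C = fcst c - fcst e.
Proof. apply fps_ext; intros [|n]; unfold fsub; simpl; ring. Qed.
Lemma fcst_opp (c : C) : fcst (- c)%C = - fcst c.
Proof. apply fps_ext; intros [|n]; unfold fopp; simpl; ring. Qed.
Lemma fcst_mul (c e : C) : fcst (c * e)%C = fcst c * fcst e.
Proof.
  apply fps_ext; intros n; rewrite fmul_scal_coef; destruct n; simpl; ring.
Qed.

Lemma fps_ring_morph :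
  ring_morph (fcst 0) (fcst 1) fadd fmul fsub fopp (@eq fps)
    0%Z 1%Z Z.add Z.mul Z.sub Z.opp Z.eqb fZ.
Proof.
  constructor; intros; unfold fZ; try reflexivity.
  - rewrite plus_IZR, RtoC_plus; apply fcst_add.
  - rewrite minus_IZR, RtoC_minus; apply fcst_sub.
  - rewrite mult_IZR, RtoC_mult; apply fcst_mul.
  - rewrite opp_IZR, RtoC_opp; apply fcst_opp.
  - apply Z.eqb_eq in H; subst; reflexivity.
Qed.

Lemma fps_power : power_theory (fcst 1) fmul (@eq fps) N.to_nat fpow.
Proof.
  constructor; intros r [|n]; [reflexivity|].
  simpl. induction n as [|n IH] using Pos.peano_ind.
  - simpl. rewrite fmul_comm; apply fmul_1_l.
  - rewrite Pos2Nat.inj_succ. simpl. rewrite IH.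
    symmetry; apply (pow_pos_succ (Eqsth fps)).
    + intros x y -> z t ->; reflexivity.
    + intros x y z; apply fmul_assoc.
Qed.

Ltac fps_cst t :=
  match t with
  | fZ ?z => match isZcst z with true => z | _ => constr:(NotConstant) end
  | _ => constr:(NotConstant)
  end.

Ltac fps_pow t :=
  match isnatcst t with true => constr:(N.of_nat t) | _ => constr:(InitialRing.NotConstant) end.

Add Ring fps_ring_inst : fps_ring
  (morphism fps_ring_morph, constants [fps_cst], power_tac fps_power [fps_pow]).


(* Twelve times the derivation [x d/dx], which makes Ramanujan's system integral. *)
Definition fD (a : fps) : fps := fun n => (12 * RtoC (INR n) * a n)%C.

Lemma coef_D (a : fps) n : fD a n = (12 * RtoC (INR n) * a n)%C.
Proof. reflexivity. Qed.

Lemma fD_add (a b : fps) : fD (a + b) = fD a + fD b.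
Proof. apply fps_ext; intros n; unfold fD, fadd; ring. Qed.
Lemma fD_sub (a b : fps) : fD (a - b) = fD a - fD b.
Proof. apply fps_ext; intros n; unfold fD, fsub; ring. Qed.
Lemma fD_opp (a : fps) : fD (- a) = - fD a.
Proof. apply fps_ext; intros n; unfold fD, fopp; ring. Qed.
Lemma fD_cst (c : C) : fD (fcst c) = fZ 0.
Proof.
  apply fps_ext; intros [|n]; unfold fD.
  - simpl; ring.
  - change (fcst c (S n)) with (RtoC 0); change (fZ 0 (S n)) with (RtoC 0); ring.
Qed.

Lemma fD_Z (z : Z) : fD (fZ z) = fZ 0.
Proof. apply fD_cst. Qed.

Lemma fD_mul (a b : fps) : fD (a * b) = fD a * b + a * fD b.
Proof.
  apply fps_ext; intros n; revert a; induction n as [|n IH]; intros a.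
  - unfold fD, fadd; rewrite !coef_mul0; simpl; ring.
  - rewrite coef_add, !coef_mulS.
    assert (E : shift (fD a) = fD (shift a) + fZ 12 * shift a).
    { apply fps_ext; intros k. unfold fZ. rewrite coef_add, fmul_scal_coef.
      unfold shift, fD. rewrite S_INR, RtoC_plus; ring. }
    rewrite E, coef_addl. unfold fZ; rewrite fscal_mul_coef.
    transitivity (12 * RtoC (INR (S n)) * (a 0%nat * b (S n)) +
      (12 * (shift a * b)%fps n + fD (shift a * b)%fps n))%C.
    + rewrite !coef_D, coef_mulS, S_INR, RtoC_plus. ring.
    + rewrite IH, coef_add, (coef_D a), (coef_D b). simpl (INR 0). ring.
Qed.

Lemma fD_pow (a : fps) n : fD (a ^ S n) = fZ (Z.of_nat (S n)) * a ^ n * fD a.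
Proof.
  induction n as [|n IH].
  - simpl. rewrite fD_mul. unfold fZ; rewrite fD_cst. simpl. ring.
  - change (a ^ S (S n)) with (a * a ^ S n). rewrite fD_mul, IH.
    replace (fZ (Z.of_nat (S (S n)))) with (fZ 1 + fZ (Z.of_nat (S n))).
    + change (a ^ S n) with (a * a ^ n). ring.
    + rewrite (Nat2Z.inj_succ (S n)), <- Z.add_1_l. symmetry; apply (morph_add fps_ring_morph).
Qed.

Definition vanish (n : nat) (a : fps) := forall k, (k < n)%nat -> a k = 0.

Lemma vanish_mul_coef (a b : fps) n : vanish n b -> (a * b) n = (a 0%nat * b n)%C.
Proof.
  intros H. rewrite fmul_comm. revert b H; induction n as [|n IH]; intros b H.
  - rewrite coef_mul0; ring.
  - rewrite coef_mulS, (H 0%nat), IH by (try lia; intros k Hk; apply H; lia).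
    unfold shift; ring.
Qed.

Lemma vanish_mul n (a b : fps) : vanish n b -> vanish n (a * b).
Proof.
  intros H k Hk. rewrite vanish_mul_coef, H; [ring|exact Hk|].
  intros i Hi; apply H; lia.
Qed.

Lemma vanish_all (a : fps) : (forall n, vanish n a -> a n = 0) -> a = fZ 0.
Proof.
  intros H. assert (G : forall n, vanish n a).
  { induction n as [|n IH]; intros k Hk; [lia|].
    destruct (Nat.eq_dec k n) as [->|]; [apply H, IH|apply IH; lia]. }
  apply fps_ext; intros n. rewrite (G (S n)) by lia. destruct n; reflexivity.
Qed.

Lemma fsub_eq0 (a b : fps) : a - b = fZ 0 -> a = b.
Proof. intros H. transitivity (a - b + b); [ring|rewrite H; ring]. Qed.

Lemma fmul_eq0 (a b : fps) : a 0%nat <> 0 -> a * b = fZ 0 -> b = fZ 0.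
Proof.
  intros Ha H. apply vanish_all; intros n Hn.
  pose proof (vanish_mul_coef a b n Hn) as E. rewrite H in E.
  assert (E0 : (a 0%nat * b n)%C = 0) by (rewrite <- E; destruct n; reflexivity).
  destruct (Ceq_dec (b n) 0) as [|Hb]; [assumption|].
  exfalso; exact (Cmult_neq_0 _ _ Ha Hb E0).
Qed.

Lemma fmul_cancel (a b c : fps) : a 0%nat <> 0 -> a * b = a * c -> b = c.
Proof.
  intros Ha H. apply fsub_eq0, (fmul_eq0 a); [exact Ha|].
  transitivity (a * b - a * c); [ring|rewrite H; ring].
Qed.

Lemma fpow_coef0 (a : fps) n : (a ^ n) 0%nat = (a 0%nat ^ n)%C.
Proof.
  induction n as [|n IH]; [reflexivity|].
  change (a ^ S n) with (a * a ^ n). rewrite coef_mul0, IH. reflexivity.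
Qed.

Lemma RtoC_neq0 (x : R) : x <> 0%R -> RtoC x <> 0.
Proof. intros H E; apply H, RtoC_inj, E. Qed.

Ltac c0 := repeat (rewrite ?coef_add, ?coef_sub, ?coef_opp, ?coef_mul0, ?fpow_coef0).

Lemma fsqr_inj (a b : fps) : a 0%nat = 1 -> b 0%nat = 1 -> a ^ 2 = b ^ 2 -> a = b.
Proof.
  intros Ha Hb H. apply fsub_eq0, (fmul_eq0 (a + b)).
  - c0; rewrite Ha, Hb, <- RtoC_plus. apply RtoC_neq0; lra.
  - transitivity (a ^ 2 - b ^ 2); [ring|rewrite H; ring].
Qed.

Lemma fcube_inj (a b : fps) : a 0%nat = 1 -> b 0%nat = 1 -> a ^ 3 = b ^ 3 -> a = b.
Proof.
  intros Ha Hb H. apply fsub_eq0, (fmul_eq0 (a ^ 2 + a * b + b ^ 2)).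
  - c0; rewrite Ha, Hb. replace (1 ^ 2 + 1 * 1 + 1 ^ 2)%C with (RtoC 3).
    + apply RtoC_neq0; lra.
    + ring.
  - transitivity (a ^ 3 - b ^ 3); [ring|rewrite H; ring].
Qed.

Definition agree (n : nat) (a b : fps) := forall k, (k < n)%nat -> a k = b k.

Lemma agree_sub n (a b : fps) : agree n a b <-> vanish n (a - b).
Proof.
  split; intros H k Hk; specialize (H k Hk).
  - rewrite coef_sub, H; ring.
  - rewrite coef_sub in H. apply Ceq_minus; exact H.
Qed.

Lemma agree_mul n (a b c e : fps) : agree n a b -> agree n c e -> agree n (a * c) (b * e).
Proof.
  rewrite !agree_sub; intros H1 H2 k Hk.
  replace (a * c - b * e) with (c * (a - b) + b * (c - e)) by ring.
  rewrite coef_add, (vanish_mul n), (vanish_mul n) by assumption. ring.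
Qed.

Lemma causal_fixpoint (F : fps -> fps) :
  (forall n a b, agree n a b -> F a n = F b n) -> exists a, a = F a.
Proof.
  intros HF. set (it := fix it n := match n with O => fZ 0 | S m => F (it m) end).
  assert (G : forall n i j, (n < i)%nat -> (n < j)%nat -> it i n = it j n).
  { intros n; induction n as [n IH] using lt_wf_ind; intros [|i] [|j] Hi Hj; try lia.
    simpl. apply HF; intros k Hk. apply IH; lia. }
  exists (fun n => it (S n) n). apply fps_ext; intros n.
  simpl. apply HF; intros k Hk. apply (G k n (S k)); lia.
Qed.

Definition trunc0 (a : fps) : fps := fun n => match n with O => 0 | S _ => a n end.


Lemma agree_trunc0 n (a b : fps) : agree n a b -> agree n (trunc0 a) (trunc0 b).
Proof. intros H [|k] Hk; [reflexivity|apply H; exact Hk]. Qed.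

Lemma agree_trunc0_mul n (a b c e : fps) :
  agree n a b -> agree n c e -> a 0%nat = 0 -> b 0%nat = 0 -> c 0%nat = 0 ->
  (a * c) n = (b * e) n.
Proof.
  rewrite !agree_sub; intros H1 H2 Ha Hb Hc. apply Ceq_minus.
  rewrite <- coef_sub. replace (a * c - b * e) with (c * (a - b) + b * (c - e)) by ring.
  rewrite coef_add, !vanish_mul_coef, Hc, Hb by assumption. ring.
Qed.

Lemma trunc0_add (a : fps) : a 0%nat = 1 -> a = fZ 1 + trunc0 a.
Proof.
  intros H; apply fps_ext; intros [|n]; unfold fZ; rewrite coef_add; simpl; [rewrite H|]; ring.
Qed.

Lemma fsqrt_exists (f : fps) : f 0%nat = 1 -> exists a : fps, a 0%nat = 1 /\ a ^ 2 = f.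
Proof.
  intros Hf.
  destruct (causal_fixpoint (fun b n =>
    match n with O => RtoC 1 | S _ => (/ 2 * (f n - (trunc0 b * trunc0 b)%fps n))%C end))
    as [a Ha].
  { intros [|n] b e H; [reflexivity|]. apply agree_trunc0 in H.
    rewrite (agree_trunc0_mul _ _ _ _ _ H H); reflexivity. }
  assert (H0 : a 0%nat = 1) by (rewrite Ha; reflexivity).
  exists a; split; [exact H0|].
  set (t := trunc0 a).
  assert (E : f = fZ 1 + fZ 2 * t + t * t).
  { apply fps_ext; intros n. unfold fZ. rewrite !coef_add, fmul_scal_coef.
    destruct n as [|n].
    - rewrite coef_mul0. simpl. rewrite Hf; ring.
    - unfold t at 1; simpl trunc0. rewrite Ha. fold t. simpl. field. }
  rewrite E, (trunc0_add a H0). fold t. ring.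
Qed.

Lemma fcbrt_exists (f : fps) : f 0%nat = 1 -> exists a : fps, a 0%nat = 1 /\ a ^ 3 = f.
Proof.
  intros Hf.
  destruct (causal_fixpoint (fun b n =>
    match n with O => RtoC 1 | S _ =>
      (/ 3 * (f n - (3 * (trunc0 b * trunc0 b)%fps n
                     + (trunc0 b * trunc0 b * trunc0 b)%fps n)))%C end))
    as [a Ha].
  { intros [|n] b e H; [reflexivity|]. apply agree_trunc0 in H.
    rewrite (agree_trunc0_mul _ _ _ _ _ H H) by reflexivity.
    rewrite (agree_trunc0_mul _ (trunc0 b * trunc0 b) (trunc0 e * trunc0 e) _ _
      (agree_mul _ _ _ _ _ H H) H); try reflexivity; rewrite coef_mul0; simpl; ring. }
  assert (H0 : a 0%nat = 1) by (rewrite Ha; reflexivity).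
  exists a; split; [exact H0|].
  set (t := trunc0 a).
  assert (E : f = fZ 1 + fZ 3 * t + fZ 3 * (t * t) + t * t * t).
  { apply fps_ext; intros n. unfold fZ. rewrite !coef_add, !fmul_scal_coef.
    destruct n as [|n].
    - rewrite !coef_mul0. simpl. rewrite Hf; ring.
    - unfold t at 1; simpl trunc0. rewrite Ha. fold t. simpl. field. }
  rewrite E, (trunc0_add a H0). fold t. ring.
Qed.

Lemma linear_ode_unique (S h : fps) m :
  S 0%nat = (12 * RtoC (INR m))%C -> fD h = S * h ->
  (forall k, (k <= m)%nat -> h k = 0) -> h = fZ 0.
Proof.
  intros HS Hh H0. apply vanish_all; intros n Hn.
  destruct (le_lt_dec n m) as [|Hm]; [apply H0; assumption|].
  pose proof (vanish_mul_coef S h n Hn) as E.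
  rewrite <- Hh, HS in E. unfold fD in E.
  assert (E' : (12 * RtoC (INR n - INR m) * h n)%C = 0).
  { rewrite RtoC_minus. transitivity (12 * RtoC (INR n) * h n - 12 * RtoC (INR m) * h n)%C.
    - ring.
    - rewrite E; ring. }
  destruct (Ceq_dec (h n) 0) as [|Hb]; [assumption|].
  exfalso; refine (Cmult_neq_0 _ _ (Cmult_neq_0 _ _ _ _) Hb E').
  - apply RtoC_neq0; lra.
  - apply RtoC_neq0. apply lt_INR in Hm. lra.
Qed.

Definition ramanujan (P Q R : fps) : Prop :=
  fD P = P ^ 2 - Q /\ fD Q = fZ 4 * (P * Q - R) /\ fD R = fZ 6 * (P * R - Q ^ 2).

Lemma ramanujan_coef0 (P Q R : fps) :
  ramanujan P Q R -> P 0%nat = 1 -> Q 0%nat = 1 /\ R 0%nat = 1.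
Proof.
  intros (H1 & H2 & _) HP.
  assert (HQ : Q 0%nat = 1).
  { apply (f_equal (fun a : fps => a 0%nat)) in H1. unfold fD in H1. revert H1; c0.
    rewrite HP. simpl. intros H1.
    transitivity (1 * (1 * 1) - (1 * (1 * 1) - Q 0%nat))%C; [ring|].
    rewrite <- H1. ring. }
  split; [exact HQ|].
  apply (f_equal (fun a : fps => a 0%nat)) in H2. unfold fD, fZ in H2. revert H2; c0.
  rewrite HP, HQ. simpl. intros H2.
  transitivity (1 - / 4 * (4 * (1 * 1 - R 0%nat)))%C; [field|].
  rewrite <- H2. ring.
Qed.

(* Linearising the difference of two solutions at the coefficient of [x^n], one is left with
   [n^2 (n - 1) p_n = 0]. *)
Lemma ramanujan_unique (P Q R X Y Z : fps) :
  ramanujan P Q R -> ramanujan X Y Z ->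
  P 0%nat = 1 -> X 0%nat = 1 -> P 1%nat = X 1%nat -> P = X.
Proof.
  intros HR HX HP0 HX0 H1.
  destruct (ramanujan_coef0 _ _ _ HR HP0) as [HQ0 HR0].
  destruct (ramanujan_coef0 _ _ _ HX HX0) as [HY0 HZ0].
  destruct HR as (R1 & R2 & R3), HX as (X1 & X2 & X3).
  set (p := P - X). set (q := Q - Y). set (r := R - Z).
  assert (D1 : fD p = (P + X) * p - q) by (unfold p, q; rewrite fD_sub, R1, X1; ring).
  assert (D2 : fD q = fZ 4 * (P * q + Y * p - r))
    by (unfold p, q, r; rewrite fD_sub, R2, X2; ring).
  assert (D3 : fD r = fZ 6 * (P * r + Z * p - (Q + Y) * q))
    by (unfold p, q, r; rewrite fD_sub, R3, X3; ring).
  assert (G : forall n, vanish n p /\ vanish n q /\ vanish n r).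
  { induction n as [|n (Vp & Vq & Vr)]; [repeat split; intros k Hk; lia|].
    apply (f_equal (fun a : fps => a n)) in D1, D2, D3.
    unfold fZ in D2, D3. rewrite fmul_scal_coef in D2, D3.
    rewrite coef_sub, vanish_mul_coef, coef_add, HP0, HX0 in D1 by assumption.
    rewrite coef_sub, coef_add, !vanish_mul_coef, HP0, HY0 in D2 by assumption.
    rewrite coef_sub, coef_add, !vanish_mul_coef, coef_add, HP0, HZ0, HQ0, HY0 in D3 by assumption.
    unfold fD in D1, D2, D3. set (N := RtoC (INR n)) in *.
    assert (Eq : q n = ((2 - 12 * N) * p n)%C).
    { transitivity ((1 + 1) * p n - ((1 + 1) * p n - q n))%C; [ring|rewrite <- D1; ring]. }
    assert (Er : r n = (p n + q n - 3 * N * q n)%C).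
    { transitivity (p n + q n - / 4 * (4 * (1 * q n + 1 * p n - r n)))%C; [field|].
      rewrite <- D2; field. }
    assert (E3 : (N * N * (N - 1) * p n)%C = 0).
    { transitivity (/ 432 * (12 * N * r n - 6 * (1 * r n + 1 * p n - (1 + 1) * q n)))%C.
      - rewrite Er, Eq. field.
      - rewrite D3. ring. }
    assert (Ep : p n = 0).
    { destruct n as [|[|n]].
      - unfold p; rewrite coef_sub, HP0, HX0; ring.
      - unfold p; rewrite coef_sub, H1; ring.
      - destruct (Ceq_dec (p (S (S n))) 0) as [|Hb]; [assumption|].
        exfalso; refine (Cmult_neq_0 _ _ _ Hb E3).
        pose proof (pos_INR n). unfold N. rewrite !S_INR, <- RtoC_minus, <- !RtoC_mult.
        apply RtoC_neq0. apply Rgt_not_eq.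
        apply Rmult_lt_0_compat; [apply Rmult_lt_0_compat|]; lra. }
    assert (Eq' : q n = 0) by (rewrite Eq, Ep; ring).
    assert (Er' : r n = 0) by (rewrite Er, Ep, Eq'; ring).
    repeat split; intros k Hk; destruct (Nat.eq_dec k n) as [->|]; auto;
      [apply Vp|apply Vq|apply Vr]; lia. }
  apply fsub_eq0, vanish_all. intros n _. apply (proj1 (G (S n))); lia.
Qed.

Lemma ramanujan_level2 (P a b w : fps) :
  w ^ 2 + w + fZ 1 = fZ 0 -> fD w = fZ 0 ->
  fD P = fZ 2 * (P ^ 2 - a * b) ->
  fD a = fZ 4 * (P * a - b ^ 2) -> fD b = fZ 4 * (P * b - a ^ 2) ->
  exists Y Z, ramanujan (fZ 2 * P + w * a + w ^ 2 * b) Y Z.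
Proof.
  intros Hw Dw DP Da Db.
  assert (Hw2 : w * w = - w - fZ 1).
  { transitivity (w ^ 2 + w + fZ 1 - w - fZ 1); [ring|rewrite Hw; ring]. }
  exists (fZ 5 * w ^ 2 * a ^ 2 + fZ 6 * a * b + fZ 5 * w * b ^ 2),
    (fZ 11 * (a ^ 3 + b ^ 3) + fZ 21 * a * b * (w * a + w ^ 2 * b)).
  repeat split; simpl fpow; fold (fZ 1);
    repeat rewrite ?fD_add, ?fD_mul, ?fD_Z, ?DP, ?Da, ?Db, ?Dw; ring [Hw2].
Qed.

Lemma ramanujan_level3 (P g h k : fps) :
  g ^ 4 + h ^ 4 + k ^ 4 = g ^ 2 * h ^ 2 + h ^ 2 * k ^ 2 + k ^ 2 * g ^ 2 ->
  fD P = fZ 3 * P ^ 2 - (g ^ 2 + h ^ 2 + k ^ 2) ->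
  fD g = fZ 6 * (P * g - h * k) -> fD h = fZ 6 * (P * h - k * g) ->
  fD k = fZ 6 * (P * k - g * h) ->
  exists Y Z, ramanujan (fZ 3 * P + fZ 2 * (g - h - k)) Y Z.
Proof.
  intros H4 DP Dg Dh Dk.
  exists (fZ 7 * (g ^ 2 + h ^ 2 + k ^ 2) + fZ 20 * (h * k - g * h - g * k)),
    (fZ 2 * (g - h - k) * (fZ 7 * (g ^ 2 + h ^ 2 + k ^ 2) + fZ 20 * (h * k - g * h - g * k))
     + fZ 63 * g * h * k
     + fZ 30 * (g * (h ^ 2 + k ^ 2) - h * (g ^ 2 + k ^ 2) - k * (g ^ 2 + h ^ 2))).
  assert (H4' : g * (g * (g * g)) =
    g ^ 2 * h ^ 2 + h ^ 2 * k ^ 2 + k ^ 2 * g ^ 2 - h ^ 4 - k ^ 4)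
    by (rewrite <- H4; ring).
  repeat split; simpl fpow in *; fold (fZ 1) in *;
    repeat rewrite ?fD_add, ?fD_sub, ?fD_mul, ?fD_Z, ?DP, ?Dg, ?Dh, ?Dk; ring [H4'].
Qed.

(** * Ramanujan's differential equations *)

Definition fX : fps := fun n => match n with 1%nat => 1 | _ => 0 end.

Lemma fX_mul_coef (a : fps) n : (fX * a) n = match n with O => 0 | S m => a m end.
Proof.
  destruct n as [|n]; [rewrite coef_mul0; simpl; ring|].
  rewrite coef_mulS. simpl (fX 0%nat).
  replace (shift fX) with (fcst 1).
  - rewrite fmul_1_l; ring.
  - apply fps_ext; intros [|k]; reflexivity.
Qed.

Lemma fXpow_mul_coef (a : fps) m n :
  (fX ^ m * a) n = if (n <? m)%nat then 0 else a (n - m)%nat.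
Proof.
  revert n; induction m as [|m IH]; intros n.
  - simpl fpow. rewrite fmul_1_l, Nat.sub_0_r. reflexivity.
  - replace (fX ^ S m * a) with (fX * (fX ^ m * a)) by (simpl fpow; ring).
    rewrite fX_mul_coef. destruct n as [|n]; [reflexivity|].
    rewrite IH. reflexivity.
Qed.

Lemma fpow_add (a : fps) m n : a ^ (m + n) = a ^ m * a ^ n.
Proof.
  induction m as [|m IH]; simpl; [rewrite fmul_1_l; reflexivity|rewrite IH; ring].
Qed.

Definition geo (a : nat) : fps := fun n => if (n mod a =? 0)%nat then 1 else 0.

Lemma geo_inv a : (0 < a)%nat -> (fZ 1 - fX ^ a) * geo a = fZ 1.
Proof.
  intros Ha. replace ((fZ 1 - fX ^ a) * geo a) with (geo a - fX ^ a * geo a) by ring.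
  apply fps_ext; intros n. rewrite coef_sub, fXpow_mul_coef. unfold geo.
  destruct (Nat.ltb_spec n a).
  - rewrite Nat.mod_small by assumption. destruct n; simpl; ring.
  - replace (n mod a) with ((n - a) mod a).
    + replace (fZ 1 n) with (RtoC 0) by (destruct n; [lia|reflexivity]). ring.
    + rewrite <- (Nat.Div0.mod_add (n - a) 1 a). f_equal; lia.
Qed.

(* [lam a] is the Lambert term [x^a / (1 - x^a)]. *)
Definition lam (a : nat) : fps := fX ^ a * geo a.

Lemma lam_coef a n : (0 < a)%nat ->
  lam a n = if (n <? a)%nat then 0 else if (n mod a =? 0)%nat then 1 else 0.
Proof.
  intros Ha. unfold lam. rewrite fXpow_mul_coef. unfold geo.
  destruct (Nat.ltb_spec n a); [reflexivity|].
  rewrite <- (Nat.Div0.mod_add (n - a) 1 a), Nat.mul_1_l, Nat.sub_add by assumption.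
  reflexivity.
Qed.

Lemma lam_vanish a : vanish a (lam a).
Proof.
  intros k Hk. unfold lam. rewrite fXpow_mul_coef.
  destruct (Nat.ltb_spec k a); [reflexivity|lia].
Qed.

Lemma lam_eq a : (0 < a)%nat -> (fZ 1 - fX ^ a) * lam a = fX ^ a.
Proof.
  intros Ha. unfold lam.
  transitivity (fX ^ a * ((fZ 1 - fX ^ a) * geo a)); [ring|rewrite geo_inv by assumption; ring].
Qed.

Lemma one_sub_fX_coef0 a : (0 < a)%nat -> (fZ 1 - fX ^ a) 0%nat = 1.
Proof.
  intros Ha. destruct a; [lia|]. c0. simpl. ring.
Qed.

Lemma lam_mul a b : (0 < a)%nat -> (0 < b)%nat ->
  lam a * lam b = lam (a + b) * (fZ 1 + lam a + lam b).
Proof.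
  intros Ha Hb.
  pose proof (lam_eq a Ha) as Ea. pose proof (lam_eq b Hb) as Eb.
  pose proof (lam_eq (a + b) ltac:(lia)) as Eab.
  rewrite fpow_add in Eab. set (A := fX ^ a) in *. set (B := fX ^ b) in *.
  apply (fmul_cancel ((fZ 1 - A) * (fZ 1 - B) * (fZ 1 - A * B))).
  - rewrite !coef_mul0. unfold A, B. rewrite <- fpow_add, !one_sub_fX_coef0 by lia.
    rewrite !Cmult_1_l. exact C1_nz.
  - transitivity (((fZ 1 - A) * lam a) * ((fZ 1 - B) * lam b) * (fZ 1 - A * B)); [ring|].
    transitivity (((fZ 1 - A * B) * lam (a + b)) *
      ((fZ 1 - A) * (fZ 1 - B) + ((fZ 1 - A) * lam a) * (fZ 1 - B)
       + (fZ 1 - A) * ((fZ 1 - B) * lam b))); [|ring].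
    rewrite Ea, Eb, Eab. ring.
Qed.

Lemma fD_fX_pow n : fD (fX ^ n) = fcst (12 * RtoC (INR n))%C * fX ^ n.
Proof.
  apply fps_ext; intros k. rewrite fmul_scal_coef, coef_D.
  replace (fX ^ n) with (fX ^ n * fZ 1) by ring. rewrite fXpow_mul_coef.
  destruct (Nat.ltb_spec k n); [ring|].
  destruct (Nat.eq_dec k n) as [->|]; [ring|].
  replace (fZ 1 (k - n)%nat) with (RtoC 0); [ring|].
  destruct (k - n)%nat eqn:E; [lia|reflexivity].
Qed.

Lemma fD_lam a : (0 < a)%nat ->
  fD (lam a) = fcst (12 * RtoC (INR a))%C * (lam a + lam a ^ 2).
Proof.
  intros Ha. pose proof (lam_eq a Ha) as Ea. pose proof (f_equal fD Ea) as E.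
  rewrite fD_mul, fD_sub, fD_Z, fD_fX_pow in E. set (A := fX ^ a) in *.
  apply (fmul_cancel (fZ 1 - A)).
  - unfold A; rewrite one_sub_fX_coef0 by assumption. exact C1_nz.
  - set (t := fcst _) in *.
    transitivity ((fZ 0 - t * A) * lam a + (fZ 1 - A) * fD (lam a) + t * A * lam a); [ring|].
    rewrite E.
    transitivity (t * (((fZ 1 - A) * lam a) * (fZ 1 + lam a))); [rewrite Ea|]; ring.
Qed.

(* [fsum F n = F 1 + ... + F n]. *)
Fixpoint fsum (F : nat -> fps) (n : nat) : fps :=
  match n with O => fZ 0 | S m => fsum F m + F n end.

Lemma fsum_ext F G n : (forall i, (1 <= i <= n)%nat -> F i = G i) -> fsum F n = fsum G n.
Proof.
  induction n as [|n IH]; intros H; [reflexivity|].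
  simpl. rewrite IH, H; [reflexivity|lia|intros i Hi; apply H; lia].
Qed.

Lemma fsum_add F G n : fsum (fun i => F i + G i) n = fsum F n + fsum G n.
Proof. induction n as [|n IH]; simpl; [|rewrite IH]; ring. Qed.

Lemma fsum_sub F G n : fsum (fun i => F i - G i) n = fsum F n - fsum G n.
Proof. induction n as [|n IH]; simpl; [|rewrite IH]; ring. Qed.

Lemma fsum_mull a F n : fsum (fun i => a * F i) n = a * fsum F n.
Proof. induction n as [|n IH]; simpl; [|rewrite IH]; ring. Qed.

Lemma fsum_mulr a F n : fsum (fun i => F i * a) n = fsum F n * a.
Proof. induction n as [|n IH]; simpl; [|rewrite IH]; ring. Qed.

Lemma fsum_mul F G m n :
  fsum (fun i => fsum (fun j => F i * G j) n) m = fsum F m * fsum G n.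
Proof.
  rewrite <- fsum_mulr. apply fsum_ext; intros i _. apply fsum_mull.
Qed.

Lemma fsum_first F n : fsum F (S n) = F 1%nat + fsum (fun i => F (S i)) n.
Proof.
  induction n as [|n IH]; [simpl; ring|].
  change (fsum F (S n) + F (S (S n)) = F 1%nat + (fsum (fun i => F (S i)) n + F (S (S n)))).
  rewrite IH; ring.
Qed.

Lemma fsum_rev F n : fsum (fun i => F (S n - i)%nat) n = fsum F n.
Proof.
  revert F; induction n as [|n IH]; intros F; [reflexivity|].
  rewrite fsum_first. simpl fsum at 2. rewrite <- (IH F).
  replace (S (S n) - 1)%nat with (S n) by lia.
  rewrite (fsum_ext (fun i => F (S (S n) - S i)%nat) (fun i => F (S n - i)%nat)).
  - ring.
  - intros i Hi. f_equal; lia.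
Qed.

Definition ftri (F : nat -> nat -> fps) n := fsum (fun c => fsum (fun b => F c b) (c - 1)) n.

Lemma fsum_sym F n : (forall a b, F a b = F b a) ->
  fsum (fun a => fsum (fun b => F a b) n) n = fZ 2 * ftri F n + fsum (fun a => F a a) n.
Proof.
  intros HF. unfold ftri. induction n as [|n IH]; [simpl; ring|].
  cbn [fsum]. rewrite fsum_add, IH, Nat.sub_succ, Nat.sub_0_r.
  rewrite (fsum_ext (fun i => F i (S n)) (fun i => F (S n) i)) by (intros; apply HF).
  ring.
Qed.

Lemma fsum_antidiag (F : nat -> nat -> fps) n :
  fsum (fun a => fsum (fun b => F a b) (n - a)) n = ftri (fun c b => F (c - b)%nat b) n.
Proof.
  unfold ftri. induction n as [|n IH]; [reflexivity|].
  cbn [fsum]. rewrite <- IH, Nat.sub_diag, Nat.sub_succ, Nat.sub_0_r. cbn [fsum].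
  rewrite (fsum_ext _ (fun a => fsum (fun b => F a b) (n - a) + F a (S n - a)%nat)).
  - rewrite fsum_add.
    rewrite <- (fsum_rev (fun b => F (S n - b)%nat b)).
    rewrite (fsum_ext (fun i => F (S n - (S n - i))%nat (S n - i)%nat) (fun a => F a (S n - a)%nat)).
    + ring.
    + intros i Hi. f_equal; lia.
  - intros a Ha. replace (S n - a)%nat with (S (n - a)) at 1 by lia. cbn [fsum].
    f_equal. f_equal. lia.
Qed.

Lemma agree_refl n a : agree n a a.
Proof. intros k _; reflexivity. Qed.
Lemma agree_trans n a b c : agree n a b -> agree n b c -> agree n a c.
Proof. intros H1 H2 k Hk; rewrite H1, H2 by assumption; reflexivity. Qed.
Lemma agree_symm n a b : agree n a b -> agree n b a.
Proof. intros H k Hk; rewrite H by assumption; reflexivity. Qed.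
Lemma agree_add n a b c e : agree n a b -> agree n c e -> agree n (a + c) (b + e).
Proof. intros H1 H2 k Hk; rewrite !coef_add, H1, H2 by assumption; reflexivity. Qed.

Lemma agree_fsum_trunc n F m k :
  (m <= k)%nat -> (forall i, (m < i)%nat -> vanish n (F i)) -> agree n (fsum F k) (fsum F m).
Proof.
  intros Hk HF; induction k as [|k IH].
  - replace m with 0%nat by lia. apply agree_refl.
  - destruct (Nat.eq_dec m (S k)) as [->|]; [apply agree_refl|].
    intros i Hi. cbn [fsum]. rewrite coef_add, (HF (S k)), IH by lia. ring.
Qed.

Lemma vanish_le m n a : (m <= n)%nat -> vanish n a -> vanish m a.
Proof. intros H Ha k Hk; apply Ha; lia. Qed.

Lemma lam_mul_vanish a b : vanish (a + b) (lam a * lam b).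
Proof.
  unfold lam. replace (fX ^ a * geo a * (fX ^ b * geo b)) with (fX ^ (a + b) * (geo a * geo b)).
  - intros k Hk. rewrite fXpow_mul_coef. destruct (Nat.ltb_spec k (a + b)); [reflexivity|lia].
  - rewrite fpow_add; ring.
Qed.

(* The source of the convolution identities: apply [lam_mul] to each product
   [lam a * lam b] in the double sum of [s a b * lam a * lam b]. *)
Lemma lambert_convolution (s G : nat -> nat -> C) n :
  (forall a b, s a b = s b a) -> (forall a b, G a b = G b a) ->
  (forall a b, G (a + b)%nat b = (s (a + b)%nat b - s a b)%C) ->
  agree (S n)
    (fsum (fun a => fsum (fun b => fcst (G a b) * (lam a * lam b)) n) n)
    (fsum (fun c => fsum (fun b => fcst (s (c - b)%nat b)) (c - 1) * lam c) n
     - fsum (fun a => fcst (s 0%nat a) * lam a ^ 2) n).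
Proof.
  intros Hs HG HGs.
  set (U := fun a b => fcst (s a b) * (lam a * lam b)).
  set (V := ftri (fun c b => fcst (s (c - b)%nat b) * (lam c * lam b)) n).
  assert (E1 : fsum (fun a => fsum (fun b => fcst (G a b) * (lam a * lam b)) n) n
    = fsum (fun a => fsum (fun b => U a b) n) n - fZ 2 * V
      - fsum (fun a => fcst (s 0%nat a) * lam a ^ 2) n).
  { rewrite fsum_sym by (intros a b; rewrite HG; ring).
    rewrite (fsum_sym U) by (intros a b; unfold U; rewrite Hs; ring).
    assert (D : ftri (fun a b => fcst (G a b) * (lam a * lam b)) n = ftri U n - V).
    { unfold V, ftri. rewrite <- fsum_sub. apply fsum_ext; intros c Hc.
      rewrite <- fsum_sub. apply fsum_ext; intros b Hb.
      replace (G c b) with (s c b - s (c - b)%nat b)%C.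
      - unfold U. rewrite fcst_sub. ring.
      - rewrite <- (Nat.sub_add b c) at 1 3 by lia. symmetry; apply HGs. }
    rewrite D.
    replace (fsum (fun a => fcst (G a a) * (lam a * lam a)) n) with
      (fsum (fun a => U a a) n - fsum (fun a => fcst (s 0%nat a) * lam a ^ 2) n).
    - ring.
    - rewrite <- fsum_sub. apply fsum_ext; intros a Ha.
      replace (G a a) with (s a a - s 0%nat a)%C by (symmetry; apply (HGs 0%nat a)).
      unfold U. rewrite fcst_sub. ring. }
  assert (E2 : ftri (fun c b => U (c - b)%nat b) n =
    fsum (fun c => fsum (fun b => fcst (s (c - b)%nat b)) (c - 1) * lam c) n + fZ 2 * V).
  { transitivity (fsum (fun c => fsum (fun b => fcst (s (c - b)%nat b)) (c - 1) * lam c) n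
      + ftri (fun c b => fcst (s (c - b)%nat b) * (lam c * lam (c - b)%nat)) n + V).
    - unfold V, ftri. rewrite <- !fsum_add. apply fsum_ext; intros c Hc.
      rewrite <- fsum_mulr, <- !fsum_add. apply fsum_ext; intros b Hb.
      unfold U. rewrite lam_mul, Nat.sub_add by lia. ring.
    - replace (ftri (fun c b => fcst (s (c - b)%nat b) * (lam c * lam (c - b)%nat)) n) with V.
      + ring.
      + unfold V, ftri. apply fsum_ext; intros c Hc.
        rewrite <- (fsum_rev (fun b => fcst (s (c - b)%nat b) * (lam c * lam b))).
        apply fsum_ext; intros b Hb.
        replace (S (c - 1) - b)%nat with (c - b)%nat by lia.
        replace (c - (c - b))%nat with b by lia. rewrite Hs. reflexivity. }
  rewrite E1. apply agree_sub.
  assert (E3 : agree (S n) (fsum (fun a => fsum (fun b => U a b) n) n)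
    (ftri (fun c b => U (c - b)%nat b) n)).
  { rewrite <- fsum_antidiag.
    assert (H : forall m, (m <= n)%nat -> agree (S n) (fsum (fun a => fsum (fun b => U a b) n) m)
      (fsum (fun a => fsum (fun b => U a b) (n - a)) m)).
    { induction m as [|m IH]; intros Hm; [apply agree_refl|].
      cbn [fsum]. apply agree_add; [apply IH; lia|].
      apply agree_fsum_trunc; [lia|]. intros i Hi. apply vanish_mul.
      apply (vanish_le _ (S m + i)); [lia|apply lam_mul_vanish]. }
    apply H; lia. }
  rewrite agree_sub, E2 in E3.
  match type of E3 with vanish _ ?e => match goal with |- vanish _ ?e' =>
    replace e' with e by ring end end. exact E3.
Qed.

Definition cn (n : nat) : C := RtoC (INR n).

Lemma cn_add a b : cn (a + b) = (cn a + cn b)%C.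
Proof. unfold cn; rewrite plus_INR, RtoC_plus; reflexivity. Qed.
Lemma cn_S a : cn (S a) = (cn a + 1)%C.
Proof. unfold cn; rewrite S_INR, RtoC_plus; reflexivity. Qed.
Lemma cn_sub a b : (b <= a)%nat -> cn (a - b) = (cn a - cn b)%C.
Proof. intros H; unfold cn; rewrite minus_INR, RtoC_minus by assumption; reflexivity. Qed.

Fixpoint csum (f : nat -> C) (n : nat) : C :=
  match n with O => 0 | S m => (csum f m + f n)%C end.

Lemma csum_ext f g n : (forall i, (1 <= i <= n)%nat -> f i = g i) -> csum f n = csum g n.
Proof.
  induction n as [|n IH]; intros H; [reflexivity|].
  simpl. rewrite IH, H; [reflexivity|lia|intros i Hi; apply H; lia].
Qed.

Lemma fsum_fcst f n : fsum (fun b => fcst (f b)) n = fcst (csum f n).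
Proof. induction n as [|n IH]; simpl; [reflexivity|rewrite IH, fcst_add; reflexivity]. Qed.

Lemma csum_form1 c : (1 <= c)%nat ->
  csum (fun b => cn (c - b) ^ 2 + cn (c - b) * cn b + cn b ^ 2)%C (c - 1)
  = ((5 * cn c ^ 3 - 6 * cn c ^ 2 + cn c) / 6)%C.
Proof.
  intros Hc.
  assert (H : forall x m, csum (fun b => (x - cn b) ^ 2 + (x - cn b) * cn b + cn b ^ 2)%C m =
    (x ^ 2 * cn m - x * (cn m * (cn m + 1) / 2) + cn m * (cn m + 1) * (2 * cn m + 1) / 6)%C).
  { intros x; induction m as [|m IH]; [unfold cn; simpl; field|].
    cbn [csum]. rewrite IH, cn_S. field. }
  rewrite (csum_ext _ (fun b => (cn c - cn b) ^ 2 + (cn c - cn b) * cn b + cn b ^ 2)%C).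
  - rewrite H, cn_sub by assumption. change (cn 1) with (RtoC 1). field.
  - intros i Hi. rewrite cn_sub by lia. reflexivity.
Qed.

Lemma csum_form2 c : (1 <= c)%nat ->
  csum (fun b => (cn (c - b) ^ 2 + cn (c - b) * cn b + cn b ^ 2) ^ 2)%C (c - 1)
  = ((21 * cn c ^ 5 - 30 * cn c ^ 4 + 10 * cn c ^ 3 - cn c) / 30)%C.
Proof.
  intros Hc.
  assert (H : forall x m, csum (fun b => ((x - cn b) ^ 2 + (x - cn b) * cn b + cn b ^ 2) ^ 2)%C m =
    (let M := cn m in x ^ 4 * M - 2 * x ^ 3 * (M * (M + 1) / 2)
     + 3 * x ^ 2 * (M * (M + 1) * (2 * M + 1) / 6) - 2 * x * (M * (M + 1) / 2) ^ 2
     + M * (M + 1) * (2 * M + 1) * (3 * M ^ 2 + 3 * M - 1) / 30)%C).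
  { intros x; induction m as [|m IH]; [unfold cn; simpl; field|].
    cbn [csum]. rewrite IH. cbv zeta. rewrite cn_S. field. }
  rewrite (csum_ext _ (fun b => ((cn c - cn b) ^ 2 + (cn c - cn b) * cn b + cn b ^ 2) ^ 2)%C).
  - rewrite H, cn_sub by assumption. cbv zeta. change (cn 1) with (RtoC 1). field.
  - intros i Hi. rewrite cn_sub by lia. reflexivity.
Qed.

Lemma csum_form3 c : (1 <= c)%nat ->
  csum (fun b => (cn (c - b) ^ 2 + cn (c - b) * cn b + cn b ^ 2) ^ 3)%C (c - 1)
  = ((249 * cn c ^ 7 - 420 * cn c ^ 6 + 210 * cn c ^ 5 - 49 * cn c ^ 3 + 10 * cn c) / 420)%C.
Proof.
  intros Hc.
  assert (H : forall x m, csum (fun b => ((x - cn b) ^ 2 + (x - cn b) * cn b + cn b ^ 2) ^ 3)%C m =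
    (let M := cn m in x ^ 6 * M - 3 * x ^ 5 * (M * (M + 1) / 2)
     + 6 * x ^ 4 * (M * (M + 1) * (2 * M + 1) / 6) - 7 * x ^ 3 * (M * (M + 1) / 2) ^ 2
     + 6 * x ^ 2 * (M * (M + 1) * (2 * M + 1) * (3 * M ^ 2 + 3 * M - 1) / 30)
     - 3 * x * (M ^ 2 * (M + 1) ^ 2 * (2 * M ^ 2 + 2 * M - 1) / 12)
     + M * (M + 1) * (2 * M + 1) * (3 * M ^ 4 + 6 * M ^ 3 - 3 * M + 1) / 42)%C).
  { intros x; induction m as [|m IH]; [unfold cn; simpl; field|].
    cbn [csum]. rewrite IH. cbv zeta. rewrite cn_S. field. }
  rewrite (csum_ext _ (fun b => ((cn c - cn b) ^ 2 + (cn c - cn b) * cn b + cn b ^ 2) ^ 3)%C).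
  - rewrite H, cn_sub by assumption. cbv zeta. change (cn 1) with (RtoC 1). field.
  - intros i Hi. rewrite cn_sub by lia. reflexivity.
Qed.

Lemma csum_form4 c : (1 <= c)%nat ->
  csum (fun b => cn (c - b) ^ 2 * cn b ^ 2 * (cn (c - b) + cn b) ^ 2)%C (c - 1)
  = ((cn c ^ 7 - cn c ^ 3) / 30)%C.
Proof.
  intros Hc.
  assert (H : forall x m, csum (fun b => (x - cn b) ^ 2 * cn b ^ 2 * (x - cn b + cn b) ^ 2)%C m =
    (let M := cn m in x ^ 4 * (M * (M + 1) * (2 * M + 1) / 6) - 2 * x ^ 3 * (M * (M + 1) / 2) ^ 2
     + x ^ 2 * (M * (M + 1) * (2 * M + 1) * (3 * M ^ 2 + 3 * M - 1) / 30))%C).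
  { intros x; induction m as [|m IH]; [unfold cn; simpl; field|].
    cbn [csum]. rewrite IH. cbv zeta. rewrite cn_S. field. }
  rewrite (csum_ext _ (fun b => (cn c - cn b) ^ 2 * cn b ^ 2 * (cn c - cn b + cn b) ^ 2)%C).
  - rewrite H, cn_sub by assumption. cbv zeta. change (cn 1) with (RtoC 1). field.
  - intros i Hi. rewrite cn_sub by lia. reflexivity.
Qed.

Definition Sig (i : nat) : fps := fun n => RtoC (INR (Defs.sigma i n)).
Definition lamsum (i n : nat) : fps := fsum (fun a => fcst (cn a ^ i)%C * lam a) n.

Lemma lamsum_agree i n : agree (S n) (lamsum i n) (Sig i).
Proof.
  intros k Hk.
  assert (H : forall m, (m <= k)%nat -> lamsum i m k =
    RtoC (INR (list_sum (map (fun d => Nat.pow d i)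
      (filter (fun d => Nat.eqb (Nat.modulo k d) 0) (seq 1 m)))))).
  { induction m as [|m IH]; intros Hm.
    - unfold lamsum; simpl fsum. destruct k; reflexivity.
    - unfold lamsum in *; cbn [fsum]. rewrite coef_add, IH, fmul_scal_coef, lam_coef by lia.
      rewrite seq_S, filter_app, map_app, list_sum_app, plus_INR, RtoC_plus. f_equal.
      destruct (Nat.ltb_spec k (S m)); [lia|]. cbn [filter Nat.add].
      destruct (Nat.eqb (k mod S m) 0).
      + cbn [map list_sum fold_right]. rewrite Nat.add_0_r, pow_INR, RtoC_pow. unfold cn; ring.
      + simpl; ring. }
  unfold Sig, Defs.sigma. rewrite <- H by lia. unfold lamsum.
  apply (agree_fsum_trunc (S k)); try lia.
  intros j Hj. apply vanish_mul. apply (vanish_le _ j); [lia|apply lam_vanish].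
Qed.

Lemma agree_fD n a b : agree n a b -> agree n (fD a) (fD b).
Proof. intros H k Hk. rewrite !coef_D, H by assumption; reflexivity. Qed.

Lemma agree_subtract n a b c e : agree n a b -> agree n c e -> agree n (a - c) (b - e).
Proof. intros H1 H2 k Hk; rewrite !coef_sub, H1, H2 by assumption; reflexivity. Qed.

Lemma lam_sqr_sum i n :
  fsum (fun a => fcst (12 * cn a ^ S i)%C * lam a ^ 2) n
  = fD (lamsum i n) - fZ 12 * lamsum (S i) n.
Proof.
  unfold lamsum. induction n as [|n IH].
  - cbn [fsum]. rewrite fD_Z. ring.
  - cbn [fsum]. rewrite IH, fD_add, fD_mul, fD_cst, fD_lam by lia.
    replace (fcst (cn (S n) ^ S i)%C) with (fcst (cn (S n)) * fcst (cn (S n) ^ i)%C)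
      by (rewrite <- fcst_mul; reflexivity).
    replace (fcst (12 * cn (S n) ^ S i)%C) with
      (fZ 12 * fcst (cn (S n)) * fcst (cn (S n) ^ i)%C)
      by (unfold fZ; rewrite <- !fcst_mul; f_equal; simpl Cpow; ring).
    replace (fcst (12 * RtoC (INR (S n)))%C) with (fZ 12 * fcst (cn (S n)))
      by (unfold fZ; rewrite <- !fcst_mul; reflexivity).
    ring.
Qed.

Lemma fsum_prod c i j n :
  fsum (fun a => fsum (fun b => fcst (c * (cn a ^ i * cn b ^ j))%C * (lam a * lam b)) n) n
  = fcst c * (lamsum i n * lamsum j n).
Proof.
  unfold lamsum. rewrite <- fsum_mul, <- fsum_mull. apply fsum_ext; intros a _.
  rewrite <- fsum_mull. apply fsum_ext; intros b _. rewrite !fcst_mul; ring.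
Qed.

Lemma fsum2_add (f g : nat -> nat -> C) n :
  fsum (fun a => fsum (fun b => fcst (f a b + g a b)%C * (lam a * lam b)) n) n
  = fsum (fun a => fsum (fun b => fcst (f a b) * (lam a * lam b)) n) n
    + fsum (fun a => fsum (fun b => fcst (g a b) * (lam a * lam b)) n) n.
Proof.
  rewrite <- fsum_add. apply fsum_ext; intros a _.
  rewrite <- fsum_add. apply fsum_ext; intros b _. rewrite fcst_add; ring.
Qed.

Lemma agree_fps (a b : fps) : (forall n, agree (S n) a b) -> a = b.
Proof. intros H; apply fps_ext; intros n; apply (H n); lia. Qed.

Ltac to_lamsum :=
  match goal with
  | |- agree _ ?a ?a => apply agree_refl
  | |- agree _ (lamsum _ _) _ => apply lamsum_agree
  | |- agree _ (_ + _) _ => apply agree_add; to_lamsum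
  | |- agree _ (_ - _) _ => apply agree_subtract; to_lamsum
  | |- agree _ (_ * _) _ => apply agree_mul; to_lamsum
  | |- agree _ (fD _) _ => apply agree_fD; to_lamsum
  end.

Ltac fcoef := apply fps_ext; intros ?k; unfold fZ; repeat rewrite ?coef_add, ?coef_sub, ?fmul_scal_coef.

Lemma lambert_convolution_poly (s G : nat -> nat -> C) (p : nat -> C) n :
  (forall a b, s a b = s b a) -> (forall a b, G a b = G b a) ->
  (forall a b, G (a + b)%nat b = (s (a + b)%nat b - s a b)%C) ->
  (forall c, (1 <= c)%nat -> csum (fun b => s (c - b)%nat b) (c - 1) = p c) ->
  agree (S n)
    (fsum (fun a => fsum (fun b => fcst (G a b) * (lam a * lam b)) n) n)
    (fsum (fun c => fcst (p c) * lam c) n - fsum (fun a => fcst (s 0%nat a) * lam a ^ 2) n).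
Proof.
  intros H1 H2 H3 H4. eapply agree_trans; [apply (lambert_convolution s G n); assumption|].
  apply agree_subtract; [|apply agree_refl].
  intros k _. apply (f_equal (fun f : fps => f k)). apply fsum_ext; intros c Hc.
  rewrite fsum_fcst, H4 by lia. reflexivity.
Qed.

Lemma agree_eq n a b : a = b -> agree n a b.
Proof. intros ->; apply agree_refl. Qed.

Lemma agree_scale n z a b : agree n a b -> agree n (fZ z * a) (fZ z * b).
Proof. apply agree_mul, agree_refl. Qed.

Lemma Sig1_sqr : fZ 24 * (Sig 1 * Sig 1) = fZ 10 * Sig 3 + fZ 2 * Sig 1 - fD (Sig 1).
Proof.
  apply agree_fps; intros n.
  apply (agree_trans _ _ (fZ 24 * (lamsum 1 n * lamsum 1 n))); [apply agree_symm; to_lamsum|].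
  apply (agree_trans _ _ (fZ 10 * lamsum 3 n + fZ 2 * lamsum 1 n - fD (lamsum 1 n)));
    [|to_lamsum].
  pose proof (lambert_convolution_poly (fun a b => cn a ^ 2 + cn a * cn b + cn b ^ 2)%C
    (fun a b => 2 * (cn a ^ 1 * cn b ^ 1))%C _ n
    ltac:(intros; cbv beta; ring) ltac:(intros; cbv beta; ring)
    ltac:(intros; cbv beta; rewrite !cn_add; ring) csum_form1) as H.
  apply (agree_scale _ 12) in H. cbv beta in H. rewrite fsum_prod in H.
  eapply agree_trans; [apply agree_eq|eapply agree_trans; [exact H|apply agree_eq]].
  - unfold fZ; ring_simplify; fold (fZ 12) (fZ 2) (fZ 24); ring.
  - transitivity (fZ 10 * lamsum 3 n + fZ 2 * lamsum 1 n - fZ 12 * lamsum 2 n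
      - fsum (fun a => fcst (12 * cn a ^ 2)%C * lam a ^ 2) n);
      [|rewrite lam_sqr_sum; ring].
    unfold lamsum. repeat rewrite <- ?fsum_mull, <- ?fsum_add, <- ?fsum_sub.
    apply fsum_ext; intros a _. change (cn 0) with (RtoC 0).
    fcoef. field.
Qed.

Lemma Sig13 : fZ 480 * (Sig 1 * Sig 3)
  = fZ 42 * Sig 5 + fZ 20 * Sig 3 - fZ 2 * Sig 1 - fZ 5 * fD (Sig 3).
Proof.
  apply agree_fps; intros n.
  apply (agree_trans _ _ (fZ 480 * (lamsum 1 n * lamsum 3 n))); [apply agree_symm; to_lamsum|].
  apply (agree_trans _ _ (fZ 42 * lamsum 5 n + fZ 20 * lamsum 3 n - fZ 2 * lamsum 1 n
    - fZ 5 * fD (lamsum 3 n))); [|to_lamsum].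
  pose proof (lambert_convolution_poly (fun a b => (cn a ^ 2 + cn a * cn b + cn b ^ 2) ^ 2)%C
    (fun a b => 4 * (cn a ^ 1 * cn b ^ 3) + 4 * (cn a ^ 3 * cn b ^ 1))%C _ n
    ltac:(intros; cbv beta; ring) ltac:(intros; cbv beta; ring)
    ltac:(intros; cbv beta; rewrite !cn_add; ring) csum_form2) as H.
  apply (agree_scale _ 60) in H. cbv beta in H. rewrite fsum2_add, !fsum_prod in H.
  eapply agree_trans; [apply agree_eq|eapply agree_trans; [exact H|apply agree_eq]].
  - fold (fZ 4); ring.
  - transitivity (fZ 42 * lamsum 5 n - fZ 60 * lamsum 4 n + fZ 20 * lamsum 3 n
      - fZ 2 * lamsum 1 n
      - fZ 5 * fsum (fun a => fcst (12 * cn a ^ 4)%C * lam a ^ 2) n);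
      [|rewrite lam_sqr_sum; ring].
    unfold lamsum. repeat rewrite <- ?fsum_mull, <- ?fsum_add, <- ?fsum_sub.
    apply fsum_ext; intros a _. change (cn 0) with (RtoC 0).
    fcoef. field.
Qed.

Lemma Sig33 : fZ 120 * (Sig 3 * Sig 3) = Sig 7 - Sig 3.
Proof.
  apply agree_fps; intros n.
  apply (agree_trans _ _ (fZ 120 * (lamsum 3 n * lamsum 3 n))); [apply agree_symm; to_lamsum|].
  apply (agree_trans _ _ (lamsum 7 n - lamsum 3 n)); [|to_lamsum].
  pose proof (lambert_convolution_poly (fun a b => cn a ^ 2 * cn b ^ 2 * (cn a + cn b) ^ 2)%C
    (fun a b => 4 * (cn a ^ 3 * cn b ^ 3))%C _ n
    ltac:(intros; cbv beta; ring) ltac:(intros; cbv beta; ring)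
    ltac:(intros; cbv beta; rewrite !cn_add; ring) csum_form4) as H.
  apply (agree_scale _ 30) in H. cbv beta in H. rewrite fsum_prod in H.
  eapply agree_trans; [apply agree_eq|eapply agree_trans; [exact H|apply agree_eq]].
  - fold (fZ 4); ring.
  - unfold lamsum. repeat rewrite <- ?fsum_sub, <- ?fsum_mull.
    apply fsum_ext; intros a _. change (cn 0) with (RtoC 0).
    fcoef. field.
Qed.

Lemma Sig15 : fZ 5040 * (Sig 1 * Sig 5) + fZ 5880 * (Sig 3 * Sig 3)
  = fZ 249 * Sig 7 + fZ 210 * Sig 5 - fZ 49 * Sig 3 + fZ 10 * Sig 1 - fZ 35 * fD (Sig 5).
Proof.
  apply agree_fps; intros n.
  apply (agree_trans _ _ (fZ 5040 * (lamsum 1 n * lamsum 5 n) + fZ 5880 * (lamsum 3 n * lamsum 3 n)));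
    [apply agree_symm; to_lamsum|].
  apply (agree_trans _ _ (fZ 249 * lamsum 7 n + fZ 210 * lamsum 5 n - fZ 49 * lamsum 3 n
    + fZ 10 * lamsum 1 n - fZ 35 * fD (lamsum 5 n))); [|to_lamsum].
  pose proof (lambert_convolution_poly (fun a b => (cn a ^ 2 + cn a * cn b + cn b ^ 2) ^ 3)%C
    (fun a b => 6 * (cn a ^ 1 * cn b ^ 5) + 6 * (cn a ^ 5 * cn b ^ 1)
      + 14 * (cn a ^ 3 * cn b ^ 3))%C _ n
    ltac:(intros; cbv beta; ring) ltac:(intros; cbv beta; ring)
    ltac:(intros; cbv beta; rewrite !cn_add; ring) csum_form3) as H.
  apply (agree_scale _ 420) in H. cbv beta in H. rewrite !fsum2_add, !fsum_prod in H.
  eapply agree_trans; [apply agree_eq|eapply agree_trans; [exact H|apply agree_eq]].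
  - fold (fZ 6) (fZ 14); ring.
  - transitivity (fZ 249 * lamsum 7 n - fZ 420 * lamsum 6 n + fZ 210 * lamsum 5 n
      - fZ 49 * lamsum 3 n + fZ 10 * lamsum 1 n
      - fZ 35 * fsum (fun a => fcst (12 * cn a ^ 6)%C * lam a ^ 2) n);
      [|rewrite lam_sqr_sum; ring].
    unfold lamsum. repeat rewrite <- ?fsum_mull, <- ?fsum_add, <- ?fsum_sub.
    apply fsum_ext; intros a _. change (cn 0) with (RtoC 0).
    fcoef. field.
Qed.

Definition fE2 : fps := fZ 1 - fZ 24 * Sig 1.
Definition fE4 : fps := fZ 1 + fZ 240 * Sig 3.
Definition fE6 : fps := fZ 1 - fZ 504 * Sig 5.

Lemma fZ_cancel z (a b : fps) : z <> 0%Z -> fZ z * a = fZ z * b -> a = b.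
Proof.
  intros Hz. apply fmul_cancel. apply RtoC_neq0. apply not_0_IZR; exact Hz.
Qed.

Lemma ramanujan_fE : ramanujan fE2 fE4 fE6.
Proof.
  pose proof Sig1_sqr as H1. pose proof Sig13 as H2. pose proof Sig33 as H3.
  pose proof Sig15 as H4.
  unfold ramanujan, fE2, fE4, fE6. repeat rewrite ?fD_add, ?fD_sub, ?fD_mul, ?fD_Z.
  repeat split.
  - transitivity (fZ 0 - fZ 24 * (fZ 10 * Sig 3 + fZ 2 * Sig 1 - (fZ 10 * Sig 3 + fZ 2 * Sig 1 - fD (Sig 1)))); [ring|].
    rewrite <- H1. ring.
  - transitivity (fZ 48 * (fZ 42 * Sig 5 + fZ 20 * Sig 3 - fZ 2 * Sig 1
      - (fZ 42 * Sig 5 + fZ 20 * Sig 3 - fZ 2 * Sig 1 - fZ 5 * fD (Sig 3)))); [ring|].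
    rewrite <- H2. ring.
  - apply (fZ_cancel 5); [lia|].
    assert (H7 : Sig 7 = fZ 120 * (Sig 3 * Sig 3) + Sig 3) by (rewrite H3; ring).
    rewrite H7 in H4.
    match type of H4 with ?l = ?r =>
      transitivity (fZ 72 * (l - r) - fZ 2520 * fD (Sig 5)); [rewrite H4|]; ring end.
Qed.

(** * The identities of level two and three *)

(* [fV m a] is [a(x^m)]. *)
Definition fV (m : nat) (a : fps) : fps :=
  fun n => if (n mod m =? 0)%nat then a (n / m)%nat else 0.

Lemma fV_add m a b : fV m (a + b) = fV m a + fV m b.
Proof.
  apply fps_ext; intros n; unfold fV, fadd. destruct (n mod m =? 0)%nat; [|ring].
  reflexivity.
Qed.

Lemma fV_sub m a b : fV m (a - b) = fV m a - fV m b.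
Proof.
  apply fps_ext; intros n; unfold fV, fsub. destruct (n mod m =? 0)%nat; [|ring].
  reflexivity.
Qed.

Lemma fV_scal m c a : fV m (fcst c * a) = fcst c * fV m a.
Proof.
  apply fps_ext; intros n. rewrite fmul_scal_coef. unfold fV.
  rewrite fmul_scal_coef. destruct (n mod m =? 0)%nat; ring.
Qed.

Lemma fV_fX_mul m a : (0 < m)%nat -> fV m (fX * a) = fX ^ m * fV m a.
Proof.
  intros Hm. apply fps_ext; intros n. rewrite fXpow_mul_coef. unfold fV. rewrite fX_mul_coef.
  destruct (Nat.ltb_spec n m) as [H|H].
  - rewrite Nat.div_small by assumption. destruct (n mod m =? 0)%nat; reflexivity.
  - assert (E : n = (n - m + 1 * m)%nat) by lia.
    replace (n mod m) with ((n - m) mod m)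
      by (rewrite E at 2; rewrite Nat.Div0.mod_add; reflexivity).
    replace (n / m)%nat with (S ((n - m) / m))
      by (rewrite E at 2; rewrite Nat.div_add by lia; lia).
    reflexivity.
Qed.

Lemma fps_decomp (a : fps) : a = fcst (a 0%nat) + fX * shift a.
Proof.
  apply fps_ext; intros n. rewrite coef_add, fX_mul_coef.
  destruct n; simpl; unfold shift; ring.
Qed.

Lemma fV_cst m c : (0 < m)%nat -> fV m (fcst c) = fcst c.
Proof.
  intros Hm. apply fps_ext; intros n. unfold fV.
  destruct n as [|n]; [rewrite Nat.Div0.mod_0_l, Nat.Div0.div_0_l; reflexivity|].
  destruct (Nat.eqb_spec (S n mod m) 0) as [E|E]; [|reflexivity].
  destruct (S n / m)%nat eqn:D; [|reflexivity].
  exfalso. pose proof (Nat.div_mod_eq (S n) m). rewrite E, D in H. lia.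
Qed.

Lemma fV_decomp m a : (0 < m)%nat -> fV m a = fcst (a 0%nat) + fX ^ m * fV m (shift a).
Proof.
  intros Hm. rewrite (fps_decomp a) at 1. rewrite fV_add, fV_fX_mul, fV_cst by assumption.
  reflexivity.
Qed.

Lemma fV_mul m a b : (0 < m)%nat -> fV m (a * b) = fV m a * fV m b.
Proof.
  intros Hm. apply fps_ext; intros n; revert a.
  induction n as [n IH] using lt_wf_ind; intros a.
  assert (E1 : fV m (a * b) = fcst (a 0%nat) * fV m b + fX ^ m * fV m (shift a * b)).
  { rewrite (fps_decomp a) at 1.
    replace ((fcst (a 0%nat) + fX * shift a) * b) with
      (fcst (a 0%nat) * b + fX * (shift a * b)) by ring.
    rewrite fV_add, fV_scal, fV_fX_mul by assumption. reflexivity. }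
  assert (E2 : fV m a * fV m b = fcst (a 0%nat) * fV m b + fX ^ m * (fV m (shift a) * fV m b)).
  { rewrite (fV_decomp m a) by assumption. ring. }
  rewrite E1, E2, !coef_add, !fXpow_mul_coef. f_equal.
  destruct (Nat.ltb_spec n m); [reflexivity|]. apply IH; lia.
Qed.

Lemma fV_Z m z : (0 < m)%nat -> fV m (fZ z) = fZ z.
Proof. apply fV_cst. Qed.

Lemma fV_pow m a i : (0 < m)%nat -> fV m (a ^ i) = fV m a ^ i.
Proof.
  intros Hm; induction i as [|i IH]; [apply fV_cst; exact Hm|].
  cbn [fpow]. rewrite fV_mul, IH by assumption. reflexivity.
Qed.

Lemma fV_fX m : (0 < m)%nat -> fV m fX = fX ^ m.
Proof.
  intros Hm. transitivity (fV m (fX * fZ 1)); [f_equal; ring|].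
  rewrite fV_fX_mul, fV_Z by assumption. ring.
Qed.

Lemma fD_fV m a : (0 < m)%nat -> fD (fV m a) = fZ (Z.of_nat m) * fV m (fD a).
Proof.
  intros Hm. apply fps_ext; intros n. unfold fZ. rewrite fmul_scal_coef.
  unfold fV, fD. destruct (Nat.eqb_spec (n mod m) 0) as [E|E]; [|ring].
  rewrite <- INR_IZR_INZ.
  pose proof (Nat.div_mod_eq n m) as D. rewrite E, Nat.add_0_r in D.
  rewrite D at 1. rewrite mult_INR, RtoC_mult. ring.
Qed.

Definition ftw (z : C) (a : fps) : fps := fun n => (z ^ n * a n)%C.

Lemma ftw_sub z a b : ftw z (a - b) = ftw z a - ftw z b.
Proof. apply fps_ext; intros n; unfold ftw, fsub; ring. Qed.
Lemma ftw_cst z c : ftw z (fcst c) = fcst c.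
Proof. apply fps_ext; intros [|n]; unfold ftw; [simpl|change (fcst c (S n)) with (RtoC 0)]; ring. Qed.
Lemma ftw_Z z c : ftw z (fZ c) = fZ c.
Proof. apply ftw_cst. Qed.

Lemma ftw_mul z a b : ftw z (a * b) = ftw z a * ftw z b.
Proof.
  apply fps_ext; intros n; revert a; induction n as [|n IH]; intros a.
  - unfold ftw. rewrite !coef_mul0. ring.
  - rewrite coef_mulS.
    replace (shift (ftw z a)) with (fcst z * ftw z (shift a)).
    + rewrite fscal_mul_coef, <- IH. unfold ftw. rewrite coef_mulS. simpl Cpow. ring.
    + apply fps_ext; intros k. rewrite fmul_scal_coef. unfold shift, ftw. simpl Cpow. ring.
Qed.

Lemma ftw_pow z a i : ftw z (a ^ i) = ftw z a ^ i.
Proof.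
  induction i as [|i IH]; [apply ftw_cst|]. cbn [fpow]. rewrite ftw_mul, IH. reflexivity.
Qed.

Lemma fD_ftw z a : fD (ftw z a) = ftw z (fD a).
Proof. apply fps_ext; intros n; unfold fD, ftw; ring. Qed.

Lemma ramanujan_ftw z P Q R : ramanujan P Q R -> ramanujan (ftw z P) (ftw z Q) (ftw z R).
Proof.
  intros (H1 & H2 & H3). unfold ramanujan. rewrite !fD_ftw, H1, H2, H3.
  repeat rewrite ?ftw_sub, ?ftw_mul, ?ftw_pow, ?ftw_Z. repeat split.
Qed.

Fixpoint feuler_trunc (n : nat) : fps :=
  match n with O => fZ 1 | S m => feuler_trunc m * (fZ 1 - fX ^ n) end.
Definition feuler : fps := fun n => feuler_trunc n n.

Lemma feuler_trunc_agree n : agree (S n) (feuler_trunc n) feuler.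
Proof.
  assert (H : forall m k, agree (S m) (feuler_trunc (k + m)) (feuler_trunc m)).
  { intros m k; induction k as [|k IH]; [apply agree_refl|].
    eapply agree_trans; [|exact IH]. cbn [Nat.add feuler_trunc].
    intros i Hi. replace (feuler_trunc (k + m) * (fZ 1 - fX ^ S (k + m))) with
      (feuler_trunc (k + m) - fX ^ S (k + m) * feuler_trunc (k + m)) by ring.
    rewrite coef_sub, fXpow_mul_coef. destruct (Nat.ltb_spec i (S (k + m))); [ring|lia]. }
  intros k Hk. unfold feuler. rewrite <- (H k (n - k)%nat k) by lia. f_equal. lia.
Qed.

Lemma fD_feuler : fD feuler = fZ (-12) * (feuler * Sig 1).
Proof.
  apply agree_fps; intros n.
  apply (agree_trans _ _ (fD (feuler_trunc n)));
    [apply agree_fD, agree_symm, feuler_trunc_agree|].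
  apply (agree_trans _ _ (fZ (-12) * (feuler_trunc n * lamsum 1 n))).
  - apply agree_eq. unfold lamsum. induction n as [|n IH].
    + simpl. rewrite fD_Z. ring.
    + cbn [feuler_trunc fsum]. rewrite fD_mul, IH, fD_sub, fD_Z, fD_fX_pow.
      replace (fcst (12 * RtoC (INR (S n)))%C) with (fZ 12 * fcst (cn (S n)))
        by (unfold fZ; rewrite <- fcst_mul; reflexivity).
      rewrite Cpow_1_r. pose proof (lam_eq (S n) ltac:(lia)) as E.
      set (A := fX ^ S n) in *. set (L := lam (S n)) in *.
      transitivity (fZ (-12) * (feuler_trunc n * fsum (fun a => fcst (cn a ^ 1)%C * lam a) n)
        * (fZ 1 - A) + fZ (-12) * feuler_trunc n * fcst (cn (S n)) * ((fZ 1 - A) * L)).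
      * rewrite E; ring.
      * ring.
  - apply agree_mul; [apply agree_refl|]. apply agree_mul; [apply feuler_trunc_agree|apply lamsum_agree].
Qed.

Lemma Sig_0 i : Sig i 0%nat = 0.
Proof. reflexivity. Qed.
Lemma Sig_1 i : Sig i 1%nat = 1.
Proof.
  unfold Sig, Defs.sigma. change (seq 1 1) with (1%nat :: nil). cbn.
  rewrite Nat.pow_1_l. reflexivity.
Qed.

Lemma fE2_0 : fE2 0%nat = 1.
Proof. unfold fE2, fZ. rewrite coef_sub, fmul_scal_coef, Sig_0. simpl. ring. Qed.
Lemma fE2_1 : fE2 1%nat = -24.
Proof. unfold fE2, fZ. rewrite coef_sub, fmul_scal_coef, Sig_1. simpl. ring. Qed.
Lemma fE4_0 : fE4 0%nat = 1.
Proof. unfold fE4, fZ. rewrite coef_add, fmul_scal_coef, Sig_0. simpl. ring. Qed.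
Lemma fE4_1 : fE4 1%nat = 240.
Proof. unfold fE4, fZ. rewrite coef_add, fmul_scal_coef, Sig_1. simpl. ring. Qed.
Lemma fE6_0 : fE6 0%nat = 1.
Proof. unfold fE6, fZ. rewrite coef_sub, fmul_scal_coef, Sig_0. simpl. ring. Qed.
Lemma fE6_1 : fE6 1%nat = -504.
Proof. unfold fE6, fZ. rewrite coef_sub, fmul_scal_coef, Sig_1. simpl. ring. Qed.

Lemma fD_fX : fD fX = fZ 12 * fX.
Proof.
  pose proof (fD_fX_pow 1) as E. simpl INR in E. rewrite Cmult_1_r in E.
  fold (fZ 12) in E. replace (fX ^ 1) with fX in E by ring. exact E.
Qed.

Lemma discriminant : fE4 ^ 3 - fE6 ^ 2 = fZ 1728 * (fX * feuler ^ 24).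
Proof.
  destruct ramanujan_fE as (_ & HQ & HR).
  apply fsub_eq0, (linear_ode_unique (fZ 12 * fE2) _ 1).
  - unfold fZ. rewrite fmul_scal_coef, fE2_0. reflexivity.
  - rewrite !fD_sub, !fD_mul, !fD_pow, fD_Z, HQ, HR, fD_fX, fD_feuler.
    unfold fE2. simpl Z.of_nat. ring.
  - intros k Hk. assert (E0 : feuler 0%nat = 1) by reflexivity.
    unfold fZ. rewrite !coef_sub, fmul_scal_coef, fX_mul_coef.
    destruct k as [|[|k]]; [| |lia].
    + c0. rewrite fE4_0, fE6_0. ring.
    + rewrite fpow_coef0, E0, Cpow_1_l. cbn [fpow].
      repeat rewrite ?coef_mul1, ?coef_mul0. rewrite fE4_0, fE4_1, fE6_0, fE6_1.
      simpl. ring.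
Qed.


Section Substitution.
Variable m : nat.
Hypothesis Hm : (0 < m)%nat.

Lemma fV_coef0 a : fV m a 0%nat = a 0%nat.
Proof. unfold fV. rewrite Nat.Div0.mod_0_l, Nat.Div0.div_0_l. reflexivity. Qed.

Lemma fV_coef1 a : (1 < m)%nat -> fV m a 1%nat = 0.
Proof. intros H. unfold fV. rewrite Nat.mod_small by assumption. reflexivity. Qed.

Lemma fV_discriminant :
  fV m fE4 ^ 3 - fV m fE6 ^ 2 = fZ 1728 * (fX ^ m * fV m feuler ^ 24).
Proof.
  pose proof (f_equal (fV m) discriminant) as H.
  rewrite fV_sub, !fV_mul, !fV_pow, fV_Z, fV_fX in H by assumption. exact H.
Qed.

Lemma fD_fV_fE2 : fD (fV m fE2) = fZ (Z.of_nat m) * (fV m fE2 ^ 2 - fV m fE4).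
Proof.
  destruct ramanujan_fE as (H & _ & _).
  rewrite fD_fV, H, fV_sub, fV_pow by assumption. reflexivity.
Qed.

Lemma fD_fV_fE4 :
  fD (fV m fE4) = fZ (Z.of_nat m) * (fZ 4 * (fV m fE2 * fV m fE4 - fV m fE6)).
Proof.
  destruct ramanujan_fE as (_ & H & _).
  rewrite fD_fV, H, fV_mul, fV_sub, fV_mul, fV_Z by assumption. reflexivity.
Qed.

Lemma fD_fV_fE6 :
  fD (fV m fE6) = fZ (Z.of_nat m) * (fZ 6 * (fV m fE2 * fV m fE6 - fV m fE4 ^ 2)).
Proof.
  destruct ramanujan_fE as (_ & _ & H).
  rewrite fD_fV, H, fV_mul, fV_sub, fV_mul, fV_pow, fV_Z by assumption. reflexivity.
Qed.

(* [fX * fV m feuler ^ k] with [m k = 24] is the expansion of [eta(tau) ^ k] in [q ^ (1/m)]. *)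
Lemma fD_eta_pow k : (m * S k = 24)%nat ->
  fD (fX * fV m feuler ^ S k) = fZ 12 * (fV m fE2 * (fX * fV m feuler ^ S k)).
Proof.
  intros Hk.
  rewrite fD_mul, fD_fX, fD_pow, fD_fV, fD_feuler, !fV_mul, fV_Z by assumption.
  unfold fE2. rewrite fV_sub, fV_mul, !fV_Z by assumption.
  assert (E : fZ (Z.of_nat (S k)) * fZ (Z.of_nat m) = fZ 24).
  { rewrite <- (morph_mul fps_ring_morph), <- Nat2Z.inj_mul, Nat.mul_comm, Hk. reflexivity. }
  cbn [fpow]. set (g := fV m feuler) in *.
  transitivity (fZ 12 * fX * (g * g ^ k) +
    fX * (fZ (Z.of_nat (S k)) * fZ (Z.of_nat m)) * (g ^ k * (fZ (-12) * (g * fV m (Sig 1)))));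
    [ring|rewrite E; ring].
Qed.
End Substitution.

Lemma fcst_root3 (w : C) : (w ^ 2 + w + 1)%C = 0 -> fcst w ^ 2 + fcst w + fZ 1 = fZ 0.
Proof.
  intros H. unfold fZ. cbn [fpow]. rewrite <- !fcst_mul, <- !fcst_add, <- H.
  reflexivity.
Qed.

Lemma cube_coef1 (a : fps) : a 0%nat = 1 -> (a ^ 3) 1%nat = (3 * a 1%nat)%C.
Proof.
  intros H. cbn [fpow]. repeat rewrite ?coef_mul1, ?coef_mul0. rewrite H. simpl. ring.
Qed.

Lemma sqr_coef1 (a : fps) : a 0%nat = 1 -> (a ^ 2) 1%nat = (2 * a 1%nat)%C.
Proof.
  intros H. cbn [fpow]. repeat rewrite ?coef_mul1, ?coef_mul0. rewrite H. simpl. ring.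
Qed.

Lemma Cmult_cancel (a b c : C) : a <> 0 -> (a * b)%C = (a * c)%C -> b = c.
Proof.
  intros Ha H. transitivity (/ a * (a * b))%C; [field; exact Ha|].
  rewrite H. field; exact Ha.
Qed.

Lemma level2_identity (s : C) : (s * s)%C = -3 ->
  let f c := fZ 12 * fV 2 fE2 - fcst (3 + c)%C * fE2 - fcst (3 - c)%C * ftw (-1) fE2 in
  f s ^ 3 = fZ 216 * (fV 2 fE6 + fcst (24 * s)%C * (fX * fV 2 feuler ^ 12)) /\
  f s * f (- s)%C = fZ 36 * fV 2 fE4.
Proof.
  intros Hs f.
  set (w := ((-1 + s) / 2)%C).
  assert (Hw : (w ^ 2 + w + 1)%C = 0).
  { transitivity ((s * s + 3) / 4)%C; [unfold w; field|]. rewrite Hs. field. }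
  apply fcst_root3 in Hw as Hwf. set (W := fcst w) in *.
  assert (HsW : fcst s = fZ 2 * W + fZ 1).
  { unfold W, fZ. rewrite <- fcst_mul, <- fcst_add. f_equal. unfold w; field. }
  assert (HW2 : W * W = - W - fZ 1).
  { transitivity (W ^ 2 + W + fZ 1 - W - fZ 1); [ring|rewrite Hwf; ring]. }
  pose proof (fV_discriminant 2 ltac:(lia)) as HD.
  pose proof (fD_fV_fE2 2 ltac:(lia)) as DP.
  pose proof (fD_fV_fE6 2 ltac:(lia)) as DR.
  pose proof (fD_eta_pow 2 ltac:(lia) 11 eq_refl) as DT.
  simpl Z.of_nat in *.
  set (P := fV 2 fE2) in *. set (Q := fV 2 fE4) in *. set (R := fV 2 fE6) in *.
  set (T := fX * fV 2 feuler ^ 12) in *.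
  assert (HQ0 : Q 0%nat = 1) by (unfold Q; rewrite fV_coef0; apply fE4_0).
  assert (HR0 : R 0%nat = 1) by (unfold R; rewrite fV_coef0; apply fE6_0).
  assert (HR1 : R 1%nat = 0) by (unfold R; apply fV_coef1; lia).
  assert (HP0 : P 0%nat = 1) by (unfold P; rewrite fV_coef0; apply fE2_0).
  assert (HP1 : P 1%nat = 0) by (unfold P; apply fV_coef1; lia).
  assert (HT0 : T 0%nat = 0) by (unfold T; apply fX_mul_coef).
  assert (HT1 : T 1%nat = 1).
  { unfold T. rewrite fX_mul_coef, fpow_coef0, fV_coef0. apply Cpow_1_l. }
  set (t := fcst (24 * s)%C).
  assert (Ht : t = fZ 24 * (fZ 2 * W + fZ 1)) by (unfold t; rewrite fcst_mul, HsW; reflexivity).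
  destruct (fcbrt_exists (R + t * T)) as (a & Ha0 & Ha).
  { c0. rewrite HT0, HR0. ring. }
  destruct (fcbrt_exists (R - t * T)) as (b & Hb0 & Hb).
  { c0. rewrite HT0, HR0. ring. }
  assert (Hab : a * b = Q).
  { apply fcube_inj; [c0; rewrite Ha0, Hb0; ring|exact HQ0|].
    transitivity (a ^ 3 * b ^ 3); [ring|]. rewrite Ha, Hb, Ht.
    transitivity (Q ^ 3 - R ^ 2 - fZ 1728 * T ^ 2 + R ^ 2 + fZ 1728 * T ^ 2); [|ring].
    rewrite HD. unfold T. ring [HW2]. }
  assert (Da : fD a = fZ 4 * (P * a - b ^ 2)).
  { apply (fmul_cancel (fZ 3 * a ^ 2)).
    - c0. rewrite Ha0. apply Cmult_neq_0; [apply RtoC_neq0; lra|].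
      rewrite Cpow_1_l. exact C1_nz.
    - pose proof (f_equal fD Ha) as E.
      rewrite (fD_pow a 2), fD_add, fD_mul, DR, DT in E. unfold t in E at 1.
      rewrite fD_cst in E. simpl Z.of_nat in E. rewrite E.
      transitivity (fZ 12 * (P * (R + t * T) - Q ^ 2)); [ring|].
      rewrite <- Ha, <- Hab. ring. }
  assert (Db : fD b = fZ 4 * (P * b - a ^ 2)).
  { apply (fmul_cancel (fZ 3 * b ^ 2)).
    - c0. rewrite Hb0. apply Cmult_neq_0; [apply RtoC_neq0; lra|].
      rewrite Cpow_1_l. exact C1_nz.
    - pose proof (f_equal fD Hb) as E.
      rewrite (fD_pow b 2), fD_sub, fD_mul, DR, DT in E. unfold t in E at 1.
      rewrite fD_cst in E. simpl Z.of_nat in E. rewrite E.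
      transitivity (fZ 12 * (P * (R - t * T) - Q ^ 2)); [ring|].
      rewrite <- Hb, <- Hab. ring. }
  assert (Ha1 : a 1%nat = (8 * s)%C).
  { apply (f_equal (fun f : fps => f 1%nat)) in Ha. rewrite cube_coef1 in Ha by exact Ha0.
    apply (Cmult_cancel 3); [apply RtoC_neq0; lra|]. rewrite Ha, coef_add.
    unfold t. rewrite fmul_scal_coef, HR1, HT1. ring. }
  assert (Hb1 : b 1%nat = (- (8 * s))%C).
  { apply (f_equal (fun f : fps => f 1%nat)) in Hb. rewrite cube_coef1 in Hb by exact Hb0.
    apply (Cmult_cancel 3); [apply RtoC_neq0; lra|]. rewrite Hb, coef_sub.
    unfold t. rewrite fmul_scal_coef, HR1, HT1. ring. }
  assert (Hw2 : (w * w)%C = (- w - 1)%C).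
  { transitivity (w ^ 2 + w + 1 - w - 1)%C; [ring|rewrite Hw; ring]. }
  assert (HW2' : W ^ 2 = fcst (w * w)%C) by (unfold W; rewrite fcst_mul; ring).
  assert (X0 : fZ 2 * P + W * a + W ^ 2 * b = fE2).
  { rewrite <- Hab in DP.
    destruct (ramanujan_level2 P a b W Hwf (fD_cst w) DP Da Db) as (Y & Z & HX).
    apply (ramanujan_unique _ _ _ _ _ _ HX ramanujan_fE).
    - rewrite HW2'. unfold W, fZ. c0. rewrite HP0, Ha0, Hb0. simpl. rewrite Hw2. ring.
    - apply fE2_0.
    - rewrite HW2'. unfold W, fZ. rewrite !coef_add, !fmul_scal_coef, HP1, Ha1, Hb1, fE2_1, Hw2.
      transitivity (8 * (s * s))%C; [unfold w; field|]. rewrite Hs; ring. }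
  assert (X1 : fZ 2 * P + W * b + W ^ 2 * a = ftw (-1) fE2).
  { rewrite <- Hab in DP. replace (a * b) with (b * a) in DP by ring.
    destruct (ramanujan_level2 P b a W Hwf (fD_cst w) DP Db Da) as (Y & Z & HX).
    apply (ramanujan_unique _ _ _ _ _ _ HX (ramanujan_ftw _ _ _ _ ramanujan_fE)).
    - rewrite HW2'. unfold W, fZ. c0. rewrite HP0, Ha0, Hb0. simpl. rewrite Hw2. ring.
    - unfold ftw. rewrite fE2_0. simpl; ring.
    - rewrite HW2'. unfold W, fZ, ftw.
      rewrite !coef_add, !fmul_scal_coef, HP1, Ha1, Hb1, fE2_1, Hw2.
      transitivity (- (8 * (s * s)))%C; [unfold w; simpl; field|]. rewrite Hs; ring. }
  assert (Fs : f s = fZ 6 * a).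
  { unfold f. rewrite <- X1, <- X0, fcst_add, fcst_sub, HsW. fold (fZ 3). ring [HW2]. }
  assert (Fms : f (- s)%C = fZ 6 * b).
  { unfold f. rewrite <- X1, <- X0, fcst_add, fcst_sub, fcst_opp, HsW. fold (fZ 3). ring [HW2]. }
  split.
  - rewrite Fs, <- Ha. ring.
  - rewrite Fs, Fms, <- Hab. ring.
Qed.

Lemma level3_identity (w : C) : (w ^ 2 + w + 1)%C = 0 ->
  let X i := ftw (w ^ i)%C fE2 in
  let g i j := fZ 12 * fV 3 fE2 - fZ 2 * (X i + X j) in
  g 1%nat 2%nat ^ 2 = fZ 64 * (fV 3 fE4 - fZ 12 * (fX * fV 3 feuler ^ 8)) /\
  g 1%nat 2%nat * g 0%nat 2%nat * g 0%nat 1%nat = fZ 512 * fV 3 fE6.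
Proof.
  intros Hw X g.
  apply fcst_root3 in Hw as Hwf. set (W := fcst w) in *.
  assert (HW2 : W * W = - W - fZ 1).
  { transitivity (W ^ 2 + W + fZ 1 - W - fZ 1); [ring|rewrite Hwf; ring]. }
  assert (Hw2 : (w * w)%C = (- w - 1)%C).
  { transitivity (w ^ 2 + w + 1 - w - 1)%C; [ring|rewrite Hw; ring]. }
  pose proof (fV_discriminant 3 ltac:(lia)) as HD.
  pose proof (fD_fV_fE2 3 ltac:(lia)) as DP.
  pose proof (fD_fV_fE4 3 ltac:(lia)) as DQ.
  pose proof (fD_eta_pow 3 ltac:(lia) 7 eq_refl) as DT.
  simpl Z.of_nat in *.
  set (P := fV 3 fE2) in *. set (Q := fV 3 fE4) in *. set (R := fV 3 fE6) in *.
  set (T := fX * fV 3 feuler ^ 8) in *.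
  assert (HQ0 : Q 0%nat = 1) by (unfold Q; rewrite fV_coef0; apply fE4_0).
  assert (HQ1 : Q 1%nat = 0) by (unfold Q; apply fV_coef1; lia).
  assert (HR0 : R 0%nat = 1) by (unfold R; rewrite fV_coef0; apply fE6_0).
  assert (HP0 : P 0%nat = 1) by (unfold P; rewrite fV_coef0; apply fE2_0).
  assert (HP1 : P 1%nat = 0) by (unfold P; apply fV_coef1; lia).
  assert (HT0 : T 0%nat = 0) by (unfold T; apply fX_mul_coef).
  assert (HT1 : T 1%nat = 1).
  { unfold T. rewrite fX_mul_coef, fpow_coef0, fV_coef0. apply Cpow_1_l. }
  assert (root : forall i, exists a : fps, a 0%nat = 1 /\ a ^ 2 = Q - fcst (12 * w ^ i)%C * T
    /\ a 1%nat = (-6 * w ^ i)%C).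
  { intros i. destruct (fsqrt_exists (Q - fcst (12 * w ^ i)%C * T)) as (a & Ha0 & Ha).
    - c0. rewrite HT0, HQ0. ring.
    - exists a; repeat split; [exact Ha0|exact Ha|].
      apply (f_equal (fun f : fps => f 1%nat)) in Ha. rewrite sqr_coef1 in Ha by exact Ha0.
      apply (Cmult_cancel 2); [apply RtoC_neq0; lra|]. rewrite Ha, coef_sub.
      rewrite fmul_scal_coef, HQ1, HT1. ring. }
  assert (H12 : forall c, fcst (12 * c)%C = fZ 12 * fcst c) by (intros c; apply fcst_mul).
  destruct (root 0%nat) as (a & Ha0 & Ha & Ha1), (root 1%nat) as (b & Hb0 & Hb & Hb1),
    (root 2%nat) as (c & Hc0 & Hc & Hc1); clear root.
  replace (w ^ 0)%C with (RtoC 1) in Ha, Ha1 by (simpl; ring).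
  replace (w ^ 1)%C with w in Hb, Hb1 by (simpl; ring).
  replace (w ^ 2)%C with (- w - 1)%C in Hc, Hc1 by (rewrite <- Hw2; ring).
  rewrite H12 in Ha, Hb, Hc. rewrite fcst_sub, fcst_opp in Hc.
  fold (fZ 1) in Ha, Hc. fold W in Hb, Hc.
  assert (Habc : a * b * c = R).
  { apply fsqr_inj; [c0; rewrite Ha0, Hb0, Hc0; ring|exact HR0|].
    transitivity (a ^ 2 * b ^ 2 * c ^ 2); [ring|]. rewrite Ha, Hb, Hc.
    transitivity (Q ^ 3 - (Q ^ 3 - R ^ 2)); [rewrite HD; unfold T|]; ring [HW2]. }
  assert (D : forall z x y k : fps, z 0%nat = 1 -> z ^ 2 = Q - fZ 12 * k * T -> fD k = fZ 0 ->
    z * x * y = R -> fD z = fZ 6 * (P * z - x * y)).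
  { intros z x y k Hz0 Hz Dk HR. apply (fmul_cancel (fZ 2 * z)).
    - c0. rewrite Hz0. apply Cmult_neq_0; [apply RtoC_neq0; lra|exact C1_nz].
    - pose proof (f_equal fD Hz) as E.
      rewrite (fD_pow z 1), fD_sub, !fD_mul, fD_Z, Dk, DQ, DT in E. simpl Z.of_nat in E.
      transitivity (fZ 2 * z ^ 1 * fD z); [ring|]. rewrite E.
      transitivity (fZ 12 * (P * (Q - fZ 12 * k * T) - R)); [ring|].
      rewrite <- Hz, <- HR. ring. }
  assert (DW : fD W = fZ 0) by apply fD_cst.
  assert (Da : fD a = fZ 6 * (P * a - b * c)) by (apply (D a b c (fZ 1)); auto using fD_Z).
  assert (Db : fD b = fZ 6 * (P * b - c * a)).
  { apply (D b c a W); auto. rewrite <- Habc; ring. }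
  assert (Dc : fD c = fZ 6 * (P * c - a * b)).
  { apply (D c a b (- W - fZ 1)); auto.
    - rewrite fD_sub, fD_opp, DW, fD_Z; ring.
    - rewrite <- Habc; ring. }
  assert (Hsum : forall x y z : fps, x ^ 2 + y ^ 2 + z ^ 2 = fZ 3 * Q ->
    fD P = fZ 3 * P ^ 2 - (x ^ 2 + y ^ 2 + z ^ 2)).
  { intros x y z ->. rewrite DP. ring. }
  assert (Hq : a ^ 2 * a ^ 2 + b ^ 2 * b ^ 2 + c ^ 2 * c ^ 2
    = a ^ 2 * b ^ 2 + b ^ 2 * c ^ 2 + c ^ 2 * a ^ 2).
  { rewrite Ha, Hb, Hc. ring [HW2]. }
  assert (Hs3 : a ^ 2 + b ^ 2 + c ^ 2 = fZ 3 * Q) by (rewrite Ha, Hb, Hc; ring).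
  assert (XX : forall (x y z : fps) i, x 0%nat = 1 -> y 0%nat = 1 -> z 0%nat = 1 ->
    x ^ 4 + y ^ 4 + z ^ 4 = x ^ 2 * y ^ 2 + y ^ 2 * z ^ 2 + z ^ 2 * x ^ 2 ->
    x ^ 2 + y ^ 2 + z ^ 2 = fZ 3 * Q ->
    fD x = fZ 6 * (P * x - y * z) -> fD y = fZ 6 * (P * y - z * x) ->
    fD z = fZ 6 * (P * z - x * y) -> (x 1%nat - y 1%nat - z 1%nat)%C = (-12 * w ^ i)%C ->
    X i = fZ 3 * P + fZ 2 * (x - y - z)).
  { intros x y z i Hx Hy Hz H4 H2 Dx Dy Dz H1.
    destruct (ramanujan_level3 P x y z H4 (Hsum x y z H2) Dx Dy Dz) as (Y & Z & HX).
    symmetry. apply (ramanujan_unique _ _ _ _ _ _ HX (ramanujan_ftw _ _ _ _ ramanujan_fE)).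
    - unfold fZ. c0. rewrite HP0, Hx, Hy, Hz. simpl. ring.
    - unfold ftw. rewrite fE2_0. simpl; ring.
    - unfold fZ, ftw. rewrite coef_add, !fmul_scal_coef, !coef_sub, HP1, H1, fE2_1.
      simpl. ring. }
  assert (X0 : X 0%nat = fZ 3 * P + fZ 2 * (a - b - c)).
  { apply XX; auto.
    - transitivity (a ^ 2 * a ^ 2 + b ^ 2 * b ^ 2 + c ^ 2 * c ^ 2); [ring|exact Hq].
    - rewrite Ha1, Hb1, Hc1. simpl; ring. }
  assert (X1 : X 1%nat = fZ 3 * P + fZ 2 * (b - c - a)).
  { apply XX; auto.
    - transitivity (a ^ 2 * a ^ 2 + b ^ 2 * b ^ 2 + c ^ 2 * c ^ 2); [ring|rewrite Hq; ring].
    - rewrite <- Hs3; ring.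
    - rewrite Ha1, Hb1, Hc1. simpl; ring. }
  assert (X2 : X 2%nat = fZ 3 * P + fZ 2 * (c - a - b)).
  { apply XX; auto.
    - transitivity (a ^ 2 * a ^ 2 + b ^ 2 * b ^ 2 + c ^ 2 * c ^ 2); [ring|rewrite Hq; ring].
    - rewrite <- Hs3; ring.
    - rewrite Ha1, Hb1, Hc1. transitivity (-12 * (- w - 1))%C; [ring|].
      rewrite <- Hw2. simpl; ring. }
  assert (G0 : g 1%nat 2%nat = fZ 8 * a) by (unfold g; rewrite X1, X2; ring).
  assert (G1 : g 0%nat 2%nat = fZ 8 * b) by (unfold g; rewrite X0, X2; ring).
  assert (G2 : g 0%nat 1%nat = fZ 8 * c) by (unfold g; rewrite X0, X1; ring).
  rewrite G0, G1, G2. split.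
  - transitivity (fZ 64 * a ^ 2); [ring|rewrite Ha; ring].
  - rewrite <- Habc. ring.
Qed.

Close Scope fps_scope.

(** * Complex series *)

Definition Ccv (u : nat -> C) (l : C) : Prop := is_lim_seq (fun n => Cmod (u n - l)) 0%R.

Lemma Cmod_sub_sym (a b : C) : Cmod (a - b) = Cmod (b - a).
Proof. rewrite <- Cmod_opp. f_equal. ring. Qed.

Lemma Ccv_squeeze u l (e : nat -> R) :
  (forall n, Cmod (u n - l) <= e n)%R -> is_lim_seq e 0%R -> Ccv u l.
Proof.
  intros H He. unfold Ccv. apply (is_lim_seq_le_le (fun _ => 0%R) _ e).
  - intros n; split; [apply Cmod_ge_0|apply H].
  - apply is_lim_seq_const.
  - exact He.
Qed.

Lemma Ccv_ext_loc u v l : eventually (fun n => u n = v n) -> Ccv u l -> Ccv v l.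
Proof.
  intros [N HN] H. apply (is_lim_seq_ext_loc (fun n => Cmod (u n - l))); [|exact H].
  exists N; intros n Hn; rewrite HN by exact Hn; reflexivity.
Qed.

Lemma Ccv_ext u v l : (forall n, u n = v n) -> Ccv u l -> Ccv v l.
Proof. intros H; apply Ccv_ext_loc; exists 0%nat; auto. Qed.

Lemma Ccv_const c : Ccv (fun _ => c) c.
Proof.
  apply (is_lim_seq_ext (fun _ => 0%R)); [|apply is_lim_seq_const].
  intros n. replace (c - c) with (RtoC 0) by ring. symmetry; apply Cmod_0.
Qed.

Lemma Ccv_plus u v l m : Ccv u l -> Ccv v m -> Ccv (fun n => u n + v n) (l + m).
Proof.
  intros H1 H2. apply (Ccv_squeeze _ _ (fun n => Cmod (u n - l) + Cmod (v n - m))%R).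
  - intros n. replace (u n + v n - (l + m)) with ((u n - l) + (v n - m)) by ring.
    apply Cmod_triangle.
  - replace (Finite 0) with (Finite (0 + 0)) by (f_equal; ring).
    apply is_lim_seq_plus'; assumption.
Qed.

Lemma Ccv_Cmod u l : Ccv u l -> is_lim_seq (fun n => Cmod (u n)) (Cmod l).
Proof.
  intros H. apply (is_lim_seq_le_le (fun n => Cmod l - Cmod (u n - l))%R _
    (fun n => Cmod l + Cmod (u n - l))%R).
  - intros n; split.
    + assert (Cmod l <= Cmod (u n) + Cmod (u n - l))%R; [|lra].
      rewrite (Cmod_sub_sym (u n)).
      replace l with (u n + (l - u n)) at 1 by ring. apply Cmod_triangle.
    + replace (u n) with (l + (u n - l)) at 1 by ring. apply Cmod_triangle.
  - replace (Finite (Cmod l)) with (Finite (Cmod l - 0)) by (f_equal; ring).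
    apply is_lim_seq_minus'; [apply is_lim_seq_const|exact H].
  - replace (Finite (Cmod l)) with (Finite (Cmod l + 0)) by (f_equal; ring).
    apply is_lim_seq_plus'; [apply is_lim_seq_const|exact H].
Qed.

Lemma Ccv_mult u v l m : Ccv u l -> Ccv v m -> Ccv (fun n => u n * v n) (l * m).
Proof.
  intros H1 H2.
  apply (Ccv_squeeze _ _ (fun n => Cmod (u n - l) * Cmod (v n) + Cmod l * Cmod (v n - m))%R).
  - intros n. replace (u n * v n - l * m) with ((u n - l) * v n + l * (v n - m)) by ring.
    rewrite <- !Cmod_mult. apply Cmod_triangle.
  - replace (Finite 0) with (Finite (0 * Cmod m + Cmod l * 0)) by (f_equal; ring).
    apply is_lim_seq_plus'; apply is_lim_seq_mult'; try assumption.
    + apply Ccv_Cmod; assumption.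
    + apply is_lim_seq_const.
Qed.

Lemma Ccv_scal c u l : Ccv u l -> Ccv (fun n => c * u n) (c * l).
Proof. intros H; apply Ccv_mult; [apply Ccv_const|exact H]. Qed.

Lemma Ccv_opp u l : Ccv u l -> Ccv (fun n => - u n) (- l).
Proof.
  intros H. apply (Ccv_ext (fun n => (-1) * u n)); [intros n; ring|].
  replace (- l) with ((-1) * l) by ring. apply Ccv_scal; exact H.
Qed.

Lemma Ccv_minus u v l m : Ccv u l -> Ccv v m -> Ccv (fun n => u n - v n) (l - m).
Proof. intros H1 H2. apply Ccv_plus; [exact H1|apply Ccv_opp; exact H2]. Qed.

Lemma Ccv_neq0 u (l : C) : l <> 0 -> Ccv u l -> eventually (fun n => u n <> 0).
Proof.
  intros Hl H. apply Ccv_Cmod in H. apply is_lim_seq_spec in H.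
  assert (P : (0 < Cmod l)%R) by (apply Cmod_gt_0; exact Hl).
  destruct (H (mkposreal _ P)) as [N HN]. exists N; intros n Hn E.
  specialize (HN n Hn). rewrite E, Cmod_0 in HN. simpl in HN.
  rewrite Rminus_0_l, Rabs_Ropp, Rabs_pos_eq in HN by lra. lra.
Qed.

Lemma Ccv_inv u (l : C) : l <> 0 -> Ccv u l -> Ccv (fun n => / u n) (/ l).
Proof.
  intros Hl H. assert (P : (0 < Cmod l)%R) by (apply Cmod_gt_0; exact Hl).
  unfold Ccv. apply (is_lim_seq_ext_loc (fun n => Cmod (u n - l) / (Cmod (u n) * Cmod l))%R).
  - destruct (Ccv_neq0 u l Hl H) as [N HN]. exists N; intros n Hn. specialize (HN n Hn).
    rewrite (Cmod_sub_sym (u n)), <- Cmod_mult, <- Cmod_div by (apply Cmult_neq_0; assumption).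
    f_equal. field. split; assumption.
  - replace (Finite 0) with (Finite (0 / (Cmod l * Cmod l))) by (f_equal; field; lra).
    apply is_lim_seq_div'; [exact H| |nra].
    apply is_lim_seq_mult'; [apply Ccv_Cmod; exact H|apply is_lim_seq_const].
Qed.

Lemma Ccv_unique u l m : Ccv u l -> Ccv u m -> l = m.
Proof.
  intros H1 H2. pose proof (Ccv_minus _ _ _ _ H1 H2) as H.
  apply Ccv_Cmod in H.
  assert (E : is_lim_seq (fun n => Cmod (u n - u n)) 0%R).
  { apply (is_lim_seq_ext (fun _ => 0%R)); [|apply is_lim_seq_const].
    intros n. replace (u n - u n) with (RtoC 0) by ring. symmetry; apply Cmod_0. }
  apply is_lim_seq_unique in H, E. rewrite H in E. injection E as E.
  apply Cmod_eq_0 in E. apply Ceq_minus; exact E.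
Qed.

Lemma Ccv_subseq u l (f : nat -> nat) :
  (forall n, (n <= f n)%nat) -> Ccv u l -> Ccv (fun n => u (f n)) l.
Proof.
  intros Hf H. apply (is_lim_seq_subseq (fun n => Cmod (u n - l)) 0%R f); [|exact H].
  intros P [N HN]; exists N; intros n Hn; apply HN. specialize (Hf n); lia.
Qed.

Lemma Ccv_le u l (M : R) : Ccv u l -> (forall n, Cmod (u n) <= M)%R -> (Cmod l <= M)%R.
Proof.
  intros H HM. apply Ccv_Cmod in H.
  apply (is_lim_seq_le _ (fun _ => M) (Cmod l) M HM H), is_lim_seq_const.
Qed.

Lemma Ccv_Re_Im u l :
  is_lim_seq (fun n => Re (u n)) (Re l) -> is_lim_seq (fun n => Im (u n)) (Im l) -> Ccv u l.
Proof.
  intros H1 H2.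
  apply (Ccv_squeeze _ _ (fun n => Rabs (Re (u n) - Re l) + Rabs (Im (u n) - Im l))%R).
  - intros n. destruct (u n) as [a b], l as [c e]. unfold Cmod. simpl.
    rewrite <- (Rabs_pos_eq (Rabs (a - c) + Rabs (b - e)))
      by (apply Rplus_le_le_0_compat; apply Rabs_pos).
    rewrite <- sqrt_Rsqr_abs. apply sqrt_le_1_alt. unfold Rsqr.
    pose proof (Rabs_pos (a - c)). pose proof (Rabs_pos (b - e)).
    assert (E1 : (Rabs (a - c) * Rabs (a - c) = (a - c) * (a - c))%R)
      by (rewrite <- Rabs_mult; apply Rabs_pos_eq, Rle_0_sqr).
    assert (E2 : (Rabs (b - e) * Rabs (b - e) = (b - e) * (b - e))%R)
      by (rewrite <- Rabs_mult; apply Rabs_pos_eq, Rle_0_sqr).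
    nra.
  - assert (G : forall (v : nat -> R) (k : R), is_lim_seq v k ->
      is_lim_seq (fun n => Rabs (v n - k)) 0%R).
    { intros v k Hv. rewrite <- (Rabs_R0).
      apply (is_lim_seq_abs (fun n => v n - k)%R 0%R).
      replace (Finite 0) with (Finite (k - k)) by (f_equal; ring).
      apply is_lim_seq_minus'; [exact Hv|apply is_lim_seq_const]. }
    replace (Finite 0) with (Finite (0 + 0)) by (f_equal; ring).
    apply is_lim_seq_plus'; apply G; assumption.
Qed.

Lemma Clim_of_Ccv u l : Ccv u l -> Clim u = l.
Proof.
  intros H. apply Clim_unique. apply filterlim_locally. intros eps.
  apply is_lim_seq_spec in H. destruct (H eps) as [N HN]. exists N; intros n Hn.
  specialize (HN n Hn). rewrite Rminus_0_r, Rabs_pos_eq in HN by apply Cmod_ge_0.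
  pose proof (Rmax_Cmod (u n - l)) as Hm.
  pose proof (Rmax_l (Rabs (fst (u n - l))) (Rabs (snd (u n - l)))).
  pose proof (Rmax_r (Rabs (fst (u n - l))) (Rabs (snd (u n - l)))).
  split; unfold ball; simpl; unfold AbsRing_ball, abs, minus, plus, opp; simpl;
    unfold Cminus, Cplus, Copp in *; simpl in *; lra.
Qed.

Fixpoint rsum (f : nat -> R) (n : nat) : R :=
  match n with O => 0%R | S m => (rsum f m + f n)%R end.

Lemma rsum_sum_n f n : rsum f (S n) = sum_n (fun i => f (S i)) n.
Proof.
  induction n as [|n IH]; [simpl; rewrite sum_O; ring|].
  rewrite sum_Sn, <- IH. reflexivity.
Qed.

Lemma rsum_series f l : is_series (fun i => f (S i)) l -> is_lim_seq (rsum f) l.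
Proof.
  intros H. apply is_lim_seq_incr_1.
  apply (is_lim_seq_ext (sum_n (fun i => f (S i)))); [|exact H].
  intros n; symmetry; apply rsum_sum_n.
Qed.

(* Series are indexed from [1]. *)
Definition Cser (a : nat -> C) : C :=
  (Series (fun n => Re (a (S n))), Series (fun n => Im (a (S n)))).
Definition Csmb (a : nat -> C) : Prop := ex_series (fun n => Cmod (a (S n))).

Lemma Re_csum a n : Re (csum a n) = rsum (fun i => Re (a i)) n.
Proof. induction n as [|n IH]; [reflexivity|]. simpl. rewrite <- IH. reflexivity. Qed.
Lemma Im_csum a n : Im (csum a n) = rsum (fun i => Im (a i)) n.
Proof. induction n as [|n IH]; [reflexivity|]. simpl. rewrite <- IH. reflexivity. Qed.

Lemma Re_le_Cmod z : (Rabs (Re z) <= Cmod z)%R.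
Proof. eapply Rle_trans; [apply Rmax_l|apply Rmax_Cmod]. Qed.
Lemma Im_le_Cmod z : (Rabs (Im z) <= Cmod z)%R.
Proof. eapply Rle_trans; [apply Rmax_r|apply Rmax_Cmod]. Qed.

Lemma Cser_cv a : Csmb a -> Ccv (csum a) (Cser a).
Proof.
  intros H. apply Ccv_Re_Im.
  - apply (is_lim_seq_ext (rsum (fun i => Re (a i)))); [intros n; symmetry; apply Re_csum|].
    apply rsum_series, Series_correct.
    apply (ex_series_le (K := R_AbsRing) (V := R_CompleteNormedModule) _ _ (fun n => Re_le_Cmod (a (S n))) H).
  - apply (is_lim_seq_ext (rsum (fun i => Im (a i)))); [intros n; symmetry; apply Im_csum|].
    apply rsum_series, Series_correct.
    apply (ex_series_le (K := R_AbsRing) (V := R_CompleteNormedModule) _ _ (fun n => Im_le_Cmod (a (S n))) H).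
Qed.

Lemma Cser_eq a l : Csmb a -> Ccv (csum a) l -> Cser a = l.
Proof. intros H1 H2; exact (Ccv_unique _ _ _ (Cser_cv a H1) H2). Qed.

Lemma Csmb_le a (b : nat -> R) :
  (forall n, (1 <= n)%nat -> Cmod (a n) <= b n)%R -> ex_series (fun n => b (S n)) -> Csmb a.
Proof.
  intros H Hb. apply (ex_series_le (K := R_AbsRing) (V := R_CompleteNormedModule) _ (fun n => b (S n))); [|exact Hb].
  intros n. unfold norm; simpl. unfold abs; simpl.
  rewrite Rabs_pos_eq by apply Cmod_ge_0. apply H; lia.
Qed.

Lemma Cser_ext a b : (forall n, (1 <= n)%nat -> a n = b n) -> Cser a = Cser b.
Proof.
  intros H. unfold Cser. f_equal; apply Series_ext; intros n; rewrite H by lia; reflexivity.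
Qed.

Lemma Csmb_ext a b : (forall n, (1 <= n)%nat -> a n = b n) -> Csmb a -> Csmb b.
Proof.
  intros H. apply ex_series_ext; intros n; rewrite H by lia; reflexivity.
Qed.

Lemma csum_plus a b n : csum (fun i => a i + b i) n = csum a n + csum b n.
Proof. induction n as [|n IH]; simpl; [|rewrite IH]; ring. Qed.
Lemma csum_scal c a n : csum (fun i => c * a i) n = c * csum a n.
Proof. induction n as [|n IH]; simpl; [|rewrite IH]; ring. Qed.

Lemma Csmb_plus a b : Csmb a -> Csmb b -> Csmb (fun n => a n + b n).
Proof.
  intros H1 H2. apply (Csmb_le _ (fun n => Cmod (a n) + Cmod (b n))%R).
  - intros n _; apply Cmod_triangle.
  - apply (ex_series_plus (K := R_AbsRing) (V := R_NormedModule) _ _ H1 H2).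
Qed.

Lemma Csmb_scal c a : Csmb a -> Csmb (fun n => c * a n).
Proof.
  intros H. apply (Csmb_le _ (fun n => Cmod c * Cmod (a n))%R).
  - intros n _; rewrite Cmod_mult; apply Rle_refl.
  - apply (ex_series_scal_l (K := R_AbsRing) (Cmod c) (fun n => Cmod (a (S n))) H).
Qed.

Lemma Cser_plus a b : Csmb a -> Csmb b -> Cser (fun n => a n + b n) = Cser a + Cser b.
Proof.
  intros H1 H2. apply Cser_eq; [apply Csmb_plus; assumption|].
  apply (Ccv_ext (fun n => csum a n + csum b n)); [intros; symmetry; apply csum_plus|].
  apply Ccv_plus; apply Cser_cv; assumption.
Qed.

Lemma Cser_scal c a : Csmb a -> Cser (fun n => c * a n) = c * Cser a.
Proof.
  intros H. apply Cser_eq; [apply Csmb_scal; assumption|].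
  apply (Ccv_ext (fun n => c * csum a n)); [intros; symmetry; apply csum_scal|].
  apply Ccv_scal, Cser_cv; assumption.
Qed.

Lemma Cser_finite (a : nat -> C) m : (forall n, (m < n)%nat -> a n = 0) -> Csmb a /\ Cser a = csum a m.
Proof.
  intros H.
  assert (Hs : Csmb a).
  { unfold Csmb. apply (ex_series_incr_n (K := R_AbsRing) (V := R_NormedModule) _ m).
    apply (ex_series_ext (fun _ => 0%R)).
    - intros n. rewrite H by lia. symmetry; apply Cmod_0.
    - exists 0%R. change (is_lim_seq (sum_n (fun _ : nat => 0%R)) 0%R). apply (is_lim_seq_ext (fun _ => 0%R)); [|apply is_lim_seq_const].
      intros n. rewrite sum_n_const. ring. }
  split; [exact Hs|]. apply Cser_eq; [exact Hs|].
  apply (Ccv_ext_loc (fun _ => csum a m)); [|apply Ccv_const].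
  exists m; intros n Hn. induction Hn as [|n Hn IH]; [reflexivity|].
  simpl. rewrite <- IH, H by lia. ring.
Qed.

Lemma Cmod_csum_sub a b m n : (m <= n)%nat ->
  (forall i, (m < i <= n)%nat -> Cmod (a i) <= b i)%R ->
  (Cmod (csum a n - csum a m) <= rsum b n - rsum b m)%R.
Proof.
  intros Hmn. induction Hmn as [|n Hmn IH]; intros H.
  - replace (csum a m - csum a m) with (RtoC 0) by ring. rewrite Cmod_0. lra.
  - simpl. replace (csum a n + a (S n) - csum a m) with ((csum a n - csum a m) + a (S n)) by ring.
    eapply Rle_trans; [apply Cmod_triangle|].
    assert (Cmod (csum a n - csum a m) <= rsum b n - rsum b m)%R by (apply IH; intros; apply H; lia).
    assert (Cmod (a (S n)) <= b (S n))%R by (apply H; lia). lra.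
Qed.

Lemma Cser_tail (a : nat -> C) (b : nat -> R) (B : R) m :
  is_lim_seq (rsum b) B -> (forall n, (1 <= n)%nat -> Cmod (a n) <= b n)%R -> Csmb a ->
  (Cmod (Cser a - csum a m) <= B - rsum b m)%R.
Proof.
  intros HB H Ha.
  assert (H1 : Ccv (fun n => csum a (m + n)%nat - csum a m) (Cser a - csum a m)).
  { apply Ccv_minus; [|apply Ccv_const].
    apply (Ccv_subseq (csum a) _ (fun n => (m + n)%nat)); [intros; lia|apply Cser_cv; exact Ha]. }
  apply Ccv_Cmod in H1.
  refine (is_lim_seq_le _ (fun n => rsum b (m + n) - rsum b m)%R _ (B - rsum b m)%R _ H1 _).
  - intros n. apply Cmod_csum_sub; [lia|]. intros i Hi; apply H; lia.
  - apply is_lim_seq_minus'; [|apply is_lim_seq_const].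
    apply (is_lim_seq_subseq (rsum b) B (fun n => (m + n)%nat)); [|exact HB].
    intros P [N HN]; exists N; intros n Hn; apply HN; lia.
Qed.

Lemma Ccv_csum (a : nat -> nat -> C) l m :
  (forall i, (1 <= i)%nat -> Ccv (fun N => a N i) (l i)) ->
  Ccv (fun N => csum (a N) m) (csum l m).
Proof.
  intros H; induction m as [|m IH]; [exact (Ccv_const 0)|].
  simpl. apply Ccv_plus; [exact IH|apply H; lia].
Qed.

Lemma tannery (a : nat -> nat -> C) (l : nat -> C) (b : nat -> R) :
  (forall i, (1 <= i)%nat -> Ccv (fun N => a N i) (l i)) ->
  eventually (fun N => forall i, (1 <= i)%nat -> Cmod (a N i) <= b i)%R ->
  ex_series (fun n => b (S n)) ->
  Csmb l /\ Ccv (fun N => Cser (a N)) (Cser l).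
Proof.
  intros Hl [N0 Hb] [B HB]. pose proof (rsum_series b B HB) as Hlim.
  assert (Hlb : forall i, (1 <= i)%nat -> (Cmod (l i) <= b i)%R).
  { intros i Hi.
    apply (Ccv_le (fun n => a (N0 + n)%nat i)).
    - apply (Ccv_subseq (fun N => a N i) _ (fun n => (N0 + n)%nat)); [intros; lia|apply Hl, Hi].
    - intros n; apply Hb; [lia|exact Hi]. }
  assert (Hs : Csmb l) by (apply (Csmb_le _ b Hlb); exists B; exact HB).
  split; [exact Hs|].
  apply is_lim_seq_spec. intros eps.
  assert (P3 : (0 < eps / 3)%R) by (destruct eps as [e He]; simpl; lra).
  apply is_lim_seq_spec in Hlim. destruct (Hlim (mkposreal _ P3)) as [M HM].
  specialize (HM M (Nat.le_refl M)). simpl in HM.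
  pose proof (Ccv_csum a l M Hl) as Hc. apply is_lim_seq_spec in Hc.
  destruct (Hc (mkposreal _ P3)) as [N1 HN1].
  exists (N0 + N1)%nat; intros n Hn. rewrite Rminus_0_r, Rabs_pos_eq by apply Cmod_ge_0.
  specialize (HN1 n ltac:(lia)). simpl in HN1.
  rewrite Rminus_0_r, Rabs_pos_eq in HN1 by apply Cmod_ge_0.
  assert (Hbn : forall i, (1 <= i)%nat -> (Cmod (a n i) <= b i)%R) by (intros; apply Hb; [lia|assumption]).
  assert (T1 : (Cmod (Cser (a n) - csum (a n) M) <= B - rsum b M)%R).
  { apply Cser_tail; [apply rsum_series; exact HB|exact Hbn|].
    apply (Csmb_le _ b Hbn); exists B; exact HB. }
  assert (T2 : (Cmod (Cser l - csum l M) <= B - rsum b M)%R).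
  { apply Cser_tail; [apply rsum_series; exact HB|exact Hlb|exact Hs]. }
  replace (Cser (a n) - Cser l) with
    ((Cser (a n) - csum (a n) M) + ((csum (a n) M - csum l M) + - (Cser l - csum l M))) by ring.
  eapply Rle_lt_trans; [apply Cmod_triangle|].
  pose proof (Cmod_triangle (csum (a n) M - csum l M) (- (Cser l - csum l M))) as T3.
  rewrite Cmod_opp in T3.
  apply Rabs_def2 in HM. lra.
Qed.

(** * Partial fractions *)

Lemma Cexp_plus z w : Cexp (z + w) = Cexp z * Cexp w.
Proof.
  destruct z as [a b], w as [c e]. unfold Cexp. simpl Re; simpl Im.
  rewrite exp_plus, cos_plus, sin_plus.
  unfold Cmult, RtoC; simpl. f_equal; ring.
Qed.

Lemma Cexp_0 : Cexp 0 = 1.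
Proof. unfold Cexp; simpl. rewrite exp_0, cos_0, sin_0. unfold Cmult, RtoC; simpl. f_equal; ring. Qed.

Lemma Cmod_Cexp z : Cmod (Cexp z) = exp (Re z).
Proof.
  unfold Cexp. rewrite Cmod_mult, Cmod_R, Rabs_pos_eq by (left; apply exp_pos).
  replace (Cmod (cos (Im z), sin (Im z))) with 1%R; [ring|].
  unfold Cmod; simpl. replace (cos (Im z) * (cos (Im z) * 1) + sin (Im z) * (sin (Im z) * 1))%R
    with 1%R; [symmetry; apply sqrt_1|].
  pose proof (sin2_cos2 (Im z)) as H; unfold Rsqr in H; lra.
Qed.

Lemma Re_qarg z : Re (2 * RtoC PI * Ci * z) = (-2 * PI * Im z)%R.
Proof. destruct z as [a b]; simpl; ring. Qed.
Lemma Im_qarg z : Im (2 * RtoC PI * Ci * z) = (2 * PI * Re z)%R.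
Proof. destruct z as [a b]; simpl; ring. Qed.

Lemma qexp_plus z w : qexp (z + w) = qexp z * qexp w.
Proof. unfold qexp. rewrite <- Cexp_plus. f_equal; ring. Qed.

Lemma qexp_0 : qexp 0 = 1.
Proof. unfold qexp. rewrite Cmult_0_r. apply Cexp_0. Qed.

Lemma Cmod_qexp z : Cmod (qexp z) = exp (-2 * PI * Im z).
Proof. unfold qexp. rewrite Cmod_Cexp, Re_qarg. reflexivity. Qed.

Lemma qexp_neq0 z : qexp z <> 0.
Proof. apply Cmod_gt_0. rewrite Cmod_qexp. apply exp_pos. Qed.

Lemma qexp_opp z : qexp (- z) = / qexp z.
Proof.
  apply (Cmult_cancel (qexp z)); [apply qexp_neq0|].
  rewrite <- qexp_plus, Cinv_r by apply qexp_neq0.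
  replace (z + - z) with (RtoC 0) by ring. apply qexp_0.
Qed.

Lemma qexp_real (x : R) : qexp x = (cos (2 * PI * x), sin (2 * PI * x)).
Proof.
  unfold qexp, Cexp. rewrite Re_qarg, Im_qarg. simpl. rewrite Rmult_0_r, exp_0.
  unfold Cmult; simpl. f_equal; ring.
Qed.

Lemma qexp_1 : qexp 1 = 1.
Proof. rewrite qexp_real, Rmult_1_r, cos_2PI, sin_2PI. reflexivity. Qed.

Lemma qexp_half : qexp (1 / 2) = -1.
Proof.
  replace (1 / 2) with (RtoC (1 / 2)) by (rewrite RtoC_div by lra; reflexivity).
  rewrite qexp_real. replace (2 * PI * (1 / 2))%R with PI by field.
  rewrite cos_PI, sin_PI. reflexivity.
Qed.

Lemma qexp_mult_nat z n : qexp (RtoC (INR n) * z) = qexp z ^ n.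
Proof.
  induction n as [|n IH].
  - simpl INR. rewrite Cmult_0_l, qexp_0. reflexivity.
  - rewrite S_INR, RtoC_plus, Cpow_S, <- IH, <- qexp_plus. f_equal; ring.
Qed.

Lemma qexp_nat n : qexp (RtoC (INR n)) = 1.
Proof.
  replace (RtoC (INR n)) with (RtoC (INR n) * 1) by ring.
  rewrite qexp_mult_nat, qexp_1. apply Cpow_1_l.
Qed.

Lemma qexp_add_nat z n : qexp (z + RtoC (INR n)) = qexp z.
Proof. rewrite qexp_plus, qexp_nat; ring. Qed.

Lemma qexp_neq1 z : Im z <> 0%R -> qexp z <> 1.
Proof.
  intros H E. apply (f_equal Cmod) in E. rewrite Cmod_qexp, Cmod_1, <- exp_0 in E.
  apply exp_inv in E. pose proof PI_RGT_0. nra.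
Qed.

Lemma sin_lower t : (0 <= t <= 3 * PI / 4)%R -> (t / 9 <= sin t)%R.
Proof.
  intros Ht.
  assert (G : forall x, (0 <= x <= PI / 2)%R -> (x / 3 <= sin x)%R).
  { intros x Hx. pose proof PI_4. pose proof PI2_3_2.
    assert (Hb := pre_sin_bound x 0%nat (proj1 Hx) ltac:(lra)).
    destruct Hb as [Hb _]. unfold sin_approx, sum_f_R0, sin_term in Hb. simpl in Hb.
    apply (Rle_trans _ (x - x * x * x / 6)%R); [|nra].
    assert (x * x <= 4)%R; nra. }
  destruct (Rle_dec t (PI / 2)).
  - pose proof (G t ltac:(lra)). lra.
  - rewrite <- sin_PI_x. pose proof (G (PI - t)%R ltac:(lra)). lra.
Qed.

Lemma sin_sqr_lower x : (Rabs x <= 3 / 4)%R -> (x * x <= 9 * (sin (PI * x) * sin (PI * x)))%R.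
Proof.
  intros Hx.
  assert (G : forall y, (0 <= y <= 3 / 4)%R -> (y * y <= 9 * (sin (PI * y) * sin (PI * y)))%R).
  { intros y Hy. pose proof PI2_3_2. pose proof (sin_lower (PI * y) ltac:(nra)).
    assert (y / 3 <= sin (PI * y))%R by nra. nra. }
  destruct (Rcase_abs x) as [Hn|Hp].
  - rewrite Rabs_left in Hx by assumption.
    pose proof (G (- x)%R ltac:(lra)) as H.
    replace (PI * - x)%R with (- (PI * x))%R in H by ring. rewrite sin_neg in H. lra.
  - rewrite Rabs_right in Hx by assumption. apply G. lra.
Qed.

Lemma exp_sub_lower s : (s * s <= (exp s - exp (- s)) * (exp s - exp (- s)))%R.
Proof.
  assert (G : forall t, (0 <= t)%R -> (t <= exp t - exp (- t))%R).
  { intros t Ht. assert (1 + t <= exp t)%R.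
    { destruct (Req_dec t 0) as [->|Hn]; [rewrite exp_0; lra|].
      left; apply exp_ineq1; lra. }
    assert (exp (- t) <= 1)%R; [|lra].
    rewrite <- exp_0. destruct (Req_dec t 0) as [->|Hn]; [rewrite Ropp_0; lra|].
    left; apply exp_increasing; lra. }
  destruct (Rle_dec 0 s) as [H|H].
  - pose proof (G s H). nra.
  - pose proof (G (- s)%R ltac:(lra)) as Hs. rewrite Ropp_involutive in Hs. nra.
Qed.

(* [|1 - q|^2 / |q| = (e^(pi y) - e^(-pi y))^2 + 4 sin(pi x)^2] for [q = e^(2 pi i (x + i y))]. *)
Lemma qexp_sub1_lower v : (Rabs (Re v) <= 3 / 4)%R ->
  (Cmod (qexp v) * (Cmod v * Cmod v) <= 3 * (Cmod (1 - qexp v) * Cmod (1 - qexp v)))%R.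
Proof.
  destruct v as [x y]. intros Hx. simpl Re in Hx.
  assert (S2 : forall z, (Cmod z * Cmod z = Re z * Re z + Im z * Im z)%R).
  { intros z. unfold Cmod. rewrite sqrt_sqrt; [unfold Re, Im; ring|nra]. }
  rewrite Cmod_qexp, !S2. simpl Re at 1 2. simpl Im at 1 2 3.
  replace (1 - qexp (x, y)) with
    ((1 - exp (-2 * PI * y) * cos (2 * PI * x), - (exp (-2 * PI * y) * sin (2 * PI * x)))%R : C).
  2:{ unfold qexp, Cexp. rewrite Re_qarg, Im_qarg. simpl Re; simpl Im.
      unfold Cmult, Cminus, Cplus, Copp, RtoC; simpl. f_equal; ring. }
  simpl Re; simpl Im.
  assert (Ee : (exp (-2 * PI * y) * ((exp (PI * y) - exp (- (PI * y))) * (exp (PI * y) - exp (- (PI * y))))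
    = 1 - 2 * exp (-2 * PI * y) + exp (-2 * PI * y) * exp (-2 * PI * y))%R).
  { assert (E1 : (exp (PI * y) * exp (- (PI * y)) = 1)%R)
      by (rewrite <- exp_plus, Rplus_opp_r; apply exp_0).
    assert (E2 : (exp (-2 * PI * y) = exp (- (PI * y)) * exp (- (PI * y)))%R)
      by (rewrite <- exp_plus; f_equal; ring).
    rewrite E2. set (a := exp (PI * y)) in *. set (b := exp (- (PI * y))) in *.
    transitivity ((a * b) * (a * b) - 2 * (a * b) * (b * b) + b * b * (b * b))%R; [ring|].
    rewrite E1. ring. }
  pose proof (exp_sub_lower (PI * y)) as Hy. pose proof (sin_sqr_lower x Hx) as Hs.
  pose proof (exp_pos (-2 * PI * y)) as Hp. set (E := exp (-2 * PI * y)) in *.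
  replace (2 * PI * x)%R with (2 * (PI * x))%R by ring.
  pose proof (sin2_cos2 (2 * (PI * x))) as Hsc. unfold Rsqr in Hsc.
  assert (Hc : (cos (2 * (PI * x)) = 1 - 2 * (sin (PI * x) * sin (PI * x)))%R)
    by (rewrite cos_2a_sin; ring).
  set (c := cos _) in *. set (s2 := sin (2 * (PI * x))) in *. set (s1 := sin (PI * x)) in *.
  assert (Hyy : (y * y <= PI * y * (PI * y))%R).
  { pose proof PI2_3_2. assert (1 <= PI * PI)%R by nra. pose proof (Rle_0_sqr y). unfold Rsqr in *. nra. }
  replace ((1 - E * c) * (1 - E * c) + - (E * s2) * - (E * s2))%R with
    (1 - 2 * E * c + E * E * (s2 * s2 + c * c))%R by ring.
  rewrite Hsc, Hc.
  replace (1 - 2 * E * (1 - 2 * (s1 * s1)) + E * E * 1)%R with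
    ((1 - 2 * E + E * E) + E * (4 * (s1 * s1)))%R by ring.
  rewrite <- Ee, <- Rmult_plus_distr_l, <- Rmult_assoc, (Rmult_comm 3), Rmult_assoc.
  apply Rmult_le_compat_l; [lra|]. pose proof (Rle_0_sqr y). pose proof (Rle_0_sqr s1). unfold Rsqr in *. lra.
Qed.

Lemma inv_pow2_lim : is_lim_seq (fun k => / 2 ^ k)%R 0%R.
Proof.
  apply (is_lim_seq_ext (fun k => (/ 2) ^ k)%R).
  - intros n. rewrite pow_inv. reflexivity.
  - apply is_lim_seq_geom. rewrite Rabs_pos_eq; lra.
Qed.

Lemma derivative_seq (f : R -> R) (l : R) : derivable_pt_lim f 0 l ->
  is_lim_seq (fun k => 2 ^ k * (f (/ 2 ^ k) - f 0))%R l.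
Proof.
  intros H. apply is_lim_seq_spec. intros eps. destruct (H eps (cond_pos eps)) as [d Hd].
  pose proof inv_pow2_lim as HL. apply is_lim_seq_spec in HL. destruct (HL d) as [N HN].
  exists N; intros n Hn. specialize (HN n Hn). rewrite Rminus_0_r in HN.
  assert (P : (0 < 2 ^ n)%R) by (apply pow_lt; lra).
  specialize (Hd (/ 2 ^ n)%R ltac:(apply Rinv_neq_0_compat; lra) HN).
  rewrite Rplus_0_l in Hd.
  replace (2 ^ n * (f (/ 2 ^ n) - f 0))%R with ((f (/ 2 ^ n) - f 0) / / 2 ^ n)%R by (field; lra).
  exact Hd.
Qed.

Definition pow2 (k : nat) : C := RtoC (2 ^ k).

Lemma pow2_neq0 k : pow2 k <> 0.
Proof. apply RtoC_neq0, pow_nonzero; lra. Qed.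

Lemma qexp_derivative z :
  Ccv (fun k => pow2 k * (qexp (z / pow2 k) - 1)) (2 * RtoC PI * Ci * z).
Proof.
  destruct z as [x y].
  assert (Ez : forall k, qexp ((x, y) / pow2 k) =
    ((exp (-2 * PI * y * / 2 ^ k) * cos (2 * PI * x * / 2 ^ k)),
     (exp (-2 * PI * y * / 2 ^ k) * sin (2 * PI * x * / 2 ^ k)))%R).
  { intros k. assert (2 ^ k <> 0)%R by (apply pow_nonzero; lra).
    replace ((x, y) / pow2 k) with ((x * / 2 ^ k, y * / 2 ^ k)%R : C).
    - unfold qexp, Cexp. rewrite Re_qarg, Im_qarg. simpl Re; simpl Im.
      unfold Cmult, RtoC; simpl. f_equal;
      rewrite ?Rmult_0_l, ?Rminus_0_r, ?Rplus_0_r; do 2 f_equal; ring.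
    - unfold Cdiv, pow2. rewrite <- RtoC_inv by assumption.
      unfold Cmult, RtoC; simpl. f_equal; ring. }
  apply Ccv_Re_Im.
  - rewrite Re_qarg. simpl Im.
    apply (is_lim_seq_ext (fun k => 2 ^ k * ((fun t => exp (-2 * PI * y * t) * cos (2 * PI * x * t)) (/ 2 ^ k)
      - (fun t => exp (-2 * PI * y * t) * cos (2 * PI * x * t)) 0))%R).
    + intros k. rewrite Ez. rewrite !Rmult_0_r, exp_0, cos_0. simpl. ring.
    + apply (derivative_seq (fun t => exp (-2 * PI * y * t) * cos (2 * PI * x * t))%R).
      apply is_derive_Reals. auto_derive; [trivial|].
      rewrite !Rmult_0_r, exp_0, cos_0, sin_0. ring.
  - rewrite Im_qarg. simpl Re.
    apply (is_lim_seq_ext (fun k => 2 ^ k * ((fun t => exp (-2 * PI * y * t) * sin (2 * PI * x * t)) (/ 2 ^ k)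
      - (fun t => exp (-2 * PI * y * t) * sin (2 * PI * x * t)) 0))%R).
    + intros k. rewrite Ez. rewrite !Rmult_0_r, exp_0, sin_0. simpl. ring.
    + apply (derivative_seq (fun t => exp (-2 * PI * y * t) * sin (2 * PI * x * t))%R).
      apply is_derive_Reals. auto_derive; [trivial|].
      rewrite !Rmult_0_r, exp_0, cos_0, sin_0. ring.
Qed.

Lemma inv_pow2_Ccv : Ccv (fun k => / pow2 k) 0.
Proof.
  apply (Ccv_squeeze _ _ (fun k => / 2 ^ k)%R); [|apply inv_pow2_lim].
  intros k. replace (/ pow2 k - 0) with (/ pow2 k) by ring.
  rewrite Cmod_inv by apply pow2_neq0. unfold pow2. rewrite Cmod_R, Rabs_pos_eq; [lra|].
  apply pow_le; lra.
Qed.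

Lemma qexp_lim1 z : Ccv (fun k => qexp (z / pow2 k)) 1.
Proof.
  apply (Ccv_ext (fun k => 1 + / pow2 k * (pow2 k * (qexp (z / pow2 k) - 1)))).
  - intros k. field. apply pow2_neq0.
  - pose proof (Ccv_plus _ _ _ _ (Ccv_const 1)
      (Ccv_mult _ _ _ _ inv_pow2_Ccv (qexp_derivative z))) as H.
    replace (1 + 0 * (2 * RtoC PI * Ci * z)) with (RtoC 1) in H by ring. exact H.
Qed.

Lemma qexp_div_pow2_neq1 z k : qexp z <> 1 -> qexp (z / pow2 k) <> 1.
Proof.
  intros H E. apply H. replace z with (RtoC (INR (2 ^ k)) * (z / pow2 k)).
  - rewrite qexp_mult_nat, E. apply Cpow_1_l.
  - rewrite pow_INR. change (INR 2) with 2%R. fold (pow2 k). field. apply pow2_neq0.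
Qed.

Lemma csum_split f m n : csum f (m + n) = csum f m + csum (fun j => f (m + j)%nat) n.
Proof.
  induction n as [|n IH]; [rewrite Nat.add_0_r; simpl; ring|].
  rewrite Nat.add_succ_r. simpl. rewrite IH, Nat.add_succ_r. ring.
Qed.

Lemma csum_rev f n : csum (fun i => f (S n - i)%nat) n = csum f n.
Proof.
  revert f; induction n as [|n IH]; intros f; [reflexivity|].
  change (csum f (S n)) with (csum f n + f (S n)).
  rewrite <- (IH f). rewrite (csum_split _ 1 n : csum _ (S n) = _).
  simpl csum at 1. rewrite (csum_ext (fun j => f (S (S n) - (1 + j))%nat) (fun i => f (S n - i)%nat)).
  - simpl; ring.
  - intros i _. f_equal.
Qed.

Lemma csum_shift f n : csum (fun j => f (j - 1)%nat) n = f 0%nat + csum f n - f n.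
Proof.
  induction n as [|n IH]; [simpl; ring|].
  simpl csum. rewrite IH, Nat.sub_0_r. ring.
Qed.

Lemma csum_wrap h m : h (m + m)%nat = h 0%nat ->
  csum h (m + m) = h 0%nat - h m + csum (fun j => h j + h (m + m - j)%nat) m.
Proof.
  intros H. rewrite csum_split, <- (csum_rev (fun j => h (m + j)%nat)), csum_plus.
  rewrite (csum_ext (fun i => h (m + (S m - i))%nat)
    (fun i => (fun j => h (m + m - j)%nat) (i - 1)%nat)).
  - rewrite (csum_shift (fun j => h (m + m - j)%nat)), Nat.sub_0_r, H. replace (m + m - m)%nat with m by lia. ring.
  - intros i Hi. f_equal. lia.
Qed.

Lemma pow2_nat k : pow2 k = RtoC (INR (2 ^ k)).
Proof. unfold pow2. rewrite pow_INR. reflexivity. Qed.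
Lemma pow2_S k : pow2 (S k) = 2 * pow2 k.
Proof. unfold pow2. simpl. rewrite RtoC_mult. reflexivity. Qed.

Lemma rsum_inv_sqr n : (rsum (fun i => / (INR i * INR i)) (S n) <= 2 - / INR (S n))%R.
Proof.
  set (f := fun i : nat => (/ (INR i * INR i))%R).
  induction n as [|n IH]; [unfold f; simpl; lra|].
  assert (E : rsum f (S (S n)) = (rsum f (S n) + f (S (S n)))%R) by reflexivity.
  rewrite E. unfold f at 2.
  rewrite (S_INR (S n)). set (x := INR (S n)) in *.
  assert (0 < x)%R by (apply lt_0_INR; lia).
  assert (/ ((x + 1) * (x + 1)) <= / x - / (x + 1))%R; [|lra].
  replace (/ x - / (x + 1))%R with (/ (x * (x + 1)))%R by (field; lra).
  apply Rinv_le_contravar; nra.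
Qed.

Lemma ex_series_inv_sqr : ex_series (fun n => / (INR (S n) * INR (S n)))%R.
Proof.
  set (f := fun i : nat => (/ (INR i * INR i))%R).
  assert (H : ex_finite_lim_seq (fun n => rsum f (S n))).
  { apply (ex_finite_lim_seq_incr _ 2).
    - intros n. change (rsum f (S (S n))) with (rsum f (S n) + f (S (S n)))%R.
      assert (0 < f (S (S n)))%R; [|lra]. unfold f. apply Rinv_0_lt_compat.
      pose proof (lt_0_INR (S (S n)) ltac:(lia)). nra.
    - intros n. pose proof (rsum_inv_sqr n) as H. fold f in H.
      assert (0 < / INR (S n))%R by (apply Rinv_0_lt_compat, lt_0_INR; lia). lra. }
  destruct H as [l Hl]. exists l.
  change (is_lim_seq (sum_n (fun n => f (S n))) l).
  apply (is_lim_seq_ext (fun n => rsum f (S n))); [|exact Hl].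
  intros n. apply (rsum_sum_n f).
Qed.

Lemma ex_series_scaled_inv_sqr K : ex_series (fun n => K * / (INR (S n) * INR (S n)))%R.
Proof.
  apply (ex_series_scal_l (K := R_AbsRing) K (fun n => / (INR (S n) * INR (S n)))%R),
    ex_series_inv_sqr.
Qed.

Definition far (d : R) (z : C) : Prop := (0 < d)%R /\
  forall j, (1 <= j)%nat -> (d * INR j <= Cmod (z + cn j))%R /\ (d * INR j <= Cmod (z - cn j))%R.

Lemma far_neq0 d z j : far d z -> (1 <= j)%nat -> z + cn j <> 0 /\ z - cn j <> 0.
Proof.
  intros [Hd H] Hj. destruct (H j Hj) as [H1 H2].
  assert (0 < INR j)%R by (apply lt_0_INR; lia).
  split; apply Cmod_gt_0; nra.
Qed.

Section PartialFractions.
Variables (F L : C -> C) (c : C).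
Hypothesis F_per : forall z n, F (z + cn n) = F z.
Hypothesis F_dbl : forall z, qexp z <> 1 -> F z = c * (F (z / 2) + F ((z + 1) / 2)).
Hypothesis F_lim : forall z : C, z <> 0 -> Ccv (fun k => c ^ k * F (z / pow2 k)) (L z).
Hypothesis F_half : forall z, Ccv (fun k => c ^ S k * F (z / pow2 (S k) + 1 / 2)) 0.

Lemma pf_sum z k : qexp z <> 1 -> F z = c ^ k * csum (fun j => F ((z + cn j) / pow2 k)) (2 ^ k).
Proof.
  intros Hz. induction k as [|k IH].
  - simpl. rewrite <- (F_per z 1). change (cn 1) with (RtoC 1).
    replace ((z + 1) / pow2 0) with (z + 1) by (unfold pow2; simpl; field). ring.
  - rewrite IH. replace (2 ^ S k)%nat with (2 ^ k + 2 ^ k)%nat by (simpl; lia).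
    rewrite csum_split, <- csum_plus, Cpow_S.
    replace (c * c ^ k) with (c ^ k * c) by ring. rewrite <- Cmult_assoc, <- (csum_scal c).
    f_equal. apply csum_ext; intros j _.
    rewrite F_dbl.
    + f_equal. f_equal; f_equal.
      * rewrite pow2_S. field. apply pow2_neq0.
      * rewrite cn_add. unfold cn at 2. rewrite <- pow2_nat, pow2_S. field. apply pow2_neq0.
    + apply qexp_div_pow2_neq1. unfold cn. rewrite qexp_add_nat. exact Hz.
Qed.

Lemma pf_paired z k : qexp z <> 1 ->
  F z = c ^ S k * F (z / pow2 (S k)) - c ^ S k * F (z / pow2 (S k) + 1 / 2)
    + c ^ S k * csum (fun j => F ((z + cn j) / pow2 (S k)) + F ((z - cn j) / pow2 (S k))) (2 ^ k).
Proof.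
  intros Hz. rewrite (pf_sum z (S k) Hz) at 1.
  assert (E : cn (2 ^ k + 2 ^ k) = pow2 (S k)).
  { rewrite cn_add. unfold cn. rewrite <- pow2_nat, pow2_S. ring. }
  replace (2 ^ S k)%nat with (2 ^ k + 2 ^ k)%nat by (simpl; lia).
  pose proof (pow2_neq0 (S k)) as Hn. pose proof (pow2_neq0 k) as Hn'.
  rewrite csum_wrap.
  - rewrite (csum_ext _ (fun j => F ((z + cn j) / pow2 (S k)) + F ((z - cn j) / pow2 (S k)))).
    + replace ((z + cn 0) / pow2 (S k)) with (z / pow2 (S k))
        by (change (cn 0) with (RtoC 0); field; exact Hn).
      replace ((z + cn (2 ^ k)) / pow2 (S k)) with (z / pow2 (S k) + 1 / 2)
        by (unfold cn; rewrite <- pow2_nat, pow2_S; field; exact Hn').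
      ring.
    + intros j Hj. f_equal. rewrite cn_sub, E by lia.
      rewrite <- (F_per ((z - cn j) / pow2 (S k)) 1). f_equal.
      change (cn 1) with (RtoC 1). field. exact Hn.
  - rewrite E, <- (F_per ((z + cn 0) / pow2 (S k)) 1). f_equal.
    change (cn 0) with (RtoC 0). change (cn 1) with (RtoC 1). field. exact Hn.
Qed.

Lemma partial_fractions z d K : qexp z <> 1 -> far d z ->
  eventually (fun k => forall j, (1 <= j <= 2 ^ k)%nat ->
    (Cmod (c ^ S k * (F ((z + cn j) / pow2 (S k)) + F ((z - cn j) / pow2 (S k))))
      <= K * / (INR j * INR j))%R) ->
  Csmb (fun j => L (z + cn j) + L (z - cn j)) /\
  F z = L z + Cser (fun j => L (z + cn j) + L (z - cn j)).
Proof.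
  intros Hz Hfar [k0 Hdom].
  assert (Hz0 : z <> 0) by (intros E; apply Hz; rewrite E; apply qexp_0).
  set (a := fun k j => if (j <=? 2 ^ k)%nat
    then c ^ S k * (F ((z + cn j) / pow2 (S k)) + F ((z - cn j) / pow2 (S k))) else 0).
  destruct (tannery a (fun j => L (z + cn j) + L (z - cn j)) (fun j => Rabs K * / (INR j * INR j))%R)
    as [Hs Hc].
  - intros j Hj. destruct (far_neq0 d z j Hfar Hj) as [H1 H2].
    apply (Ccv_ext_loc (fun k => c ^ S k * F ((z + cn j) / pow2 (S k))
      + c ^ S k * F ((z - cn j) / pow2 (S k)))).
    + exists j; intros k Hk. unfold a. destruct (Nat.leb_spec j (2 ^ k)) as [|H]; [ring|].
      pose proof (Nat.pow_gt_lin_r 2 k ltac:(lia)). lia.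
    + apply Ccv_plus.
      * apply (Ccv_subseq (fun k => c ^ k * F ((z + cn j) / pow2 k)) _ S); [lia|apply F_lim, H1].
      * apply (Ccv_subseq (fun k => c ^ k * F ((z - cn j) / pow2 k)) _ S); [lia|apply F_lim, H2].
  - exists k0; intros k Hk j Hj. unfold a.
    assert (0 < INR j)%R by (apply lt_0_INR; lia).
    assert (0 < / (INR j * INR j))%R by (apply Rinv_0_lt_compat; nra).
    destruct (Nat.leb_spec j (2 ^ k)) as [H'|H'].
    + eapply Rle_trans; [apply Hdom; [exact Hk|lia]|].
      apply Rmult_le_compat_r; [lra|apply Rle_abs].
    + rewrite Cmod_0. apply Rmult_le_pos; [apply Rabs_pos|lra].
  - apply ex_series_scaled_inv_sqr.
  - split; [exact Hs|].
    apply (Ccv_unique (fun _ => F z)); [apply Ccv_const|].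
    apply (Ccv_ext (fun k => c ^ S k * F (z / pow2 (S k)) - c ^ S k * F (z / pow2 (S k) + 1 / 2)
      + Cser (a k))).
    + intros k. rewrite (pf_paired z k Hz). f_equal.
      destruct (Cser_finite (a k) (2 ^ k)) as [_ E].
      { intros n Hn. unfold a. destruct (Nat.leb_spec n (2 ^ k)); [lia|reflexivity]. }
      rewrite E, <- csum_scal. apply csum_ext; intros j Hj. unfold a.
      destruct (Nat.leb_spec j (2 ^ k)); [reflexivity|lia].
    + apply Ccv_plus; [|exact Hc].
      replace (L z) with (L z - 0) by ring. apply Ccv_minus; [|apply F_half].
      apply (Ccv_subseq (fun k => c ^ k * F (z / pow2 k)) _ S); [lia|apply F_lim, Hz0].
Qed.
End PartialFractions.

(* [pi^2 / sin(pi z)^2] and [pi cot(pi z)]. *)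
Definition csc2 (z : C) : C := -4 * (RtoC PI * RtoC PI) * (qexp z / ((1 - qexp z) * (1 - qexp z))).
Definition pcot (z : C) : C := RtoC PI * Ci * ((qexp z + 1) / (qexp z - 1)).

Lemma csc2_add_nat z n : csc2 (z + cn n) = csc2 z.
Proof. unfold csc2, cn. rewrite qexp_add_nat. reflexivity. Qed.
Lemma pcot_add_nat z n : pcot (z + cn n) = pcot z.
Proof. unfold pcot, cn. rewrite qexp_add_nat. reflexivity. Qed.

Lemma qexp_halves z : qexp z = qexp (z / 2) * qexp (z / 2) /\ qexp ((z + 1) / 2) = - qexp (z / 2).
Proof.
  split.
  - rewrite <- qexp_plus. f_equal. field.
  - replace ((z + 1) / 2) with (z / 2 + 1 / 2) by field. rewrite qexp_plus, qexp_half. ring.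
Qed.

Lemma sqr_neq1 (p : C) : p * p <> 1 -> 1 - p <> 0 /\ 1 + p <> 0.
Proof.
  intros H; split; intros E; apply H.
  - replace p with (1 - (1 - p)) by ring. rewrite E; ring.
  - replace p with ((1 + p) - 1) by ring. rewrite E; ring.
Qed.

Lemma csc2_double z : qexp z <> 1 -> csc2 z = / 4 * (csc2 (z / 2) + csc2 ((z + 1) / 2)).
Proof.
  intros H. unfold csc2. destruct (qexp_halves z) as [E1 E2]. rewrite E1 in *. rewrite E2.
  set (p := qexp (z / 2)) in *. destruct (sqr_neq1 p H) as [H1 H2].
  field. repeat split; try assumption.
  - replace (1 - - p) with (1 + p) by ring. exact H2.
  - replace (1 - p * p) with ((1 - p) * (1 + p)) by ring. apply Cmult_neq_0; assumption.
Qed.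

Lemma pcot_double z : qexp z <> 1 -> pcot z = / 2 * (pcot (z / 2) + pcot ((z + 1) / 2)).
Proof.
  intros H. unfold pcot. destruct (qexp_halves z) as [E1 E2]. rewrite E1 in *. rewrite E2.
  set (p := qexp (z / 2)) in *. destruct (sqr_neq1 p H) as [H1 H2].
  assert (p - 1 <> 0).
  { intros E; apply H1. replace (1 - p) with (- (p - 1)) by ring. rewrite E; ring. }
  field. repeat split; try assumption.
  - intros E; apply H2. replace (1 + p) with (- (- p - 1)) by ring. rewrite E; ring.
  - replace (p * p - 1) with ((p - 1) * (1 + p)) by ring. apply Cmult_neq_0; assumption.
Qed.

Lemma inv4_pow k : (/ 4) ^ k = / pow2 k * / pow2 k.
Proof.
  induction k as [|k IH]; [unfold pow2; simpl; field|].
  rewrite Cpow_S, IH, pow2_S. field. apply pow2_neq0.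
Qed.
Lemma inv2_pow k : (/ 2) ^ k = / pow2 k.
Proof.
  induction k as [|k IH]; [unfold pow2; simpl; field|].
  rewrite Cpow_S, IH, pow2_S. field. apply pow2_neq0.
Qed.

Lemma PI_C_neq0 : RtoC PI <> 0.
Proof. apply RtoC_neq0, PI_neq0. Qed.

Lemma Ci_sqr : Ci * Ci = -1.
Proof. unfold Ci, Cmult, RtoC; simpl. f_equal; ring. Qed.

Lemma qexp_neq1_eventually (z : C) : z <> 0 -> eventually (fun k => qexp (z / pow2 k) <> 1).
Proof.
  intros Hz.
  assert (Hn : 2 * RtoC PI * Ci * z <> 0).
  { repeat apply Cmult_neq_0; auto using PI_C_neq0, Ci_nz. apply RtoC_neq0; lra. }
  destruct (Ccv_neq0 _ _ Hn (qexp_derivative z)) as [N HN].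
  exists N; intros n Hn' E. apply (HN n Hn'). rewrite E. ring.
Qed.

Lemma csc2_lim (z : C) : z <> 0 -> Ccv (fun k => (/ 4) ^ k * csc2 (z / pow2 k)) (/ (z * z)).
Proof.
  intros Hz. set (D := 2 * RtoC PI * Ci * z).
  assert (HD : D <> 0).
  { unfold D. repeat apply Cmult_neq_0; auto using PI_C_neq0, Ci_nz. apply RtoC_neq0; lra. }
  pose proof (qexp_derivative z) as H1. fold D in H1.
  pose proof (Ccv_mult _ _ _ _ (qexp_lim1 z)
    (Ccv_inv _ _ (Cmult_neq_0 _ _ HD HD) (Ccv_mult _ _ _ _ H1 H1))) as H2.
  apply (Ccv_scal (-4 * (RtoC PI * RtoC PI))) in H2.
  replace (-4 * (RtoC PI * RtoC PI) * (1 * / (D * D))) with (/ (z * z)) in H2.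
  - revert H2; apply Ccv_ext_loc. destruct (qexp_neq1_eventually z Hz) as [N HN].
    exists N; intros k Hk. specialize (HN k Hk). rewrite inv4_pow. unfold csc2.
    pose proof (pow2_neq0 k). set (q := qexp (z / pow2 k)) in *.
    assert (q - 1 <> 0) by (apply Cminus_eq_contra; exact HN).
    assert (1 - q <> 0) by (apply Cminus_eq_contra; auto).
    field. repeat split; assumption.
  - replace (D * D) with (4 * (RtoC PI * RtoC PI) * (Ci * Ci) * (z * z)) by (unfold D; ring).
    rewrite Ci_sqr. field. split; [exact Hz|exact PI_C_neq0].
Qed.

Lemma pcot_lim (z : C) : z <> 0 -> Ccv (fun k => (/ 2) ^ k * pcot (z / pow2 k)) (/ z).
Proof.
  intros Hz. set (D := 2 * RtoC PI * Ci * z).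
  assert (HD : D <> 0).
  { unfold D. repeat apply Cmult_neq_0; auto using PI_C_neq0, Ci_nz. apply RtoC_neq0; lra. }
  pose proof (qexp_derivative z) as H1. fold D in H1.
  pose proof (Ccv_mult _ _ _ _ (Ccv_plus _ _ _ _ (qexp_lim1 z) (Ccv_const 1))
    (Ccv_inv _ _ HD H1)) as H2.
  apply (Ccv_scal (RtoC PI * Ci)) in H2.
  replace (RtoC PI * Ci * ((1 + 1) * / D)) with (/ z) in H2.
  - revert H2; apply Ccv_ext_loc. destruct (qexp_neq1_eventually z Hz) as [N HN].
    exists N; intros k Hk. specialize (HN k Hk). rewrite inv2_pow. unfold pcot.
    pose proof (pow2_neq0 k). set (q := qexp (z / pow2 k)) in *.
    assert (q - 1 <> 0) by (apply Cminus_eq_contra; exact HN).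
    field. repeat split; assumption.
  - unfold D. field. repeat split; auto using PI_C_neq0, Ci_nz.
Qed.

Lemma qexp_half_lim z : Ccv (fun k => qexp (z / pow2 (S k) + 1 / 2)) (-1).
Proof.
  apply (Ccv_ext (fun k => -1 * qexp (z / pow2 (S k)))).
  - intros k. rewrite qexp_plus, qexp_half. ring.
  - pose proof (Ccv_scal (-1) _ _
      (Ccv_subseq _ _ S (fun n => Nat.le_succ_diag_r n) (qexp_lim1 z))) as H.
    rewrite Cmult_1_r in H. exact H.
Qed.

Lemma csc2_half z : Ccv (fun k => (/ 4) ^ S k * csc2 (z / pow2 (S k) + 1 / 2)) 0.
Proof.
  pose proof (qexp_half_lim z) as H.
  assert (H0 : (1 - -1) * (1 - -1) <> 0).
  { replace ((1 - -1) * (1 - -1)) with (RtoC 4) by ring. apply RtoC_neq0; lra. }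
  pose proof (Ccv_minus _ _ _ _ (Ccv_const 1) H) as H1.
  pose proof (Ccv_scal (-4 * (RtoC PI * RtoC PI)) _ _
    (Ccv_mult _ _ _ _ H (Ccv_inv _ _ H0 (Ccv_mult _ _ _ _ H1 H1)))) as H2.
  pose proof (Ccv_subseq _ _ S (fun n => Nat.le_succ_diag_r n) inv_pow2_Ccv) as H3.
  pose proof (Ccv_mult _ _ _ _ (Ccv_mult _ _ _ _ H3 H3) H2) as H4.
  replace (0 * 0 * _) with (RtoC 0) in H4 by ring.
  revert H4; apply Ccv_ext. intros k. rewrite inv4_pow. reflexivity.
Qed.

Lemma pcot_half z : Ccv (fun k => (/ 2) ^ S k * pcot (z / pow2 (S k) + 1 / 2)) 0.
Proof.
  pose proof (qexp_half_lim z) as H.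
  assert (H0 : -1 - 1 <> 0).
  { replace (-1 - 1) with (RtoC (-2)) by ring. apply RtoC_neq0; lra. }
  pose proof (Ccv_scal (RtoC PI * Ci) _ _
    (Ccv_mult _ _ _ _ (Ccv_plus _ _ _ _ H (Ccv_const 1))
      (Ccv_inv _ _ H0 (Ccv_minus _ _ _ _ H (Ccv_const 1))))) as H2.
  pose proof (Ccv_subseq _ _ S (fun n => Nat.le_succ_diag_r n) inv_pow2_Ccv) as H3.
  pose proof (Ccv_mult _ _ _ _ H3 H2) as H4.
  replace (0 * _) with (RtoC 0) in H4 by ring.
  revert H4; apply Ccv_ext. intros k. rewrite inv2_pow. reflexivity.
Qed.

Lemma Cmod_pow2 k : Cmod (pow2 k) = (2 ^ k)%R.
Proof. unfold pow2. rewrite Cmod_R. apply Rabs_pos_eq, pow_le; lra. Qed.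

Lemma Re_div_pow2 z k : Re (z / pow2 k) = (Re z * / 2 ^ k)%R.
Proof.
  unfold Cdiv, pow2. rewrite <- RtoC_inv by (apply pow_nonzero; lra).
  destruct z as [x y]. simpl. ring.
Qed.

Lemma Re_small_eventually z : eventually (fun k => forall j, (j <= 2 ^ k)%nat ->
  (Rabs (Re ((z + cn j) / pow2 (S k))) <= 3 / 4)%R /\
  (Rabs (Re ((z - cn j) / pow2 (S k))) <= 3 / 4)%R).
Proof.
  pose proof inv_pow2_lim as HL.
  assert (H : is_lim_seq (fun k => Rabs (Re z) * / 2 ^ k)%R 0%R).
  { replace (Finite 0) with (Finite (Rabs (Re z) * 0)) by (f_equal; ring).
    apply is_lim_seq_mult'; [apply is_lim_seq_const|exact HL]. }
  apply is_lim_seq_spec in H. destruct (H (mkposreal (1 / 4) ltac:(lra))) as [N HN]. simpl in HN.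
  exists N; intros k Hk j Hj. specialize (HN (S k) ltac:(lia)).
  rewrite !Re_div_pow2.
  assert (P : (0 < 2 ^ S k)%R) by (apply pow_lt; lra).
  assert (Pi : (0 < / 2 ^ S k)%R) by (apply Rinv_0_lt_compat; exact P).
  rewrite Rminus_0_r, Rabs_pos_eq in HN by (apply Rmult_le_pos; [apply Rabs_pos|lra]).
  assert (Hj' : (INR j * / 2 ^ S k <= 1 / 2)%R).
  { apply le_INR in Hj. rewrite pow_INR in Hj. change (INR 2) with 2%R in Hj.
    assert (P' : (0 < 2 ^ k)%R) by (apply pow_lt; lra).
    apply (Rle_trans _ (2 ^ k * / 2 ^ S k)%R); [apply Rmult_le_compat_r; lra|].
    right. simpl. field. lra. }
  pose proof (pos_INR j).
  replace (Re (z + cn j)) with (Re z + INR j)%R by (destruct z; reflexivity).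
  replace (Re (z - cn j)) with (Re z - INR j)%R by (destruct z; reflexivity).
  rewrite !Rabs_mult, !(Rabs_pos_eq (/ 2 ^ S k)) by lra.
  pose proof (Rabs_triang (Re z) (INR j)). pose proof (Rabs_triang (Re z) (- INR j)) as T2.
  rewrite Rabs_Ropp in T2. rewrite !(Rabs_pos_eq (INR j)) in * by lra.
  change (Re z - INR j)%R with (Re z + - INR j)%R.
  split; (eapply Rle_trans; [apply Rmult_le_compat_r; [lra|eassumption]|]); lra.
Qed.

Lemma csc2_bound (v : C) : v <> 0 -> qexp v <> 1 -> (Rabs (Re v) <= 3 / 4)%R ->
  (Cmod (csc2 v) <= 12 * (PI * PI) * / (Cmod v * Cmod v))%R.
Proof.
  intros Hv Hq HR. pose proof (qexp_sub1_lower v HR) as H.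
  assert (Pv : (0 < Cmod v)%R) by (apply Cmod_gt_0; exact Hv).
  assert (Pq : (0 < Cmod (1 - qexp v))%R) by (apply Cmod_gt_0, Cminus_eq_contra; auto).
  unfold csc2. pose proof PI_RGT_0.
  rewrite Cmod_mult, Cmod_div by (apply Cmult_neq_0; apply Cminus_eq_contra; auto).
  rewrite !Cmod_mult, !Cmod_R. rewrite Rabs_left, (Rabs_pos_eq PI) by lra.
  replace (12 * (PI * PI) * / (Cmod v * Cmod v))%R with
    (- -4 * (PI * PI) * (3 * / (Cmod v * Cmod v)))%R by ring.
  apply Rmult_le_compat_l; [nra|].
  set (a := Cmod v) in *. set (b := Cmod (1 - qexp v)) in *.
  apply (Rmult_le_reg_r (a * a * (b * b))); [apply Rmult_lt_0_compat; nra|].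
  replace (Cmod (qexp v) / (b * b) * (a * a * (b * b)))%R with (Cmod (qexp v) * (a * a))%R
    by (field; lra).
  replace (3 * / (a * a) * (a * a * (b * b)))%R with (3 * (b * b))%R by (field; lra).
  exact H.
Qed.

Lemma Cmod_div_pow2 z k : Cmod (z / pow2 k) = (Cmod z * / 2 ^ k)%R.
Proof. rewrite Cmod_div, Cmod_pow2 by apply pow2_neq0. reflexivity. Qed.

Lemma qexp_shift_neq1 z j k : qexp z <> 1 ->
  qexp ((z + cn j) / pow2 k) <> 1 /\ qexp ((z - cn j) / pow2 k) <> 1.
Proof.
  intros H; split; apply qexp_div_pow2_neq1; unfold cn.
  - rewrite qexp_add_nat; exact H.
  - rewrite <- (qexp_add_nat (z - RtoC (INR j)) j).
    replace (z - RtoC (INR j) + RtoC (INR j)) with z by ring. exact H.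
Qed.

Lemma csc2_term_bound (v : C) d j k : v <> 0 -> qexp (v / pow2 k) <> 1 ->
  (Rabs (Re (v / pow2 k)) <= 3 / 4)%R -> (0 < d)%R -> (1 <= j)%nat -> (d * INR j <= Cmod v)%R ->
  (Cmod ((/ 4) ^ k * csc2 (v / pow2 k)) <= 12 * (PI * PI) / (d * d) * / (INR j * INR j))%R.
Proof.
  intros Hv Hq HR Hd Hj Hdv.
  assert (Hj0 : (0 < INR j)%R) by (apply lt_0_INR; lia).
  assert (P : (0 < 2 ^ k)%R) by (apply pow_lt; lra).
  pose proof PI_RGT_0.
  assert (Hv' : v / pow2 k <> 0).
  { apply Cmod_gt_0. rewrite Cmod_div_pow2. apply Rmult_lt_0_compat; [nra|].
    apply Rinv_0_lt_compat; exact P. }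
  pose proof (csc2_bound _ Hv' Hq HR) as H1. rewrite Cmod_div_pow2 in H1.
  rewrite inv4_pow, Cmod_mult, Cmod_mult, !Cmod_inv, Cmod_pow2 by apply pow2_neq0.
  assert (0 < d * INR j)%R by nra.
  apply (Rle_trans _ (/ 2 ^ k * / 2 ^ k *
    (12 * (PI * PI) * / (Cmod v * / 2 ^ k * (Cmod v * / 2 ^ k))))%R).
  - apply Rmult_le_compat_l; [|exact H1].
    left; apply Rmult_lt_0_compat; apply Rinv_0_lt_compat; exact P.
  - replace (/ 2 ^ k * / 2 ^ k * (12 * (PI * PI) * / (Cmod v * / 2 ^ k * (Cmod v * / 2 ^ k))))%R
      with (12 * (PI * PI) * / (Cmod v * Cmod v))%R by (field; lra).
    replace (12 * (PI * PI) / (d * d) * / (INR j * INR j))%R with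
      (12 * (PI * PI) * / (d * INR j * (d * INR j)))%R by (field; lra).
    apply Rmult_le_compat_l; [nra|]. apply Rinv_le_contravar; nra.
Qed.

Lemma csc2_partial_fractions z d : qexp z <> 1 -> far d z ->
  Csmb (fun j => / ((z + cn j) * (z + cn j)) + / ((z - cn j) * (z - cn j))) /\
  csc2 z = / (z * z) + Cser (fun j => / ((z + cn j) * (z + cn j)) + / ((z - cn j) * (z - cn j))).
Proof.
  intros Hz Hfar.
  apply (partial_fractions csc2 (fun z => / (z * z)) (/ 4) csc2_add_nat csc2_double csc2_lim
    csc2_half z d (12 * (PI * PI) / (d * d) + 12 * (PI * PI) / (d * d)) Hz Hfar).
  destruct (Re_small_eventually z) as [N HN]. exists N; intros k Hk j Hj.
  destruct (HN k Hk j ltac:(lia)) as [R1 R2].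
  destruct (far_neq0 d z j Hfar ltac:(lia)) as [Z1 Z2].
  destruct (qexp_shift_neq1 z j (S k) Hz) as [Q1 Q2].
  destruct Hfar as [Hd Hf]. destruct (Hf j ltac:(lia)) as [D1 D2].
  rewrite Cmult_plus_distr_l. eapply Rle_trans; [apply Cmod_triangle|].
  rewrite Rmult_plus_distr_r.
  apply Rplus_le_compat; apply csc2_term_bound; try assumption; lia.
Qed.

Lemma pcot_pair a b : qexp a <> 1 -> qexp b <> 1 ->
  pcot a + pcot b = 2 * RtoC PI * Ci * ((qexp (a + b) - 1) / ((1 - qexp a) * (1 - qexp b))).
Proof.
  intros Ha Hb. unfold pcot. rewrite qexp_plus.
  assert (qexp a - 1 <> 0) by (apply Cminus_eq_contra; exact Ha).
  assert (qexp b - 1 <> 0) by (apply Cminus_eq_contra; exact Hb).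
  assert (1 - qexp a <> 0) by (apply Cminus_eq_contra; auto).
  assert (1 - qexp b <> 0) by (apply Cminus_eq_contra; auto).
  field. repeat split; assumption.
Qed.

Lemma pcot_pair_bound (a b : C) K : qexp a <> 1 -> qexp b <> 1 -> a <> 0 -> b <> 0 ->
  (Rabs (Re a) <= 3 / 4)%R -> (Rabs (Re b) <= 3 / 4)%R ->
  (Cmod (qexp (a + b) - 1) <= K)%R -> (1 / 4 <= Cmod (qexp (a + b)))%R ->
  (Cmod (pcot a + pcot b) <= 12 * PI * K * / (Cmod a * Cmod b))%R.
Proof.
  intros Ha Hb Ha0 Hb0 Ra Rb HK Hq.
  assert (Pa : (0 < Cmod a)%R) by (apply Cmod_gt_0; exact Ha0).
  assert (Pb : (0 < Cmod b)%R) by (apply Cmod_gt_0; exact Hb0).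
  assert (Na : 1 - qexp a <> 0) by (apply Cminus_eq_contra; auto).
  assert (Nb : 1 - qexp b <> 0) by (apply Cminus_eq_contra; auto).
  assert (Qa : (0 < Cmod (1 - qexp a))%R) by (apply Cmod_gt_0; exact Na).
  assert (Qb : (0 < Cmod (1 - qexp b))%R) by (apply Cmod_gt_0; exact Nb).
  pose proof (qexp_sub1_lower a Ra) as La. pose proof (qexp_sub1_lower b Rb) as Lb.
  rewrite pcot_pair by assumption. pose proof PI_RGT_0.
  rewrite !Cmod_mult, Cmod_div, Cmod_mult, Cmod_Ci, !Cmod_R, !Rabs_pos_eq
    by (try lra; apply Cmult_neq_0; assumption).
  rewrite qexp_plus, Cmod_mult in Hq.
  set (x := Cmod a) in *. set (y := Cmod b) in *.
  set (u := Cmod (1 - qexp a)) in *. set (v := Cmod (1 - qexp b)) in *.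
  pose proof (Cmod_ge_0 (qexp a)) as Ga. pose proof (Cmod_ge_0 (qexp b)) as Gb.
  set (p := Cmod (qexp a)) in *. set (r := Cmod (qexp b)) in *.
  pose proof (Cmod_ge_0 (qexp (a + b) - 1)). set (D := Cmod (qexp (a + b) - 1)) in *.
  assert (Hxy : (x * y <= 6 * (u * v))%R).
  { assert (H1 : (p * (x * x) * (r * (y * y)) <= 3 * (u * u) * (3 * (v * v)))%R).
    { apply Rmult_le_compat; try assumption; apply Rmult_le_pos; nra. }
    assert (H2 : (1 / 4 * (x * y * (x * y)) <= p * r * (x * y * (x * y)))%R).
    { apply Rmult_le_compat_r; [apply Rle_0_sqr|exact Hq]. }
    assert (0 < x * y)%R by nra. assert (0 < u * v)%R by nra.
    apply Rsqr_incr_0; [|lra|lra]. unfold Rsqr.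
    replace (p * (x * x) * (r * (y * y)))%R with (p * r * (x * y * (x * y)))%R in H1 by ring.
    replace (3 * (u * u) * (3 * (v * v)))%R with (9 * (u * v * (u * v)))%R in H1 by ring.
    lra. }
  assert (0 < x * y)%R by nra. assert (0 < u * v)%R by nra.
  apply (Rmult_le_reg_r (x * y * (u * v))); [nra|].
  replace (2 * PI * 1 * (D / (u * v)) * (x * y * (u * v)))%R with (2 * PI * (D * (x * y)))%R
    by (field; lra).
  replace (12 * PI * K * / (x * y) * (x * y * (u * v)))%R with (2 * PI * (K * (6 * (u * v))))%R
    by (field; lra).
  apply Rmult_le_compat_l; [lra|]. apply Rmult_le_compat; lra.
Qed.

Lemma pcot_partial_fractions z d : qexp z <> 1 -> far d z ->
  Csmb (fun j => / (z + cn j) + / (z - cn j)) /\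
  pcot z = / z + Cser (fun j => / (z + cn j) + / (z - cn j)).
Proof.
  intros Hz Hfar.
  set (B := (Cmod (2 * RtoC PI * Ci * z) + 1)%R).
  apply (partial_fractions pcot (fun z => / z) (/ 2) pcot_add_nat pcot_double pcot_lim
    pcot_half z d (24 * PI * B / (d * d)) Hz Hfar).
  destruct (Re_small_eventually z) as [N HN].
  pose proof (Ccv_Cmod _ _ (qexp_derivative z)) as L1. apply is_lim_seq_spec in L1.
  destruct (L1 (mkposreal 1 Rlt_0_1)) as [N1 HN1]. simpl in HN1.
  pose proof (Ccv_Cmod _ _ (qexp_lim1 z)) as L2. rewrite Cmod_1 in L2. apply is_lim_seq_spec in L2.
  destruct (L2 (mkposreal (1 / 2) ltac:(lra))) as [N2 HN2]. simpl in HN2.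
  exists (N + N1 + N2)%nat; intros k Hk j Hj.
  destruct (HN k ltac:(lia) j ltac:(lia)) as [R1 R2].
  specialize (HN1 k ltac:(lia)). specialize (HN2 k ltac:(lia)).
  destruct (far_neq0 d z j Hfar ltac:(lia)) as [Z1 Z2].
  destruct (qexp_shift_neq1 z j (S k) Hz) as [Q1 Q2].
  destruct Hfar as [Hd Hf]. destruct (Hf j ltac:(lia)) as [D1 D2].
  assert (Hj0 : (0 < INR j)%R) by (apply lt_0_INR; lia).
  assert (P : (0 < 2 ^ k)%R) by (apply pow_lt; lra).
  assert (PS : (0 < 2 ^ S k)%R) by (apply pow_lt; lra).
  pose proof PI_RGT_0. assert (0 < d * INR j)%R by nra.
  assert (HB : (0 < B)%R) by (unfold B; pose proof (Cmod_ge_0 (2 * RtoC PI * Ci * z)); lra).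
  set (u := (z + cn j) / pow2 (S k)) in *. set (v := (z - cn j) / pow2 (S k)) in *.
  assert (Euv : u + v = z / pow2 k) by (unfold u, v; rewrite pow2_S; field; apply pow2_neq0).
  assert (Eu : Cmod u = (Cmod (z + cn j) * / 2 ^ S k)%R) by apply Cmod_div_pow2.
  assert (Ev : Cmod v = (Cmod (z - cn j) * / 2 ^ S k)%R) by apply Cmod_div_pow2.
  assert (Pi : (0 < / 2 ^ S k)%R) by (apply Rinv_0_lt_compat; exact PS).
  assert (HK : (Cmod (qexp (u + v) - 1) <= B * / 2 ^ k)%R).
  { rewrite Euv. apply (Rmult_le_reg_l (2 ^ k)); [exact P|].
    replace (2 ^ k * (B * / 2 ^ k))%R with B by (field; lra).
    rewrite <- Cmod_pow2, <- Cmod_mult. apply Rabs_def2 in HN1. unfold B. lra. }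
  assert (Hb : (Cmod (pcot u + pcot v) <= 12 * PI * (B * / 2 ^ k) * / (Cmod u * Cmod v))%R).
  { apply pcot_pair_bound; try assumption.
    - apply Cmod_gt_0. rewrite Eu. apply Rmult_lt_0_compat; [lra|exact Pi].
    - apply Cmod_gt_0. rewrite Ev. apply Rmult_lt_0_compat; [lra|exact Pi].
    - rewrite Euv. apply Rabs_def2 in HN2. lra. }
  rewrite inv2_pow, Cmod_mult, Cmod_inv, Cmod_pow2 by apply pow2_neq0.
  apply (Rle_trans _ (/ 2 ^ S k * (12 * PI * (B * / 2 ^ k) * / (Cmod u * Cmod v)))%R).
  { apply Rmult_le_compat_l; lra. }
  rewrite Eu, Ev.
  replace (/ 2 ^ S k * (12 * PI * (B * / 2 ^ k) *
    / (Cmod (z + cn j) * / 2 ^ S k * (Cmod (z - cn j) * / 2 ^ S k))))%R with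
    (24 * PI * B * / (Cmod (z + cn j) * Cmod (z - cn j)))%R.
  2:{ simpl pow. field. repeat split; lra. }
  replace (24 * PI * B / (d * d) * / (INR j * INR j))%R with
    (24 * PI * B * / (d * INR j * (d * INR j)))%R by (field; lra).
  apply Rmult_le_compat_l; [nra|]. apply Rinv_le_contravar; nra.
Qed.

(** * Evaluation of power series *)

Lemma nat_geom_bound t : (0 <= t < 1)%R ->
  exists K, (0 < K)%R /\ forall n, (INR (S n) * t ^ n <= K * ((1 + t) / 2) ^ n)%R.
Proof.
  intros [[Ht|<-] Ht1].
  - set (u := ((1 + t) / 2)%R). set (h := (u / t - 1)%R).
    assert (Hh : (0 < h)%R).
    { unfold h, u. apply Rlt_0_minus. apply (Rmult_lt_reg_r t); [exact Ht|].
      unfold Rdiv at 1. rewrite Rmult_assoc, Rinv_l by lra. lra. }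
    exists (1 + / h)%R. assert (Pi : (0 < / h)%R) by (apply Rinv_0_lt_compat; exact Hh).
    split; [lra|]. intros n.
    assert (Eu : u = (t * (1 + h))%R) by (unfold h; field; lra).
    rewrite Eu, Rpow_mult_distr.
    assert (Hb : (1 + INR n * h <= (1 + h) ^ n)%R) by (apply poly; exact Hh).
    assert (Htn : (0 <= t ^ n)%R) by (apply pow_le; lra).
    rewrite S_INR. pose proof (pos_INR n).
    assert (INR n + 1 <= (1 + / h) * (1 + h) ^ n)%R; [|nra].
    apply (Rle_trans _ ((1 + / h) * (1 + INR n * h))%R); [|apply Rmult_le_compat_l; lra].
    replace ((1 + / h) * (1 + INR n * h))%R with (1 + INR n + (INR n * h + / h))%R by (field; lra).
    nra.
  - exists 1%R. split; [lra|]. intros [|n]; [simpl; lra|].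
    rewrite pow_i by lia. rewrite Rmult_0_r, Rmult_1_l. apply pow_le; lra.
Qed.

Definition coef_bound (s A : R) (a : fps) : Prop := forall n, (Cmod (a n) * s ^ n <= A)%R.

(* Radius of convergence at least [1]. *)
Definition good (a : fps) : Prop := forall s, (0 < s < 1)%R -> exists A, coef_bound s A a.

Lemma coef_bound_nonneg s A a : coef_bound s A a -> (0 <= A)%R.
Proof.
  intros H. specialize (H 0%nat). pose proof (Cmod_ge_0 (a 0%nat)). simpl in H. lra.
Qed.

Lemma coef_bound_mul s A B a b : (0 < s)%R -> coef_bound s A a -> coef_bound s B b ->
  forall n, (Cmod ((a * b)%fps n) * s ^ n <= INR (S n) * (A * B))%R.
Proof.
  intros Hs Ha Hb n; revert A a Ha; induction n as [|n IH]; intros A a Ha.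
  - rewrite coef_mul0, Cmod_mult. simpl. specialize (Ha 0%nat). specialize (Hb 0%nat).
    simpl in Ha, Hb. pose proof (Cmod_ge_0 (a 0%nat)). pose proof (Cmod_ge_0 (b 0%nat)).
    assert (Cmod (a 0%nat) * Cmod (b 0%nat) <= A * B)%R by (apply Rmult_le_compat; lra). lra.
  - pose proof (coef_bound_nonneg _ _ _ Ha). pose proof (coef_bound_nonneg _ _ _ Hb).
    assert (Hsh : coef_bound s (A / s) (shift a)).
    { intros k. specialize (Ha (S k)). unfold shift. simpl in Ha.
      apply (Rmult_le_reg_r s); [exact Hs|]. unfold Rdiv. rewrite (Rmult_assoc A), Rinv_l by lra. lra. }
    specialize (IH _ _ Hsh). rewrite coef_mulS.
    assert (Hsn : (0 < s ^ S n)%R) by (apply pow_lt; exact Hs).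
    apply (Rle_trans _ (Cmod (a 0%nat) * (Cmod (b (S n)) * s ^ S n)
      + s * (Cmod ((shift a * b)%fps n) * s ^ n))%R).
    + replace (Cmod (a 0%nat) * (Cmod (b (S n)) * s ^ S n) + s * (Cmod ((shift a * b)%fps n) * s ^ n))%R
        with ((Cmod (a 0%nat * b (S n)) + Cmod ((shift a * b)%fps n)) * s ^ S n)%R
        by (rewrite Cmod_mult; simpl; ring).
      apply Rmult_le_compat_r; [lra|apply Cmod_triangle].
    + specialize (Ha 0%nat). simpl in Ha. specialize (Hb (S n)).
      assert (Cmod (a 0%nat) * (Cmod (b (S n)) * s ^ S n) <= A * B)%R.
      { apply Rmult_le_compat; try lra; [apply Cmod_ge_0|].
        apply Rmult_le_pos; [apply Cmod_ge_0|lra]. }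
      assert (s * (Cmod ((shift a * b)%fps n) * s ^ n) <= INR (S n) * (A * B))%R.
      { replace (INR (S n) * (A * B))%R with (s * (INR (S n) * (A / s * B)))%R by (field; lra).
        apply Rmult_le_compat_l; lra. }
      rewrite (S_INR (S n)). lra.
Qed.

Lemma ratio_bounds s s' : (0 < s < s')%R -> (0 < s / s' < 1)%R.
Proof.
  intros H. split.
  - apply Rmult_lt_0_compat; [lra|apply Rinv_0_lt_compat; lra].
  - apply (Rmult_lt_reg_r s'); [lra|]. unfold Rdiv. rewrite Rmult_assoc, Rinv_l by lra. lra.
Qed.

Lemma pow_le_1_compat u n : (0 <= u <= 1)%R -> (u ^ n <= 1)%R.
Proof. intros H. rewrite <- (pow1 n). apply pow_incr; lra. Qed.

Lemma good_linear_bound (a : fps) :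
  (forall s, (0 < s < 1)%R -> exists K, forall n, (Cmod (a n) * s ^ n <= INR (S n) * K)%R) -> good a.
Proof.
  intros H s Hs. set (s' := ((1 + s) / 2)%R).
  destruct (H s' ltac:(unfold s'; lra)) as [K HK].
  pose proof (ratio_bounds s s' ltac:(unfold s'; lra)) as Ht.
  destruct (nat_geom_bound (s / s') ltac:(lra)) as (M & HM & HMn).
  exists (Rabs K * M)%R. intros n.
  assert (Ps : (0 < s' ^ n)%R) by (apply pow_lt; unfold s'; lra).
  assert (Pt : (0 < (s / s') ^ n)%R) by (apply pow_lt; lra).
  assert (E : (s ^ n = s' ^ n * (s / s') ^ n)%R).
  { rewrite <- Rpow_mult_distr. f_equal. field. unfold s'; lra. }
  rewrite E, <- Rmult_assoc.
  apply (Rle_trans _ (INR (S n) * Rabs K * (s / s') ^ n)%R).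
  - apply Rmult_le_compat_r; [lra|]. eapply Rle_trans; [apply HK|].
    apply Rmult_le_compat_l; [apply pos_INR|apply Rle_abs].
  - replace (INR (S n) * Rabs K * (s / s') ^ n)%R with (Rabs K * (INR (S n) * (s / s') ^ n))%R by ring.
    apply Rmult_le_compat_l; [apply Rabs_pos|]. eapply Rle_trans; [apply HMn|].
    rewrite <- (Rmult_1_r M) at 2. apply Rmult_le_compat_l; [lra|].
    apply pow_le_1_compat; lra.
Qed.

Lemma good_mul a b : good a -> good b -> good (a * b)%fps.
Proof.
  intros Ha Hb. apply good_linear_bound; intros s Hs.
  destruct (Ha s Hs) as [A HA], (Hb s Hs) as [B HB].
  exists (A * B)%R. apply coef_bound_mul; [lra|exact HA|exact HB].
Qed.

Lemma good_add a b : good a -> good b -> good (a + b)%fps.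
Proof.
  intros Ha Hb s Hs. destruct (Ha s Hs) as [A HA], (Hb s Hs) as [B HB].
  exists (A + B)%R; intros n. specialize (HA n). specialize (HB n). rewrite coef_add.
  assert (0 <= s ^ n)%R by (apply pow_le; lra).
  pose proof (Cmod_triangle (a n) (b n)). nra.
Qed.

Lemma good_le (a b : fps) : (forall n, (Cmod (a n) <= Cmod (b n))%R) -> good b -> good a.
Proof.
  intros H Hb s Hs. destruct (Hb s Hs) as [B HB]. exists B; intros n.
  eapply Rle_trans; [|apply HB]. apply Rmult_le_compat_r; [apply pow_le; lra|apply H].
Qed.

Lemma good_cst c : good (fcst c).
Proof.
  intros s Hs. exists (Cmod c). intros [|n]; simpl; [lra|].
  rewrite Cmod_0, Rmult_0_l. apply Cmod_ge_0.
Qed.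

Lemma good_Z z : good (fZ z).
Proof. apply good_cst. Qed.

Lemma good_sub a b : good a -> good b -> good (a - b)%fps.
Proof.
  intros Ha Hb. replace (a - b)%fps with (a + fZ (-1) * b)%fps by ring.
  apply good_add; [exact Ha|]. apply good_mul; [apply good_cst|exact Hb].
Qed.

Lemma good_pow a n : good a -> good (a ^ n)%fps.
Proof.
  intros Ha; induction n as [|n IH]; [apply good_cst|apply good_mul; assumption].
Qed.

Lemma good_fX : good fX.
Proof.
  intros s Hs. exists 1%R. intros [|[|n]]; simpl; rewrite ?Cmod_0, ?Cmod_1; lra.
Qed.

Lemma good_shift a : good a -> good (shift a).
Proof.
  intros Ha s Hs. destruct (Ha s Hs) as [A HA]. exists (A / s)%R; intros n.
  specialize (HA (S n)). unfold shift. simpl in HA. apply (Rmult_le_reg_r s); [lra|].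
  unfold Rdiv. rewrite (Rmult_assoc A), Rinv_l by lra. lra.
Qed.

Lemma good_nat_mul a : good a -> good (fun n => cn (S n) * a n).
Proof.
  intros Ha. apply good_linear_bound; intros s Hs. destruct (Ha s Hs) as [A HA].
  exists A; intros n. unfold cn. rewrite Cmod_mult, Cmod_R, Rabs_pos_eq, Rmult_assoc by apply pos_INR.
  apply Rmult_le_compat_l; [apply pos_INR|apply HA].
Qed.

Lemma good_nat_pow k : good (fun n => cn (S n) ^ k).
Proof.
  induction k as [|k IH]; [|apply (good_nat_mul _ IH)].
  intros s Hs. exists 1%R; intros n. simpl. rewrite Cmod_1, Rmult_1_l. apply pow_le_1_compat; lra.
Qed.

Lemma list_sum_pow_le k n (l : list nat) :
  (forall d, In d l -> (d <= n)%nat) ->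
  (list_sum (map (fun d => Nat.pow d k) l) <= length l * Nat.pow n k)%nat.
Proof.
  induction l as [|d l IH]; intros H; [simpl; lia|].
  simpl. assert (Nat.pow d k <= Nat.pow n k)%nat by (apply Nat.pow_le_mono_l, H; left; reflexivity).
  specialize (IH ltac:(intros; apply H; right; assumption)). unfold list_sum in *. lia.
Qed.

Lemma sigma_le k n : (Defs.sigma k n <= Nat.pow (S n) (S k))%nat.
Proof.
  unfold Defs.sigma. eapply Nat.le_trans.
  - apply (list_sum_pow_le k n). intros d Hd. apply filter_In in Hd. destruct Hd as [Hd _].
    apply in_seq in Hd. lia.
  - pose proof (filter_length_le (fun d => Nat.eqb (Nat.modulo n d) 0) (seq 1 n)) as H.
    rewrite length_seq in H. rewrite Nat.pow_succ_r'.
    apply Nat.mul_le_mono; [lia|]. apply Nat.pow_le_mono_l; lia.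
Qed.

Lemma good_Sig k : good (Sig k).
Proof.
  apply (good_le _ _) with (2 := good_nat_pow (S k)). intros n.
  unfold Sig, cn. rewrite Cmod_R, Cmod_pow, Cmod_R, !Rabs_pos_eq by apply pos_INR.
  rewrite <- pow_INR. apply le_INR, sigma_le.
Qed.

Lemma rsum_geom s n : (0 < s < 1)%R -> (rsum (fun i => s ^ i) n <= / (1 - s))%R.
Proof.
  intros Hs. assert (E : (rsum (fun i => s ^ i) n * (1 - s) = s - s ^ S n)%R).
  { induction n as [|n IH]; [simpl; ring|]. cbn [rsum]. rewrite Rmult_plus_distr_r, IH. simpl; ring. }
  assert (0 < s ^ S n)%R by (apply pow_lt; lra).
  apply (Rmult_le_reg_r (1 - s)); [lra|]. rewrite E, Rinv_l by lra. lra.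
Qed.

Lemma feuler_trunc_bound s n : (0 < s < 1)%R -> coef_bound s (exp (rsum (fun i => s ^ i) n))%R (feuler_trunc n).
Proof.
  intros Hs. induction n as [|n IH]; intros k.
  - cbn [feuler_trunc rsum]. rewrite exp_0. destruct k; simpl; rewrite ?Cmod_0, ?Cmod_1; lra.
  - cbn [feuler_trunc rsum].
    replace (feuler_trunc n * (fZ 1 - fX ^ S n))%fps with
      (feuler_trunc n - fX ^ S n * feuler_trunc n)%fps by ring.
    rewrite coef_sub, fXpow_mul_coef, exp_plus.
    set (B := exp (rsum (fun i => s ^ i) n)%R) in *.
    assert (Hsn : (0 < s ^ S n)%R) by (apply pow_lt; lra).
    assert (Hsk : (0 < s ^ k)%R) by (apply pow_lt; lra).
    assert (HB : (0 < B)%R) by apply exp_pos.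
    assert (He : (1 + s ^ S n <= exp (s ^ S n))%R) by (left; apply exp_ineq1; lra).
    apply (Rle_trans _ (B * (1 + s ^ S n))%R); [|apply Rmult_le_compat_l; lra].
    pose proof (IH k) as Hk.
    destruct (Nat.ltb_spec k (S n)) as [H|H].
    + replace (feuler_trunc n k - 0) with (feuler_trunc n k) by ring. nra.
    + pose proof (IH (k - S n)%nat) as Hk'.
      assert (E : (s ^ k = s ^ (k - S n) * s ^ S n)%R) by (rewrite <- pow_add; f_equal; lia).
      pose proof (Cmod_triangle (feuler_trunc n k) (- feuler_trunc n (k - S n)%nat)) as T.
      rewrite Cmod_opp in T.
      apply (Rle_trans _ ((Cmod (feuler_trunc n k) + Cmod (feuler_trunc n (k - S n)%nat)) * s ^ k)%R).
      * apply Rmult_le_compat_r; [lra|exact T].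
      * rewrite Rmult_plus_distr_r, Rmult_plus_distr_l. apply Rplus_le_compat; [lra|].
        rewrite E, <- Rmult_assoc. apply Rmult_le_compat_r; lra.
Qed.

Lemma feuler_trunc_uniform s n : (0 < s < 1)%R -> coef_bound s (exp (/ (1 - s)))%R (feuler_trunc n).
Proof.
  intros Hs k. eapply Rle_trans; [apply feuler_trunc_bound; exact Hs|].
  destruct (Rle_lt_or_eq_dec _ _ (rsum_geom s n Hs)) as [H|H].
  - left; apply exp_increasing; exact H.
  - right; f_equal; exact H.
Qed.

Lemma good_feuler_trunc n : good (feuler_trunc n).
Proof. intros s Hs; eexists; apply (feuler_trunc_uniform s n Hs). Qed.

Lemma good_feuler : good feuler.
Proof.
  intros s Hs; exists (exp (/ (1 - s)))%R; intros k. apply (feuler_trunc_uniform s k Hs k).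
Qed.

Lemma good_fV m a : (0 < m)%nat -> good a -> good (fV m a).
Proof.
  intros Hm Ha s Hs. destruct (Ha s Hs) as [A HA]. exists A; intros n. unfold fV.
  pose proof (coef_bound_nonneg _ _ _ HA).
  destruct (Nat.eqb_spec (n mod m) 0) as [E|E]; [|rewrite Cmod_0; lra].
  eapply Rle_trans; [|apply (HA (n / m)%nat)]. apply Rmult_le_compat_l; [apply Cmod_ge_0|].
  pose proof (Nat.div_mod_eq n m) as D. rewrite E, Nat.add_0_r in D.
  assert (n / m <= n)%nat by (apply Nat.Div0.div_le_upper_bound; nia).
  replace n with (n / m + (n - n / m))%nat at 1 by lia. rewrite pow_add.
  rewrite <- (Rmult_1_r (s ^ (n / m))) at 2. apply Rmult_le_compat_l; [apply pow_le; lra|].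
  apply pow_le_1_compat; lra.
Qed.

Lemma good_ftw z a : (Cmod z <= 1)%R -> good a -> good (ftw z a).
Proof.
  intros Hz. apply good_le. intros n. unfold ftw. rewrite Cmod_mult, Cmod_pow.
  rewrite <- (Rmult_1_l (Cmod (a n))) at 2. apply Rmult_le_compat_r; [apply Cmod_ge_0|].
  apply pow_le_1_compat. split; [apply Cmod_ge_0|exact Hz].
Qed.

Lemma good_fE2 : good fE2.
Proof. apply good_sub; [apply good_cst|apply good_mul; [apply good_cst|apply good_Sig]]. Qed.
Lemma good_fE4 : good fE4.
Proof. apply good_add; [apply good_cst|apply good_mul; [apply good_cst|apply good_Sig]]. Qed.
Lemma good_fE6 : good fE6.
Proof. apply good_sub; [apply good_cst|apply good_mul; [apply good_cst|apply good_Sig]]. Qed.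

Definition ev (x : C) (a : fps) : C := a 0%nat + Cser (fun n => a n * x ^ n).

Lemma coef_bound_geom s A a (x : C) n : (0 < s)%R -> coef_bound s A a ->
  (Cmod (a n * x ^ n) <= A * (Cmod x / s) ^ n)%R.
Proof.
  intros Hs H. rewrite Cmod_mult, Cmod_pow.
  replace (Cmod x) with (s * (Cmod x / s))%R at 1 by (field; lra).
  rewrite Rpow_mult_distr, <- Rmult_assoc. apply Rmult_le_compat_r; [|apply H].
  apply pow_le. apply Rmult_le_pos; [apply Cmod_ge_0|left; apply Rinv_0_lt_compat; exact Hs].
Qed.

Lemma div_lt_1 x s : (0 <= x < s)%R -> (0 <= x / s < 1)%R.
Proof.
  intros H. split.
  - apply Rmult_le_pos; [lra|left; apply Rinv_0_lt_compat; lra].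
  - apply (Rmult_lt_reg_r s); [lra|]. unfold Rdiv. rewrite Rmult_assoc, Rinv_l by lra. lra.
Qed.

Lemma ex_series_geom_S K u : (0 <= u < 1)%R -> ex_series (fun n => K * u ^ S n)%R.
Proof.
  intros H. apply (ex_series_scal_l (K := R_AbsRing) K (fun n => u ^ S n)%R).
  apply (ex_series_incr_1 (K := R_AbsRing) (V := R_NormedModule) (fun n => u ^ n)%R).
  apply ex_series_geom. rewrite Rabs_pos_eq; lra.
Qed.

Lemma ev_summable x a : (Cmod x < 1)%R -> good a -> Csmb (fun n => a n * x ^ n).
Proof.
  intros Hx Ha. pose proof (Cmod_ge_0 x). set (s := ((1 + Cmod x) / 2)%R).
  destruct (Ha s ltac:(unfold s; lra)) as [A HA].
  apply (Csmb_le _ (fun n => A * (Cmod x / s) ^ n)%R).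
  - intros n _. apply coef_bound_geom; [unfold s; lra|exact HA].
  - apply ex_series_geom_S, div_lt_1. unfold s; lra.
Qed.

Lemma ev_add x a b : (Cmod x < 1)%R -> good a -> good b -> ev x (a + b)%fps = ev x a + ev x b.
Proof.
  intros Hx Ha Hb. unfold ev. rewrite coef_add.
  rewrite (Cser_ext _ (fun n => a n * x ^ n + b n * x ^ n)).
  - rewrite Cser_plus by (apply ev_summable; assumption). ring.
  - intros n _. rewrite coef_add. ring.
Qed.

Lemma ev_scal x c a : (Cmod x < 1)%R -> good a -> ev x (fcst c * a)%fps = c * ev x a.
Proof.
  intros Hx Ha. unfold ev. rewrite fmul_scal_coef.
  rewrite (Cser_ext _ (fun n => c * (a n * x ^ n))).
  - rewrite Cser_scal by (apply ev_summable; assumption). ring.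
  - intros n _. rewrite fmul_scal_coef. ring.
Qed.

Lemma ev_sub x a b : (Cmod x < 1)%R -> good a -> good b -> ev x (a - b)%fps = ev x a - ev x b.
Proof.
  intros Hx Ha Hb. replace (a - b)%fps with (a + fZ (-1) * b)%fps by ring. unfold fZ.
  rewrite ev_add, ev_scal by (auto using good_mul, good_cst). ring.
Qed.

Lemma ev_cst x c : ev x (fcst c) = c.
Proof.
  unfold ev. destruct (Cser_finite (fun n => fcst c n * x ^ n) 0) as [_ E].
  - intros [|n] Hn; [lia|]. simpl. ring.
  - rewrite E. simpl. ring.
Qed.

Lemma Cser_first (a : nat -> C) : Csmb a -> Cser a = a 1%nat + Cser (fun n => a (S n)).
Proof.
  intros H.
  assert (H' : Csmb (fun n => a (S n))).
  { apply (ex_series_incr_1 (K := R_AbsRing) (V := R_NormedModule) (fun n => Cmod (a (S n)))). exact H. }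
  apply Cser_eq; [exact H|].
  apply (is_lim_seq_incr_1 (fun n => Cmod (csum a n - (a 1%nat + Cser (fun n => a (S n)))))).
  apply (Ccv_ext (fun n => a 1%nat + csum (fun n => a (S n)) n)).
  - intros n. rewrite (csum_split a 1 n : csum a (S n) = _). simpl. ring.
  - apply Ccv_plus; [apply Ccv_const|apply Cser_cv; exact H'].
Qed.

Lemma ev_shift x a : (Cmod x < 1)%R -> good a -> ev x a = a 0%nat + x * ev x (shift a).
Proof.
  intros Hx Ha. unfold ev. rewrite Cser_first by (apply ev_summable; assumption).
  rewrite (Cser_ext (fun n => a (S n) * x ^ S n) (fun n => x * (shift a n * x ^ n))).
  - rewrite Cser_scal by (apply ev_summable; [exact Hx|apply good_shift; exact Ha]).
    unfold shift. simpl. ring.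
  - intros n _. unfold shift. simpl. ring.
Qed.

Lemma ev_mul_step x a b : (Cmod x < 1)%R -> good a -> good b ->
  ev x (a * b)%fps = a 0%nat * ev x b + x * ev x (shift a * b)%fps.
Proof.
  intros Hx Ha Hb. pose proof (good_shift a Ha).
  rewrite (ev_shift x (a * b)), (ev_shift x b), shift_mul by auto using good_mul.
  rewrite ev_add, ev_scal by auto using good_mul, good_cst, good_shift.
  rewrite coef_mul0. ring.
Qed.

Lemma ev_norm_bound x s K (c : fps) u M :
  (0 < s)%R -> (0 <= K)%R -> (0 <= u < 1)%R -> (0 <= M)%R ->
  (forall n, (Cmod (c n) * s ^ n <= INR (S n) * K)%R) ->
  (forall n, (INR (S n) * (Cmod x / s) ^ n <= M * u ^ n)%R) ->
  (Cmod (ev x c) <= K * (1 + M * / (1 - u)))%R.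
Proof.
  intros Hs HK Hu HM Hc HMn.
  assert (Hb : forall n, (Cmod (c n * x ^ n) <= K * M * u ^ n)%R).
  { intros n. rewrite Cmod_mult, Cmod_pow.
    replace (Cmod x) with (s * (Cmod x / s))%R at 1 by (field; lra).
    rewrite Rpow_mult_distr, <- Rmult_assoc.
    assert (0 <= (Cmod x / s) ^ n)%R.
    { apply pow_le, Rmult_le_pos; [apply Cmod_ge_0|left; apply Rinv_0_lt_compat; exact Hs]. }
    apply (Rle_trans _ (INR (S n) * K * (Cmod x / s) ^ n)%R).
    - apply Rmult_le_compat_r; [assumption|apply Hc].
    - specialize (HMn n). nra. }
  assert (Hsum : Csmb (fun n => c n * x ^ n)).
  { apply (Csmb_le _ (fun n => K * M * u ^ n)%R); [intros n _; apply Hb|].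
    apply ex_series_geom_S; exact Hu. }
  unfold ev. eapply Rle_trans; [apply Cmod_triangle|].
  assert (H0 : (Cmod (c 0%nat) <= K)%R) by (specialize (Hc 0%nat); simpl in Hc; lra).
  assert (Hi : (0 < / (1 - u))%R) by (apply Rinv_0_lt_compat; lra).
  assert (H1 : (Cmod (Cser (fun n => c n * x ^ n)%C) <= K * M * / (1 - u))%R).
  { apply (Ccv_le _ _ _ (Cser_cv _ Hsum)). intros n.
    replace (csum (fun n => c n * x ^ n) n) with
      (csum (fun n => c n * x ^ n) n - csum (fun n => c n * x ^ n) 0) by (simpl; ring).
    eapply Rle_trans; [apply (Cmod_csum_sub _ (fun n => K * M * u ^ n)%R); [lia|intros; apply Hb]|].
    simpl rsum at 2. rewrite Rminus_0_r.
    assert (E : (rsum (fun i => K * M * u ^ i) n * (1 - u) = K * M * (u - u ^ S n))%R).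
    { induction n as [|n IH]; [simpl; ring|]. cbn [rsum]. rewrite Rmult_plus_distr_r, IH. simpl; ring. }
    apply (Rmult_le_reg_r (1 - u)); [lra|]. rewrite E.
    replace (K * M * / (1 - u) * (1 - u))%R with (K * M * 1)%R by (field; lra).
    apply Rmult_le_compat_l; [nra|]. assert (0 <= u ^ S n)%R by (apply pow_le; lra). lra. }
  lra.
Qed.

Definition shiftn (N : nat) (a : fps) : fps := fun n => a (N + n)%nat.

Lemma good_shiftn N a : good a -> good (shiftn N a).
Proof.
  intros Ha; induction N as [|N IH]; [exact Ha|].
  replace (shiftn (S N) a) with (shift (shiftn N a)); [apply good_shift; exact IH|].
  apply fps_ext; intros n. unfold shift, shiftn. f_equal; lia.
Qed.

Lemma ev_mul_partial x a b N : (Cmod x < 1)%R -> good a -> good b ->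
  ev x (a * b)%fps = (a 0%nat + csum (fun n => a n * x ^ n) N) * ev x b
    + x ^ S N * ev x (shiftn (S N) a * b)%fps.
Proof.
  intros Hx Ha Hb. induction N as [|N IH].
  - rewrite (ev_mul_step x a b) by assumption. simpl. change (shiftn 1 a) with (shift a). ring.
  - rewrite IH, (ev_mul_step x (shiftn (S N) a) b) by auto using good_shiftn.
    replace (shift (shiftn (S N) a)) with (shiftn (S (S N)) a).
    + unfold shiftn at 1. rewrite Nat.add_0_r. simpl. ring.
    + apply fps_ext; intros n. unfold shift, shiftn. f_equal; lia.
Qed.

Lemma ev_mul x a b : (Cmod x < 1)%R -> good a -> good b -> ev x (a * b)%fps = ev x a * ev x b.
Proof.
  intros Hx Ha Hb. pose proof (Cmod_ge_0 x). set (s := ((1 + Cmod x) / 2)%R).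
  assert (Hs : (0 < s < 1)%R) by (unfold s; lra).
  destruct (Ha s Hs) as [A HA], (Hb s Hs) as [B HB].
  pose proof (coef_bound_nonneg _ _ _ HA) as PA. pose proof (coef_bound_nonneg _ _ _ HB) as PB.
  set (t := (Cmod x / s)%R).
  assert (Ht : (0 <= t < 1)%R) by (apply div_lt_1; unfold s; lra).
  destruct (nat_geom_bound t Ht) as (M & HM & HMn). set (u := ((1 + t) / 2)%R) in *.
  set (W := (A * B * (1 + M * / (1 - u)))%R).
  assert (Hrem : Ccv (fun N => x ^ S N * ev x (shiftn (S N) a * b)%fps) 0).
  { apply (Ccv_squeeze _ _ (fun N => t ^ S N * W)%R).
    - intros N. replace (x ^ S N * ev x (shiftn (S N) a * b)%fps - 0) with
        (x ^ S N * ev x (shiftn (S N) a * b)%fps) by ring.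
      rewrite Cmod_mult, Cmod_pow.
      assert (HAN : coef_bound s (A / s ^ S N) (shiftn (S N) a)).
      { intros n. specialize (HA (S N + n)%nat). unfold shiftn. rewrite pow_add in HA.
        assert (P : (0 < s ^ S N)%R) by (apply pow_lt; lra).
        apply (Rmult_le_reg_r (s ^ S N)); [exact P|].
        unfold Rdiv. rewrite (Rmult_assoc A), Rinv_l by lra. lra. }
      pose proof (coef_bound_mul s _ _ _ _ (proj1 Hs) HAN HB) as Hc.
      pose proof (coef_bound_nonneg _ _ _ HAN).
      assert (Hev : (Cmod (ev x (shiftn (S N) a * b)%fps) <=
        A / s ^ S N * B * (1 + M * / (1 - u)))%R).
      { apply (ev_norm_bound x s (A / s ^ S N * B) _ u M); try assumption; try lra.
        - nra.
        - unfold u; lra. }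
      apply (Rle_trans _ (Cmod x ^ S N * (A / s ^ S N * B * (1 + M * / (1 - u))))%R).
      + apply Rmult_le_compat_l; [apply pow_le; lra|exact Hev].
      + right. unfold W, t, Rdiv. rewrite Rpow_mult_distr, pow_inv. ring.
    - replace (Finite 0) with (Finite (0 * W)) by (f_equal; ring).
      apply is_lim_seq_mult'; [|apply is_lim_seq_const].
      apply (is_lim_seq_incr_1 (fun n => t ^ n)%R). apply is_lim_seq_geom.
      rewrite Rabs_pos_eq; lra. }
  apply (Ccv_unique (fun _ => ev x (a * b)%fps)); [apply Ccv_const|].
  apply (Ccv_ext (fun N => (a 0%nat + csum (fun n => a n * x ^ n) N) * ev x b
    + x ^ S N * ev x (shiftn (S N) a * b)%fps)).
  - intros N; symmetry; apply ev_mul_partial; assumption.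
  - replace (ev x a * ev x b) with (ev x a * ev x b + 0) by ring.
    apply Ccv_plus; [|exact Hrem]. apply Ccv_mult; [|apply Ccv_const].
    apply Ccv_plus; [apply Ccv_const|apply Cser_cv, ev_summable; assumption].
Qed.

Lemma ev_pow x a n : (Cmod x < 1)%R -> good a -> ev x (a ^ n)%fps = ev x a ^ n.
Proof.
  intros Hx Ha; induction n as [|n IH]; [apply ev_cst|].
  cbn [fpow]. rewrite ev_mul, IH by auto using good_pow. reflexivity.
Qed.

Lemma ev_fX x : ev x fX = x.
Proof.
  unfold ev. destruct (Cser_finite (fun n => fX n * x ^ n) 1) as [_ E].
  - intros [|[|n]] Hn; try lia. simpl. ring.
  - rewrite E. simpl. ring.
Qed.

Lemma ev_ftw z x a : ev x (ftw z a) = ev (z * x) a.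
Proof.
  unfold ev. f_equal.
  - unfold ftw. simpl. ring.
  - apply Cser_ext; intros n _. unfold ftw. rewrite Cpow_mult_l. ring.
Qed.

Lemma csum_multiples m f n : (0 < m)%nat ->
  csum (fun i => if (i mod m =? 0)%nat then f (i / m)%nat else 0) (m * n) = csum f n.
Proof.
  intros Hm. induction n as [|n IH]; [rewrite Nat.mul_0_r; reflexivity|].
  replace (m * S n)%nat with (m * n + m)%nat by lia. rewrite csum_split, IH.
  simpl. f_equal. destruct m as [|m]; [lia|].
  cbn [csum].
  assert (E0 : forall k, (k <= m)%nat ->
    csum (fun j => if ((S m * n + j) mod S m =? 0)%nat then f ((S m * n + j) / S m)%nat else 0) k = 0).
  { induction k as [|k IHk]; intros Hk; [reflexivity|]. cbn [csum]. rewrite IHk by lia.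
    replace (S m * n + S k)%nat with (S k + n * S m)%nat by lia.
    rewrite Nat.Div0.mod_add, Nat.mod_small by lia. simpl. ring. }
  rewrite E0 by lia.
  replace (S m * n + S m)%nat with (S n * S m)%nat by lia.
  rewrite Nat.Div0.mod_mul, Nat.div_mul by lia. simpl. ring.
Qed.

Lemma Cmod_pow_lt_1 x m : (0 < m)%nat -> (Cmod x < 1)%R -> (Cmod (x ^ m) < 1)%R.
Proof.
  intros Hm Hx. rewrite Cmod_pow. pose proof (Cmod_ge_0 x). apply pow_lt_1_compat; [lra|lia].
Qed.

Lemma ev_fV m x a : (0 < m)%nat -> (Cmod x < 1)%R -> good a -> ev x (fV m a) = ev (x ^ m) a.
Proof.
  intros Hm Hx Ha. unfold ev. rewrite fV_coef0 by assumption. f_equal.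
  pose proof (ev_summable x _ Hx (good_fV m a Hm Ha)) as H1.
  pose proof (ev_summable (x ^ m) a (Cmod_pow_lt_1 x m Hm Hx) Ha) as H2.
  apply Cser_eq; [exact H1|].
  (* the full sequence converges, so its limit can be read off along the multiples of [m] *)
  pose proof (Cser_cv _ H1) as H3.
  assert (H4 : Ccv (fun n => csum (fun n => fV m a n * x ^ n) (m * n)) (Cser (fun n => fV m a n * x ^ n))).
  { apply (Ccv_subseq (csum (fun n => fV m a n * x ^ n)) _ (fun n => (m * n)%nat)); [intros; nia|exact H3]. }
  assert (H5 : Ccv (fun n => csum (fun n => fV m a n * x ^ n) (m * n)) (Cser (fun n => a n * (x ^ m) ^ n))).
  { apply (Ccv_ext (csum (fun n => a n * (x ^ m) ^ n))); [|apply Cser_cv; exact H2].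
    intros n. rewrite <- (csum_multiples m (fun n => a n * (x ^ m) ^ n) n Hm).
    apply csum_ext; intros i _. unfold fV. destruct (Nat.eqb_spec (i mod m) 0) as [E|E]; [|ring].
    rewrite <- Cpow_mult_r. pose proof (Nat.div_mod_eq i m) as D. rewrite E, Nat.add_0_r in D.
    rewrite <- D. reflexivity. }
  rewrite <- (Ccv_unique _ _ _ H4 H5). exact H3.
Qed.

Lemma Csum_n_csum (f : nat -> C) n : sum_n (fun i => f (S i)) n = csum f (S n).
Proof.
  induction n as [|n IH].
  - rewrite sum_O. simpl. ring.
  - rewrite sum_Sn, IH. reflexivity.
Qed.

Lemma Cmod_qexp_lt_1 tau : (0 < Im tau)%R -> (Cmod (qexp tau) < 1)%R.
Proof.
  intros H. rewrite Cmod_qexp, <- exp_0. apply exp_increasing. pose proof PI_RGT_0. nra.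
Qed.

Lemma sigma_series_ev k tau : (0 < Im tau)%R -> sigma_series k tau = ev (qexp tau) (Sig k).
Proof.
  intros H. unfold sigma_series. apply Clim_of_Ccv.
  unfold ev. rewrite Sig_0. rewrite Cplus_0_l.
  apply (Ccv_ext (fun n => csum (fun n => Sig k n * qexp tau ^ n) (S n))).
  - intros n. symmetry. apply (Csum_n_csum (fun n => Sig k n * qexp tau ^ n)).
  - apply (Ccv_subseq (csum _) _ S); [lia|].
    apply Cser_cv, ev_summable; [apply Cmod_qexp_lt_1; exact H|apply good_Sig].
Qed.

Lemma E2_ev tau : (0 < Im tau)%R -> E2 tau = ev (qexp tau) fE2.
Proof.
  intros H. pose proof (Cmod_qexp_lt_1 tau H). pose proof (good_Sig 1).
  unfold E2, fE2, fZ. rewrite ev_sub, ev_scal, ev_cst, sigma_series_ev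
    by auto using good_mul, good_cst. reflexivity.
Qed.
Lemma E4_ev tau : (0 < Im tau)%R -> E4 tau = ev (qexp tau) fE4.
Proof.
  intros H. pose proof (Cmod_qexp_lt_1 tau H). pose proof (good_Sig 3).
  unfold E4, fE4, fZ. rewrite ev_add, ev_scal, ev_cst, sigma_series_ev
    by auto using good_mul, good_cst. reflexivity.
Qed.
Lemma E6_ev tau : (0 < Im tau)%R -> E6 tau = ev (qexp tau) fE6.
Proof.
  intros H. pose proof (Cmod_qexp_lt_1 tau H). pose proof (good_Sig 5).
  unfold E6, fE6, fZ. rewrite ev_sub, ev_scal, ev_cst, sigma_series_ev
    by auto using good_mul, good_cst. reflexivity.
Qed.

Lemma fold_right_Cmult_app l (c : C) : fold_right Cmult 1 (l ++ c :: nil) = fold_right Cmult 1 l * c.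
Proof. induction l as [|x l IH]; simpl; [ring|rewrite IH; ring]. Qed.

Lemma euler_product_ev x n : (Cmod x < 1)%R ->
  fold_right Cmult 1 (map (fun n => 1 - x ^ n) (seq 1 n)) = ev x (feuler_trunc n).
Proof.
  intros Hx. induction n as [|n IH]; [symmetry; apply ev_cst|].
  rewrite seq_S, map_app. cbn [map Nat.add]. rewrite fold_right_Cmult_app, IH.
  cbn [feuler_trunc]. pose proof (good_pow fX (S n) good_fX).
  rewrite ev_mul, ev_sub, ev_pow, ev_fX by auto using good_feuler_trunc, good_sub, good_Z, good_fX.
  unfold fZ. rewrite ev_cst. reflexivity.
Qed.

Lemma eta_ev tau : (0 < Im tau)%R -> eta tau = qexp (tau / 24) * ev (qexp tau) feuler.
Proof.
  intros H. unfold eta. f_equal. apply Clim_of_Ccv.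
  pose proof (Cmod_qexp_lt_1 tau H) as Hx. set (x := qexp tau) in *. pose proof (Cmod_ge_0 x).
  apply (Ccv_ext (fun n => ev x (feuler_trunc n))); [intros n; symmetry; apply euler_product_ev; exact Hx|].
  set (s := ((1 + Cmod x) / 2)%R).
  unfold ev. apply Ccv_plus.
  - apply (Ccv_ext_loc (fun _ => feuler 0%nat)); [|apply Ccv_const].
    exists 0%nat; intros n _. symmetry; apply (feuler_trunc_agree n); lia.
  - apply (tannery (fun N n => feuler_trunc N n * x ^ n) _ (fun n => exp (/ (1 - s)) * (Cmod x / s) ^ n)%R).
    + intros i _. apply (Ccv_ext_loc (fun _ => feuler i * x ^ i)); [|apply Ccv_const].
      exists i; intros n Hn. f_equal. symmetry; apply (feuler_trunc_agree n); lia.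
    + exists 0%nat; intros N _ i _. apply coef_bound_geom; [unfold s; lra|].
      apply feuler_trunc_uniform. unfold s; lra.
    + apply ex_series_geom_S, div_lt_1. unfold s; lra.
Qed.

(** * Quasimodularity of E2 *)

Lemma csum_0 n : csum (fun _ => 0) n = 0.
Proof. induction n as [|n IH]; simpl; [reflexivity|rewrite IH; ring]. Qed.

Lemma csum_swap (f : nat -> nat -> C) m n :
  csum (fun i => csum (fun j => f i j) n) m = csum (fun j => csum (fun i => f i j) m) n.
Proof.
  induction m as [|m IH]; [symmetry; apply csum_0|]. cbn [csum]. rewrite IH, <- csum_plus.
  reflexivity.
Qed.

Lemma csum_single (f : nat -> C) j n :
  csum (fun i => if (j =? i)%nat then f i else 0) n
  = if ((1 <=? j) && (j <=? n))%nat%bool then f j else 0.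
Proof.
  induction n as [|n IH].
  - cbn [csum]. destruct (Nat.leb_spec 1 j), (Nat.leb_spec j 0); try reflexivity; lia.
  - cbn [csum]. rewrite IH.
    destruct (Nat.leb_spec 1 j), (Nat.leb_spec j n), (Nat.leb_spec j (S n)), (Nat.eqb_spec j (S n));
      subst; cbn [andb]; try lia; ring.
Qed.

Lemma coef_fsum F n k : fsum F n k = csum (fun i => F i k) n.
Proof.
  induction n as [|n IH]; [destruct k; reflexivity|].
  cbn [fsum csum]. rewrite coef_add, IH. reflexivity.
Qed.

Lemma lam_coef_csum a n N : (1 <= a)%nat -> (1 <= n <= N)%nat ->
  lam a n = csum (fun b => if (a * b =? n)%nat then 1 else 0) N.
Proof.
  intros Ha Hn. rewrite lam_coef by lia.
  destruct (Nat.eqb_spec (n mod a) 0) as [E|E].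
  - pose proof (Nat.div_mod_eq n a) as D. rewrite E, Nat.add_0_r in D.
    generalize dependent (n / a)%nat; intros b D.
    assert (Hb : (1 <= b)%nat) by (destruct b; lia).
    rewrite (csum_ext _ (fun i => if (b =? i)%nat then 1 else 0)).
    + rewrite (csum_single (fun _ => 1)).
      destruct (Nat.ltb_spec n a); [nia|].
      destruct (Nat.leb_spec 1 b); [|nia]. destruct (Nat.leb_spec b N); [reflexivity|nia].
    + intros i _. destruct (Nat.eqb_spec (a * i) n), (Nat.eqb_spec b i); try reflexivity; nia.
  - rewrite (csum_ext _ (fun _ => 0)).
    + rewrite csum_0. destruct (Nat.ltb_spec n a); reflexivity.
    + intros i _. destruct (Nat.eqb_spec (a * i) n) as [H|H]; [|reflexivity].
      exfalso; apply E. rewrite <- H, Nat.mul_comm. apply Nat.Div0.mod_mul.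
Qed.

(* Summation over divisor pairs [a b = n], with the roles of [a] and [b] exchanged. *)
Lemma csum_sigma1 q N : csum (fun n => Sig 1 n * q ^ n) N =
  csum (fun b => csum (fun a => if (a * b <=? N)%nat then cn a * (q ^ b) ^ a else 0) N) N.
Proof.
  transitivity (csum (fun n => csum (fun b => csum (fun a =>
    if (a * b =? n)%nat then cn a * q ^ n else 0) N) N) N).
  - apply csum_ext; intros n Hn.
    rewrite <- (lamsum_agree 1 N n) by lia. unfold lamsum. rewrite coef_fsum.
    rewrite Cmult_comm, <- csum_scal, csum_swap. apply csum_ext; intros a Ha.
    rewrite fmul_scal_coef, (lam_coef_csum a n N) by lia.
    rewrite <- !csum_scal. apply csum_ext; intros b Hb.
    destruct (a * b =? n)%nat; rewrite ?Cpow_1_r; ring.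
  - rewrite csum_swap. apply csum_ext; intros b Hb. rewrite csum_swap. apply csum_ext; intros a Ha.
    rewrite (csum_single (fun n => cn a * q ^ n)).
    destruct (Nat.leb_spec 1 (a * b)); [|nia]. simpl andb.
    destruct (a * b <=? N)%nat; [|reflexivity]. rewrite <- Cpow_mult_r. do 2 f_equal. lia.
Qed.

Lemma good_nat : good cn.
Proof.
  apply (good_le _ _) with (2 := good_nat_pow 1). intros n. unfold cn.
  rewrite Cpow_1_r, !Cmod_R, !Rabs_pos_eq by apply pos_INR. apply le_INR; lia.
Qed.

Lemma nat_gen_eq : ((fZ 1 - fX) * (fZ 1 - fX) * cn = fX)%fps.
Proof.
  assert (E : (cn - fX * cn = fX * geo 1)%fps).
  { apply fps_ext; intros n. rewrite coef_sub, !fX_mul_coef. unfold geo.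
    destruct n as [|n]; [unfold cn; simpl; ring|].
    rewrite Nat.mod_1_r. simpl Nat.eqb. rewrite cn_S. ring. }
  transitivity ((fZ 1 - fX) * (cn - fX * cn))%fps; [ring|]. rewrite E.
  pose proof (geo_inv 1 ltac:(lia)) as G. replace (fX ^ 1)%fps with fX in G by ring.
  transitivity (fX * ((fZ 1 - fX) * geo 1))%fps; [ring|]. rewrite G. ring.
Qed.

Lemma Cmod_lt_1_sub_neq0 y : (Cmod y < 1)%R -> 1 - y <> 0.
Proof.
  intros H E. replace y with (1 - (1 - y)) in H by ring. rewrite E in H.
  replace (1 - 0) with (RtoC 1) in H by ring. rewrite Cmod_1 in H. lra.
Qed.

Lemma Cser_nat_pow y : (Cmod y < 1)%R -> Cser (fun a => cn a * y ^ a) = y / ((1 - y) * (1 - y)).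
Proof.
  intros Hy. pose proof (f_equal (ev y) nat_gen_eq) as E.
  pose proof good_nat. pose proof good_fX.
  rewrite !ev_mul, ev_sub, ev_fX in E by auto using good_mul, good_sub, good_Z.
  unfold fZ in E. rewrite ev_cst in E. pose proof (Cmod_lt_1_sub_neq0 y Hy).
  replace (Cser (fun a => cn a * y ^ a)) with (ev y cn).
  - rewrite <- E at 2. field. assumption.
  - unfold ev. change (cn 0) with (RtoC 0). ring.
Qed.

Lemma lambert_series q : (0 < Cmod q < 1)%R ->
  Csmb (fun b => q ^ b / ((1 - q ^ b) * (1 - q ^ b))) /\
  Cser (fun b => q ^ b / ((1 - q ^ b) * (1 - q ^ b))) = ev q (Sig 1).
Proof.
  intros Hq. set (r := Cmod q) in *.
  destruct (nat_geom_bound r ltac:(lra)) as (M & HM & HMn). set (u := ((1 + r) / 2)%R) in *.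
  assert (Hu : (0 < u < 1)%R) by (unfold u; lra).
  assert (Hterm : forall a b, (1 <= a)%nat -> (1 <= b)%nat ->
    (Cmod (cn a * (q ^ b) ^ a) <= M / u * r ^ b * u ^ a)%R).
  { intros a b Ha Hb. rewrite Cmod_mult, !Cmod_pow. fold r. unfold cn.
    rewrite Cmod_R, Rabs_pos_eq by apply pos_INR. rewrite <- pow_mult.
    destruct a as [|a]; [lia|]. specialize (HMn a).
    replace (M / u * r ^ b * u ^ S a)%R with (r ^ b * (M * u ^ a))%R by (simpl; field; lra).
    apply (Rle_trans _ (INR (S a) * (r ^ b * r ^ a))%R).
    - apply Rmult_le_compat_l; [apply pos_INR|]. rewrite <- pow_add.
      replace (b * S a)%nat with (b + a + (b - 1) * a)%nat by nia. rewrite (pow_add _ (b + a)).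
      rewrite <- (Rmult_1_r (r ^ (b + a))) at 2.
      apply Rmult_le_compat_l; [apply pow_le; lra|apply pow_le_1_compat; lra].
    - replace (INR (S a) * (r ^ b * r ^ a))%R with (r ^ b * (INR (S a) * r ^ a))%R by ring.
      apply Rmult_le_compat_l; [apply pow_le; lra|exact HMn]. }
  assert (Hqb : forall b, (1 <= b)%nat -> (Cmod (q ^ b) < 1)%R).
  { intros b Hb. apply Cmod_pow_lt_1; [lia|apply Hq]. }
  set (t := fun (N b a : nat) => if (a * b <=? N)%nat then cn a * (q ^ b) ^ a else 0).
  assert (Hfin : forall N b, (1 <= b)%nat -> Csmb (t N b) /\ Cser (t N b) = csum (t N b) N).
  { intros N b Hb. apply Cser_finite. intros n Hn. unfold t.
    destruct (Nat.leb_spec (n * b) N); [nia|reflexivity]. }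
  assert (HtB : forall N b a, (1 <= a)%nat -> (1 <= b)%nat ->
    (Cmod (t N b a) <= M / u * r ^ b * u ^ a)%R).
  { intros N b a Ha Hb. unfold t. destruct (a * b <=? N)%nat; [apply Hterm; assumption|].
    rewrite Cmod_0. apply Rmult_le_pos; [|apply pow_le; lra].
    apply Rmult_le_pos; [|apply pow_le; lra]. left; apply Rdiv_lt_0_compat; lra. }
  assert (Hlim : forall b, (1 <= b)%nat -> Ccv (fun N => csum (t N b) N) (q ^ b / ((1 - q ^ b) * (1 - q ^ b)))).
  { intros b Hb. rewrite <- Cser_nat_pow by (apply Hqb; exact Hb).
    apply (Ccv_ext (fun N => Cser (t N b))); [intros N; apply Hfin; exact Hb|].
    apply (tannery (fun N => t N b) _ (fun a => M / u * r ^ b * u ^ a)%R).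
    - intros a Ha. apply (Ccv_ext_loc (fun _ => cn a * (q ^ b) ^ a)); [|apply Ccv_const].
      exists (a * b)%nat; intros N HN. unfold t. destruct (Nat.leb_spec (a * b) N); [reflexivity|lia].
    - exists 0%nat; intros N _ a Ha. apply HtB; assumption.
    - apply ex_series_geom_S; lra. }
  destruct (tannery (fun N b => if (b <=? N)%nat then csum (t N b) N else 0)
    (fun b => q ^ b / ((1 - q ^ b) * (1 - q ^ b))) (fun b => M / u * / (1 - u) * r ^ b)%R) as [Hs Hc].
  - intros b Hb. apply (Ccv_ext_loc (fun N => csum (t N b) N)); [|apply Hlim; exact Hb].
    exists b; intros N HN. destruct (Nat.leb_spec b N); [reflexivity|lia].
  - exists 0%nat; intros N _ b Hb.
    assert (P0 : (0 < M / u)%R) by (apply Rdiv_lt_0_compat; lra).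
    assert (P1 : (0 < / (1 - u))%R) by (apply Rinv_0_lt_compat; lra).
    assert (P2 : (0 < r ^ b)%R) by (apply pow_lt; lra).
    destruct (Nat.leb_spec b N) as [HbN|HbN].
    + replace (csum (t N b) N) with (csum (t N b) N - csum (t N b) 0) by (simpl; ring).
      eapply Rle_trans; [apply (Cmod_csum_sub _ (fun a => M / u * r ^ b * u ^ a)%R); [lia|]|].
      * intros a Ha; apply HtB; lia.
      * simpl rsum at 2. rewrite Rminus_0_r.
        assert (E : forall n, (rsum (fun a => M / u * r ^ b * u ^ a) n = M / u * r ^ b * rsum (fun a => u ^ a) n)%R).
        { induction n as [|n IH]; [simpl; ring|]. cbn [rsum]. rewrite IH. ring. }
        rewrite E. pose proof (rsum_geom u N Hu).
        replace (M / u * / (1 - u) * r ^ b)%R with (M / u * r ^ b * / (1 - u))%R by ring.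
        apply Rmult_le_compat_l; [nra|assumption].
    + rewrite Cmod_0. apply Rmult_le_pos; nra.
  - apply ex_series_geom_S; lra.
  - split; [exact Hs|].
    apply (Ccv_unique _ _ _ Hc). unfold ev. rewrite Sig_0, Cplus_0_l.
    apply (Ccv_ext (csum (fun n => Sig 1 n * q ^ n))).
    + intros N. rewrite csum_sigma1.
      destruct (Cser_finite (fun b => if (b <=? N)%nat then csum (t N b) N else 0) N) as [_ E].
      { intros n Hn. destruct (Nat.leb_spec n N); [lia|reflexivity]. }
      rewrite E. apply csum_ext; intros b Hb. destruct (Nat.leb_spec b N); [reflexivity|lia].
    + apply Cser_cv, ev_summable; [apply Hq|apply good_Sig].
Qed.

Lemma E2_csc2 tau : (0 < Im tau)%R -> Csmb (fun m => csc2 (cn m * tau)) /\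
  E2 tau = 1 + 6 / (RtoC PI * RtoC PI) * Cser (fun m => csc2 (cn m * tau)).
Proof.
  intros H. pose proof (Cmod_qexp_lt_1 tau H) as Hq.
  assert (Hq0 : (0 < Cmod (qexp tau))%R) by (apply Cmod_gt_0, qexp_neq0).
  destruct (lambert_series (qexp tau) (conj Hq0 Hq)) as [Hs Hc].
  assert (E : forall m, csc2 (cn m * tau) = -4 * (RtoC PI * RtoC PI)
    * (qexp tau ^ m / ((1 - qexp tau ^ m) * (1 - qexp tau ^ m)))).
  { intros m. unfold csc2, cn. rewrite qexp_mult_nat. reflexivity. }
  split.
  - apply (Csmb_ext (fun m => -4 * (RtoC PI * RtoC PI)
      * (qexp tau ^ m / ((1 - qexp tau ^ m) * (1 - qexp tau ^ m))))).
    + intros m _; symmetry; apply E.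
    + apply Csmb_scal; exact Hs.
  - rewrite (Cser_ext _ _ (fun m _ => E m)), Cser_scal, Hc, <- sigma_series_ev by assumption.
    unfold E2. field. exact PI_C_neq0.
Qed.

Lemma csc2_opp z : qexp z <> 1 -> csc2 (- z) = csc2 z.
Proof.
  intros H. unfold csc2. rewrite qexp_opp. pose proof (qexp_neq0 z).
  assert (1 - qexp z <> 0) by (apply Cminus_eq_contra; auto).
  assert (qexp z - 1 <> 0) by (apply Cminus_eq_contra; auto).
  field. repeat split; assumption.
Qed.

Lemma zeta2 : Csmb (fun n => / (cn n * cn n)) /\
  Cser (fun n => / (cn n * cn n)) = RtoC PI * RtoC PI / 6.
Proof.
  assert (Hs : Csmb (fun n => / (cn n * cn n))).
  { apply (Csmb_le _ (fun n => / (INR n * INR n))%R); [|apply ex_series_inv_sqr].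
    intros n Hn. assert (0 < INR n)%R by (apply lt_0_INR; lia).
    unfold cn. rewrite <- RtoC_mult, <- RtoC_inv by nra. rewrite Cmod_R, Rabs_pos_eq; [lra|].
    left; apply Rinv_0_lt_compat; nra. }
  split; [exact Hs|].
  set (Z := Cser (fun n => / (cn n * cn n))).
  set (z := 1 / 2).
  assert (Ez : forall x : R, z + RtoC x = RtoC (x + 1 / 2) /\ z - RtoC x = RtoC (1 / 2 - x)).
  { intros x. unfold z. rewrite RtoC_plus, RtoC_minus, RtoC_div by lra. split; ring. }
  destruct (csc2_partial_fractions z (1 / 2)) as [Hs2 E].
  { unfold z. rewrite qexp_half. intros H. apply RtoC_inj in H. lra. }
  { split; [lra|]. intros j Hj. assert (1 <= INR j)%R by (apply (le_INR 1); lia).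
    unfold cn. destruct (Ez (INR j)) as [-> ->]. rewrite !Cmod_R.
    rewrite Rabs_pos_eq, Rabs_left by lra. lra. }
  pose proof (Cser_cv _ Hs) as C1. fold Z in C1. pose proof (Cser_cv _ Hs2) as C2.
  set (W := Cser _) in E, C2.
  assert (HW : W = RtoC PI * RtoC PI - 4).
  { transitivity (csc2 z - / (z * z)); [rewrite E; ring|].
    unfold csc2, z. rewrite qexp_half. field. }
  assert (Hnz : forall n, (1 <= n)%nat -> cn n <> 0).
  { intros n Hn. apply RtoC_neq0, not_0_INR; lia. }
  assert (Hn2 : forall n, 2 * cn n + 1 <> 0).
  { intros n. unfold cn. rewrite <- RtoC_mult, <- RtoC_plus. apply RtoC_neq0.
    pose proof (pos_INR n). lra. }
  assert (Fin : forall n, csum (fun j => / ((z + cn j) * (z + cn j)) + / ((z - cn j) * (z - cn j))) n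
    = 8 * (csum (fun n => / (cn n * cn n)) (n + n) - / 4 * csum (fun n => / (cn n * cn n)) n)
      - 4 + 4 / ((2 * cn n + 1) * (2 * cn n + 1))).
  { induction n as [|n IH].
    - simpl. change (cn 0) with (RtoC 0). field.
    - replace (S n + S n)%nat with (S (S (n + n))) by lia. cbn [csum]. rewrite IH.
      assert (E1 : cn (S (n + n)) = 2 * cn n + 1) by (rewrite cn_S, cn_add; ring).
      assert (E2' : cn (S (S (n + n))) = 2 * (cn n + 1)) by (rewrite !cn_S, cn_add; ring).
      rewrite E1, E2', cn_S. unfold z.
      pose proof (Hn2 n). pose proof (Hn2 (S n)) as H3. pose proof (Hnz (S n) ltac:(lia)) as H4.
      rewrite cn_S in H3, H4.
      assert (H5 : 1 - (cn n + 1) * 2 <> 0).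
      { intros K. apply H. transitivity (- (1 - (cn n + 1) * 2)); [ring|rewrite K; ring]. }
      field. repeat split; assumption. }
  assert (L1 : Ccv (fun n => 4 / ((2 * cn n + 1) * (2 * cn n + 1))) 0).
  { apply (Ccv_squeeze _ _ (fun n => 4 * / INR (n + 1))%R).
    - intros n. pose proof (pos_INR n). replace (4 / ((2 * cn n + 1) * (2 * cn n + 1)) - 0) with
        (RtoC (4 / ((2 * INR n + 1) * (2 * INR n + 1)))).
      + rewrite Cmod_R, Rabs_pos_eq by (apply Rlt_le, Rdiv_lt_0_compat; nra).
        apply Rmult_le_compat_l; [lra|]. rewrite plus_INR. simpl (INR 1).
        apply Rinv_le_contravar; nra.
      + unfold cn. rewrite RtoC_div, !RtoC_mult, !RtoC_plus, !RtoC_mult by nra. ring.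
    - replace (Finite 0) with (Finite (4 * 0)) by (f_equal; ring).
      apply is_lim_seq_mult'; [apply is_lim_seq_const|].
      apply (is_lim_seq_incr_n (fun n => / INR n)%R 1).
      apply (is_lim_seq_inv _ p_infty); [apply is_lim_seq_INR|discriminate]. }
  assert (L2 : Ccv (csum (fun j => / ((z + cn j) * (z + cn j)) + / ((z - cn j) * (z - cn j))))
    (8 * (Z - / 4 * Z) - 4 + 0)).
  { apply (Ccv_ext _ _ _ (fun n => eq_sym (Fin n))).
    apply Ccv_plus; [|exact L1]. apply Ccv_minus; [|apply Ccv_const]. apply Ccv_scal.
    apply Ccv_minus; [|apply Ccv_scal; exact C1].
    apply (Ccv_subseq _ _ (fun n => (n + n)%nat)); [intros; lia|exact C1]. }
  pose proof (Ccv_unique _ _ _ C2 L2) as EW. rewrite HW in EW.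
  replace (RtoC PI * RtoC PI) with (8 * (Z - / 4 * Z) - 4 + 0 + 4) by (rewrite <- EW; ring).
  field.
Qed.

Lemma lattice_lower tau : (0 < Im tau)%R -> exists k, (0 < k)%R /\
  forall a b : R, (k * (Rabs a + Rabs b) <= Cmod (RtoC a + RtoC b * tau))%R.
Proof.
  intros H. set (y := Im tau) in *. set (T := Cmod tau).
  assert (HT : (0 <= T)%R) by apply Cmod_ge_0.
  exists (/ (1 + (1 + T) / y))%R.
  assert (P : (0 < 1 + (1 + T) / y)%R).
  { assert (0 < (1 + T) / y)%R by (apply Rdiv_lt_0_compat; lra). lra. }
  split; [apply Rinv_0_lt_compat; exact P|]. intros a b.
  set (w := RtoC a + RtoC b * tau).
  assert (H1 : (Rabs b * y <= Cmod w)%R).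
  { eapply Rle_trans; [|apply Im_le_Cmod]. unfold w, y. destruct tau as [t1 t2].
    assert (Hy : (0 < t2)%R) by exact H. simpl.
    replace (0 + (b * t2 + 0 * t1))%R with (b * t2)%R by ring.
    rewrite Rabs_mult, (Rabs_pos_eq t2) by lra. lra. }
  assert (H2 : (Rabs a <= Cmod w + Rabs b * T)%R).
  { rewrite <- (Cmod_R a), <- (Cmod_R b). unfold T. rewrite <- Cmod_mult.
    replace (RtoC a) with (w + - (RtoC b * tau)) by (unfold w; ring).
    eapply Rle_trans; [apply Cmod_triangle|]. rewrite Cmod_opp. lra. }
  assert (H3 : (Rabs b <= Cmod w / y)%R).
  { apply (Rmult_le_reg_r y); [exact H|]. unfold Rdiv. rewrite (Rmult_assoc (Cmod w)), Rinv_l by lra. lra. }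
  apply (Rmult_le_reg_l (1 + (1 + T) / y)); [exact P|].
  rewrite <- Rmult_assoc, Rinv_r, Rmult_1_l by lra.
  apply (Rle_trans _ (Cmod w + Cmod w / y * T + Cmod w / y)%R).
  - pose proof (Rabs_pos b). nra.
  - right. field. lra.
Qed.

Lemma Im_neg_inv tau : (0 < Im tau)%R -> (0 < Im (-1 / tau))%R.
Proof.
  destruct tau as [x y]. intros H. change (0 < y)%R in H.
  assert (P : (0 < x * x + y * y)%R) by nra.
  assert (E : Im (-1 / (x, y)) = (y / (x * x + y * y))%R).
  { unfold Cdiv, Cinv, Cmult, RtoC; simpl. field. nra. }
  rewrite E. apply Rdiv_lt_0_compat; lra.
Qed.

Lemma tau_neq0 tau : (0 < Im tau)%R -> tau <> 0.
Proof. intros H E. rewrite E in H. simpl in H. lra. Qed.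

Lemma Cser_csum (f : nat -> nat -> C) N :
  (forall n, (1 <= n)%nat -> Csmb (f n)) ->
  Csmb (fun m => csum (fun n => f n m) N) /\
  Cser (fun m => csum (fun n => f n m) N) = csum (fun n => Cser (f n)) N.
Proof.
  intros H. induction N as [|N [IH1 IH2]].
  - apply (Cser_finite (fun m => csum (fun n => f n m) 0) 0). reflexivity.
  - cbn [csum]. split; [apply Csmb_plus; [exact IH1|apply H; lia]|].
    rewrite Cser_plus, IH2 by (try assumption; apply H; lia). reflexivity.
Qed.

Lemma inv_INR_lim c : (0 < c)%R -> is_lim_seq (fun n => / (INR n + c))%R 0%R.
Proof.
  intros Hc. apply (is_lim_seq_inv _ p_infty); [|discriminate].
  apply (is_lim_seq_plus _ _ p_infty c); [apply is_lim_seq_INR|apply is_lim_seq_const|reflexivity].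
Qed.

Section EisensteinTransformation.
Variable tau : C.
Hypothesis Htau : (0 < Im tau)%R.
Variable k : R.
Hypothesis Hk : (0 < k)%R.
Hypothesis Hlow : forall a b : R, (k * (Rabs a + Rabs b) <= Cmod (RtoC a + RtoC b * tau))%R.

Let x (m : nat) : C := cn m * tau.

Lemma lattice_pos n m : (k * (INR n + INR m) <= Cmod (cn n + x m))%R.
Proof.
  pose proof (Hlow (INR n) (INR m)) as H. rewrite !Rabs_pos_eq in H by apply pos_INR. exact H.
Qed.

Lemma lattice_neg n m : (k * (INR n + INR m) <= Cmod (cn n - x m))%R.
Proof.
  pose proof (Hlow (INR n) (- INR m)) as H. rewrite Rabs_Ropp, !Rabs_pos_eq in H by apply pos_INR.
  replace (cn n - x m) with (RtoC (INR n) + RtoC (- INR m) * tau); [exact H|].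
  unfold x, cn. rewrite RtoC_opp. ring.
Qed.

Lemma lattice_neq0 n m : (1 <= n + m)%nat -> cn n + x m <> 0 /\ cn n - x m <> 0.
Proof.
  intros H. apply (le_INR 1) in H. rewrite plus_INR in H. simpl (INR 1) in H.
  pose proof (lattice_pos n m). pose proof (lattice_neg n m).
  split; apply Cmod_gt_0; nra.
Qed.

Lemma inv_bound (z : C) K : (0 < K)%R -> (K <= Cmod z)%R -> (Cmod (/ z) <= / K)%R.
Proof.
  intros HK H. rewrite Cmod_inv by (apply Cmod_gt_0; lra). apply Rinv_le_contravar; lra.
Qed.

Lemma x_qexp_neq1 m : (1 <= m)%nat -> qexp (x m) <> 1.
Proof.
  intros Hm. apply qexp_neq1. unfold x, cn. destruct tau as [a b]. simpl in *.
  assert (0 < INR m)%R by (apply lt_0_INR; lia). nra.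
Qed.

Lemma x_far m : far k (x m).
Proof.
  split; [exact Hk|]. intros j Hj. pose proof (pos_INR m). split.
  - rewrite Cplus_comm. eapply Rle_trans; [|apply lattice_pos]. nra.
  - rewrite Cmod_sub_sym. eapply Rle_trans; [|apply lattice_neg]. nra.
Qed.

Let row (m n : nat) : C := / ((x m + cn n) * (x m + cn n)) + / ((x m - cn n) * (x m - cn n)).
Let corr (N m : nat) : C := / (cn N + x m) + / (cn N - x m).
(* The truncated row sum, completed by the telescoping approximation of its tail. *)
Let B (N m : nat) : C := / (x m * x m) + csum (row m) N + corr N m.

Lemma row_cv m : (1 <= m)%nat -> Ccv (fun N => B N m) (csc2 (x m)).
Proof.
  intros Hm.
  destruct (csc2_partial_fractions (x m) k (x_qexp_neq1 m Hm) (x_far m)) as [Hs ->].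
  replace (/ (x m * x m) + Cser (fun j => / ((x m + cn j) * (x m + cn j)) + / ((x m - cn j) * (x m - cn j))))
    with (/ (x m * x m) + Cser (fun j => / ((x m + cn j) * (x m + cn j)) + / ((x m - cn j) * (x m - cn j))) + 0) by ring.
  apply Ccv_plus; [apply Ccv_plus; [apply Ccv_const|apply Cser_cv; exact Hs]|].
  assert (Hm' : (0 < INR m)%R) by (apply lt_0_INR; lia).
  apply (Ccv_squeeze _ _ (fun N => 2 * / k * / (INR N + INR m))%R).
  - intros N. pose proof (pos_INR N).
    replace (corr N m - 0) with (corr N m) by ring. unfold corr.
    eapply Rle_trans; [apply Cmod_triangle|].
    assert (P : (0 < k * (INR N + INR m))%R) by nra.
    pose proof (inv_bound _ _ P (lattice_pos N m)). pose proof (inv_bound _ _ P (lattice_neg N m)).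
    replace (2 * / k * / (INR N + INR m))%R with (2 * / (k * (INR N + INR m)))%R by (field; lra).
    lra.
  - replace (Finite 0) with (Finite (2 * / k * 0)) by (f_equal; ring).
    apply is_lim_seq_mult'; [apply is_lim_seq_const|apply inv_INR_lim; exact Hm'].
Qed.

Lemma B_step m N : (1 <= m)%nat ->
  (Cmod (B (S N) m - B N m) <=
    2 / (k * k * k * INR m) * (/ (INR N + INR m) - / (INR (S N) + INR m)))%R.
Proof.
  intros Hm.
  assert (Hm' : (1 <= INR m)%R) by (apply (le_INR 1); lia).
  destruct (lattice_neq0 N m ltac:(lia)) as [N1 N2].
  destruct (lattice_neq0 (S N) m ltac:(lia)) as [N3 N4].
  pose proof (pos_INR N) as HN.
  assert (ES : cn (S N) = cn N + 1) by apply cn_S.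
  assert (N5 : x m + cn (S N) <> 0) by (rewrite Cplus_comm; exact N3).
  assert (N6 : x m - cn (S N) <> 0).
  { intros E; apply N4. replace (cn (S N) - x m) with (- (x m - cn (S N))) by ring. rewrite E; ring. }
  assert (N0 : x m <> 0).
  { destruct (lattice_neq0 0 m Hm) as [H _]. change (cn 0) with (RtoC 0) in H.
    rewrite Cplus_0_l in H. exact H. }
  assert (E : B (S N) m - B N m =
    - (/ (cn (S N) + x m) * / (cn (S N) + x m) * / (cn N + x m)
       + / (cn (S N) - x m) * / (cn (S N) - x m) * / (cn N - x m))).
  { unfold B, corr, row. cbn [csum]. rewrite ES in *. field. repeat split; assumption. }
  rewrite E, Cmod_opp. eapply Rle_trans; [apply Cmod_triangle|].
  set (a := (INR N + INR m)%R) in *. set (b := (INR (S N) + INR m)%R) in *.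
  assert (Eb : b = (a + 1)%R) by (unfold a, b; rewrite S_INR; ring).
  assert (Pa : (0 < k * a)%R) by (unfold a; nra).
  assert (Pb : (0 < k * b)%R) by nra.
  assert (Ha : (1 <= a)%R) by (unfold a; lra).
  assert (Term : forall u v, (k * b <= Cmod u)%R -> (k * a <= Cmod v)%R ->
    (Cmod (/ u * / u * / v) <= / (k * b) * / (k * b) * / (k * a))%R).
  { intros u v Hu Hv. rewrite !Cmod_mult.
    pose proof (inv_bound u _ Pb Hu). pose proof (inv_bound v _ Pa Hv).
    pose proof (Cmod_ge_0 (/ u)). pose proof (Cmod_ge_0 (/ v)).
    apply Rmult_le_compat; try assumption; [apply Rmult_le_pos; assumption|].
    apply Rmult_le_compat; assumption. }
  pose proof (Term _ _ (lattice_pos (S N) m) (lattice_pos N m)).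
  pose proof (Term _ _ (lattice_neg (S N) m) (lattice_neg N m)).
  apply (Rle_trans _ (2 * (/ (k * b) * / (k * b) * / (k * a)))%R); [lra|].
  replace (2 / (k * k * k * INR m) * (/ a - / b))%R with
    (2 / (k * k * k) * (/ INR m * / (a * b)))%R by (rewrite Eb; field; repeat split; lra).
  replace (2 * (/ (k * b) * / (k * b) * / (k * a)))%R with
    (2 / (k * k * k) * (/ b * / (a * b)))%R by (field; repeat split; lra).
  apply Rmult_le_compat_l.
  - apply Rlt_le, Rdiv_lt_0_compat; [lra|]. repeat apply Rmult_lt_0_compat; exact Hk.
  - apply Rmult_le_compat_r; [left; apply Rinv_0_lt_compat; nra|].
    apply Rinv_le_contravar; [lra|]. unfold b. pose proof (pos_INR (S N)). lra.
Qed.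

Lemma B_bound m N : (1 <= m)%nat ->
  (Cmod (B N m) <= Cmod (csc2 (x m)) + 2 / (k * k * k) * / (INR m * INR m))%R.
Proof.
  intros Hm. assert (Hm' : (1 <= INR m)%R) by (apply (le_INR 1); lia).
  pose proof (pos_INR N) as HN.
  assert (P : (0 < 2 / (k * k * k * INR m))%R).
  { apply Rdiv_lt_0_compat; [lra|]. repeat apply Rmult_lt_0_compat; lra. }
  assert (H1 : forall j, (Cmod (B (N + j) m - B N m) <=
    2 / (k * k * k * INR m) * (/ (INR N + INR m) - / (INR (N + j) + INR m)))%R).
  { induction j as [|j IH].
    - rewrite Nat.add_0_r. replace (B N m - B N m) with (RtoC 0) by ring. rewrite Cmod_0.
      right; ring.
    - rewrite Nat.add_succ_r. pose proof (B_step m (N + j) Hm) as Hst.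
      replace (B (S (N + j)) m - B N m) with ((B (S (N + j)) m - B (N + j) m) + (B (N + j) m - B N m)) by ring.
      eapply Rle_trans; [apply Cmod_triangle|]. lra. }
  assert (H2 : (Cmod (csc2 (x m) - B N m) <= 2 / (k * k * k) * / (INR m * INR m))%R).
  { apply (Ccv_le (fun j => B (N + j) m - B N m)).
    - apply Ccv_minus; [|apply Ccv_const].
      apply (Ccv_subseq (fun N => B N m) _ (fun j => (N + j)%nat)); [intros; lia|apply row_cv; exact Hm].
    - intros j. eapply Rle_trans; [apply H1|].
      replace (2 / (k * k * k) * / (INR m * INR m))%R with
        (2 / (k * k * k * INR m) * / INR m)%R by (field; lra).
      apply Rmult_le_compat_l; [lra|]. pose proof (pos_INR (N + j)).
      assert (0 < / (INR (N + j) + INR m))%R by (apply Rinv_0_lt_compat; lra).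
      assert (/ (INR N + INR m) <= / INR m)%R by (apply Rinv_le_contravar; lra). lra. }
  replace (B N m) with (csc2 (x m) + - (csc2 (x m) - B N m)) by ring.
  eapply Rle_trans; [apply Cmod_triangle|]. rewrite Cmod_opp. lra.
Qed.

Lemma B_sum_cv : Ccv (fun N => Cser (B N)) (Cser (fun m => csc2 (x m))).
Proof.
  apply (tannery B _ (fun m => Cmod (csc2 (x m)) + 2 / (k * k * k) * / (INR m * INR m))%R).
  - apply row_cv.
  - exists 0%nat; intros N _ m Hm. apply B_bound; exact Hm.
  - apply (ex_series_plus (K := R_AbsRing) (V := R_NormedModule)).
    + apply (proj1 (E2_csc2 tau Htau)).
    + apply ex_series_scaled_inv_sqr.
Qed.

Lemma col_far n : far (k / Cmod tau) (cn n / tau).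
Proof.
  pose proof (tau_neq0 tau Htau) as Ht. assert (P : (0 < Cmod tau)%R) by (apply Cmod_gt_0; exact Ht).
  split; [apply Rdiv_lt_0_compat; assumption|]. intros j Hj.
  assert (Pi : (0 < / Cmod tau)%R) by (apply Rinv_0_lt_compat; exact P).
  pose proof (pos_INR n). pose proof (pos_INR j).
  replace (cn n / tau + cn j) with ((cn n + x j) / tau) by (unfold x; field; exact Ht).
  replace (cn n / tau - cn j) with ((cn n - x j) / tau) by (unfold x; field; exact Ht).
  rewrite !Cmod_div by exact Ht.
  pose proof (lattice_pos n j). pose proof (lattice_neg n j).
  replace (k / Cmod tau * INR j)%R with (k * INR j * / Cmod tau)%R by (field; lra).
  split; apply Rmult_le_compat_r; nra.
Qed.

Lemma cn_div_opp n : cn n / tau = - (cn n * (-1 / tau)).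
Proof. field. apply tau_neq0; exact Htau. Qed.

Lemma col_qexp n : (1 <= n)%nat -> qexp (cn n * (-1 / tau)) <> 1.
Proof.
  intros Hn. apply qexp_neq1. pose proof (Im_neg_inv tau Htau) as H. unfold cn.
  destruct (-1 / tau) as [a b]. simpl in *.
  assert (0 < INR n)%R by (apply lt_0_INR; lia). nra.
Qed.

Lemma col_qexp' n : (1 <= n)%nat -> qexp (cn n / tau) <> 1.
Proof.
  intros Hn E. apply (col_qexp n Hn). rewrite cn_div_opp, qexp_opp in E.
  pose proof (Cinv_r _ (qexp_neq0 (cn n * (-1 / tau)))) as H.
  rewrite E, Cmult_1_r in H. exact H.
Qed.

Lemma col_sum n : (1 <= n)%nat -> Csmb (fun m => row m n) /\
  Cser (fun m => row m n) = / (tau * tau) * csc2 (cn n * (-1 / tau)) - / (cn n * cn n).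
Proof.
  intros Hn. pose proof (tau_neq0 tau Htau) as Ht.
  destruct (csc2_partial_fractions (cn n / tau) _ (col_qexp' n Hn) (col_far n)) as [Hs E].
  assert (Hr : forall m, (1 <= m)%nat -> / (tau * tau) *
    (/ ((cn n / tau + cn m) * (cn n / tau + cn m)) + / ((cn n / tau - cn m) * (cn n / tau - cn m)))
    = row m n).
  { intros m Hm. destruct (lattice_neq0 n m ltac:(lia)) as [N1 N2]. unfold row, x in *.
    assert (N3 : cn m * tau + cn n <> 0) by (rewrite Cplus_comm; exact N1).
    assert (N4 : cn m * tau - cn n <> 0).
    { intros K; apply N2. replace (cn n - cn m * tau) with (- (cn m * tau - cn n)) by ring.
      rewrite K; ring. }
    assert (N5 : cn n - tau * cn m <> 0) by (rewrite (Cmult_comm tau); exact N2).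
    assert (N6 : cn n + tau * cn m <> 0) by (rewrite (Cmult_comm tau); exact N1).
    field. repeat split; assumption. }
  split.
  - apply (Csmb_ext _ _ Hr). apply Csmb_scal; exact Hs.
  - rewrite <- (Cser_ext _ _ Hr), Cser_scal by exact Hs.
    rewrite <- csc2_opp by (apply col_qexp; exact Hn). rewrite <- cn_div_opp, E.
    assert (cn n <> 0) by (apply RtoC_neq0, not_0_INR; lia).
    field. split; assumption.
Qed.

Lemma corr_sum N : (1 <= N)%nat -> Csmb (corr N) /\
  Cser (corr N) = / tau * pcot (cn N / tau) - / cn N.
Proof.
  intros HN. pose proof (tau_neq0 tau Htau) as Ht.
  destruct (pcot_partial_fractions (cn N / tau) _ (col_qexp' N HN) (col_far N)) as [Hs E].
  assert (Hr : forall m, (1 <= m)%nat -> / tau * (/ (cn N / tau + cn m) + / (cn N / tau - cn m))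
    = corr N m).
  { intros m Hm. destruct (lattice_neq0 N m ltac:(lia)) as [N1 N2]. unfold corr, x in *.
    assert (N5 : cn N - tau * cn m <> 0) by (rewrite (Cmult_comm tau); exact N2).
    assert (N6 : cn N + tau * cn m <> 0) by (rewrite (Cmult_comm tau); exact N1).
    field. repeat split; assumption. }
  split.
  - apply (Csmb_ext _ _ Hr). apply Csmb_scal; exact Hs.
  - rewrite <- (Cser_ext _ _ Hr), Cser_scal, E by exact Hs.
    assert (cn N <> 0) by (apply RtoC_neq0, not_0_INR; lia).
    field. split; assumption.
Qed.

Lemma B_sum N : (1 <= N)%nat -> Cser (B N) =
  / (tau * tau) * (RtoC PI * RtoC PI / 6)
  + (/ (tau * tau) * csum (fun n => csc2 (cn n * (-1 / tau))) N - csum (fun n => / (cn n * cn n)) N)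
  + (/ tau * pcot (cn N / tau) - / cn N).
Proof.
  intros HN. destruct zeta2 as [Hz Ez]. pose proof (tau_neq0 tau Htau) as Ht.
  assert (H1 : forall m, (1 <= m)%nat -> / (tau * tau) * / (cn m * cn m) = / (x m * x m)).
  { intros m Hm. assert (cn m <> 0) by (apply RtoC_neq0, not_0_INR; lia).
    unfold x. field. split; assumption. }
  assert (H2 : Csmb (fun m => / (x m * x m))).
  { apply (Csmb_ext _ _ H1). apply Csmb_scal; exact Hz. }
  destruct (Cser_csum (fun n m => row m n) N (fun n Hn => proj1 (col_sum n Hn))) as [H3 H4].
  destruct (corr_sum N HN) as [H5 H6].
  change (Cser (B N)) with (Cser (fun m => / (x m * x m) + csum (row m) N + corr N m)).
  rewrite Cser_plus by (try assumption; apply Csmb_plus; assumption).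
  rewrite Cser_plus by assumption. rewrite H6.
  rewrite <- (Cser_ext _ _ H1), Cser_scal, Ez by exact Hz.
  change (Cser (fun m => csum (row m) N)) with (Cser (fun m => csum (fun n => row m n) N)).
  rewrite H4.
  rewrite (csum_ext _ (fun n => / (tau * tau) * csc2 (cn n * (-1 / tau)) + (-1) * / (cn n * cn n))).
  - rewrite csum_plus, !csum_scal. ring.
  - intros n Hn. rewrite (proj2 (col_sum n ltac:(lia))). ring.
Qed.

Lemma pcot_limit : Ccv (fun N => pcot (cn N / tau)) (RtoC PI * Ci).
Proof.
  set (Q := qexp (-1 / tau)).
  assert (HQ : (Cmod Q < 1)%R) by (apply Cmod_qexp_lt_1, Im_neg_inv; exact Htau).
  assert (HQ0 : Q <> 0) by apply qexp_neq0.
  assert (HL : Ccv (fun N => Q ^ N) 0).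
  { apply (Ccv_squeeze _ _ (fun N => (Cmod Q) ^ N)%R).
    - intros N. replace (Q ^ N - 0) with (Q ^ N) by ring. rewrite Cmod_pow. lra.
    - apply is_lim_seq_geom. rewrite Rabs_pos_eq by apply Cmod_ge_0. exact HQ. }
  assert (H1 : 1 - 0 <> 0) by (replace (1 - 0) with (RtoC 1) by ring; apply C1_nz).
  pose proof (Ccv_scal (RtoC PI * Ci) _ _ (Ccv_mult _ _ _ _ (Ccv_plus _ _ _ _ (Ccv_const 1) HL)
    (Ccv_inv _ _ H1 (Ccv_minus _ _ _ _ (Ccv_const 1) HL)))) as H.
  replace (RtoC PI * Ci * ((1 + 0) * / (1 - 0))) with (RtoC PI * Ci) in H by field.
  revert H; apply Ccv_ext_loc. exists 1%nat; intros N HN.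
  unfold pcot. rewrite cn_div_opp, qexp_opp. unfold cn. rewrite qexp_mult_nat. fold Q.
  pose proof (Cpow_nz Q N HQ0).
  assert (N1 : 1 - Q ^ N <> 0).
  { apply Cmod_lt_1_sub_neq0. apply Cmod_pow_lt_1; [lia|exact HQ]. }
  assert (N2 : / Q ^ N - 1 <> 0).
  { replace (/ Q ^ N - 1) with ((1 - Q ^ N) / Q ^ N) by (field; assumption).
    apply Cmult_neq_0; [exact N1|]. apply Cmod_gt_0. rewrite Cmod_inv by assumption.
    apply Rinv_0_lt_compat, Cmod_gt_0; assumption. }
  field. repeat split; assumption.
Qed.

Lemma E2_inv_section : E2 (-1 / tau) = tau ^ 2 * E2 tau - 6 * Ci * tau / RtoC PI.
Proof.
  pose proof (tau_neq0 tau Htau) as Ht.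
  destruct (E2_csc2 tau Htau) as [_ E1].
  destruct (E2_csc2 (-1 / tau) (Im_neg_inv tau Htau)) as [Hs E2'].
  destruct zeta2 as [Hz Ez].
  assert (HL : Ccv (fun N => Cser (B N))
    (/ (tau * tau) * (RtoC PI * RtoC PI / 6)
     + (/ (tau * tau) * Cser (fun n => csc2 (cn n * (-1 / tau))) - RtoC PI * RtoC PI / 6)
     + (/ tau * (RtoC PI * Ci) - 0))).
  { apply (Ccv_ext_loc (fun N => / (tau * tau) * (RtoC PI * RtoC PI / 6)
      + (/ (tau * tau) * csum (fun n => csc2 (cn n * (-1 / tau))) N - csum (fun n => / (cn n * cn n)) N)
      + (/ tau * pcot (cn N / tau) - / cn N))).
    - exists 1%nat; intros N HN. symmetry; apply B_sum; exact HN.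
    - apply Ccv_plus; [apply Ccv_plus; [apply Ccv_const|]|].
      + apply Ccv_minus; [apply Ccv_scal, Cser_cv; exact Hs|].
        rewrite <- Ez. apply Cser_cv; exact Hz.
      + apply Ccv_minus; [apply Ccv_scal, pcot_limit|].
        apply (is_lim_seq_incr_1 (fun n => Cmod (/ cn n - 0))).
        apply (Ccv_squeeze (fun n => / cn (S n)) 0 (fun n => / (INR n + 1))%R); [|apply inv_INR_lim; lra].
        intros n. replace (/ cn (S n) - 0) with (/ cn (S n)) by ring.
        pose proof (pos_INR n). apply inv_bound; [lra|]. unfold cn.
        rewrite Cmod_R, S_INR, Rabs_pos_eq; lra. }
  pose proof (Ccv_unique _ _ _ B_sum_cv HL) as E. unfold x in E.
  rewrite E1, E2', E. field. split; [exact PI_C_neq0|exact Ht].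
Qed.
End EisensteinTransformation.

Lemma E2_inv tau : (0 < Im tau)%R -> E2 (-1 / tau) = tau ^ 2 * E2 tau - 6 * Ci * tau / RtoC PI.
Proof.
  intros H. destruct (lattice_lower tau H) as (k & Hk & Hlow).
  exact (E2_inv_section tau H k Hk Hlow).
Qed.

(** * Hecke relations and the main theorem *)

Lemma sigma1_csum n N : (1 <= n <= N)%nat ->
  Sig 1 n = csum (fun a => if (n mod a =? 0)%nat then cn a else 0) N.
Proof.
  intros Hn. rewrite <- (lamsum_agree 1 N n) by lia. unfold lamsum. rewrite coef_fsum.
  apply csum_ext; intros a Ha. rewrite fmul_scal_coef, lam_coef, Cpow_1_r by lia.
  destruct (Nat.ltb_spec n a) as [H|H].
  - rewrite Nat.mod_small by lia. destruct (Nat.eqb_spec n 0); [lia|]. ring.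
  - destruct (n mod a =? 0)%nat; ring.
Qed.

Section HeckeRelation.
Variable p : nat.
Hypothesis Hp : (1 < p)%nat.
Hypothesis Hgcd : forall a, (a mod p <> 0)%nat -> Nat.gcd a p = 1%nat.

(* Split the divisors of [p n] according to divisibility by [p]. *)
Lemma sigma1_hecke n : (1 <= n)%nat ->
  Sig 1 (p * n)%nat = (cn p + 1) * Sig 1 n - cn p * fV p (Sig 1) n.
Proof.
  intros Hn.
  set (A := fun a => if (a mod p =? 0)%nat
    then (fun b => if ((p * n) mod (p * b) =? 0)%nat then cn (p * b) else 0) (a / p)%nat else 0).
  set (B := fun a => if (a mod p =? 0)%nat
    then (fun b => if (n mod (p * b) =? 0)%nat then cn (p * b) else 0) (a / p)%nat else 0).
  set (D := fun a => if (a mod p =? 0)%nat then RtoC 0 else if (n mod a =? 0)%nat then cn a else 0).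
  assert (Hcn : forall b, cn (p * b) = cn p * cn b)
    by (intros b; unfold cn; rewrite mult_INR, RtoC_mult; reflexivity).
  assert (Hdiv : forall a, (a mod p)%nat = 0%nat -> (p * (a / p))%nat = a).
  { intros a E. pose proof (Nat.div_mod_eq a p). lia. }
  assert (E1 : Sig 1 (p * n)%nat = csum A (p * n) + csum D (p * n)).
  { rewrite (sigma1_csum (p * n) (p * n)) by nia. rewrite <- csum_plus. apply csum_ext; intros a Ha.
    unfold A, D. destruct (Nat.eqb_spec (a mod p) 0) as [E|E].
    - rewrite (Hdiv a E). ring.
    - replace ((p * n) mod a =? 0)%nat with (n mod a =? 0)%nat; [ring|].
      apply Bool.eq_true_iff_eq. rewrite !Nat.eqb_eq, !Nat.Lcm0.mod_divide.
      split; intros H; [apply Nat.divide_mul_r; exact H|].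
      apply (Nat.gauss _ p); [exact H|apply Hgcd; exact E]. }
  assert (E2 : Sig 1 n = csum B (p * n) + csum D (p * n)).
  { rewrite (sigma1_csum n (p * n)) by nia. rewrite <- csum_plus. apply csum_ext; intros a Ha.
    unfold B, D. destruct (Nat.eqb_spec (a mod p) 0) as [E|E]; [rewrite (Hdiv a E)|]; ring. }
  assert (E3 : csum A (p * n) = cn p * Sig 1 n).
  { unfold A. rewrite (csum_multiples p (fun b => if ((p * n) mod (p * b) =? 0)%nat
      then cn (p * b) else 0) n ltac:(lia)).
    rewrite (sigma1_csum n n), <- csum_scal by lia. apply csum_ext; intros b Hb.
    rewrite Nat.Div0.mul_mod_distr_l, Hcn.
    replace (p * (n mod b) =? 0)%nat with (n mod b =? 0)%nat
      by (destruct (Nat.eqb_spec (n mod b) 0), (Nat.eqb_spec (p * (n mod b)) 0); try reflexivity; nia).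
    destruct (n mod b =? 0)%nat; ring. }
  assert (E4 : csum B (p * n) = cn p * fV p (Sig 1) n).
  { unfold B. rewrite (csum_multiples p (fun b => if (n mod (p * b) =? 0)%nat
      then cn (p * b) else 0) n ltac:(lia)).
    unfold fV. destruct (Nat.eqb_spec (n mod p) 0) as [E|E].
    - pose proof (Hdiv n E) as Dn. set (m := (n / p)%nat) in *. clearbody m.
      rewrite (sigma1_csum m n) by nia. rewrite <- csum_scal. apply csum_ext; intros b Hb.
      rewrite <- Dn, Nat.Div0.mul_mod_distr_l, Hcn.
      replace (p * (m mod b) =? 0)%nat with (m mod b =? 0)%nat
        by (destruct (Nat.eqb_spec (m mod b) 0), (Nat.eqb_spec (p * (m mod b)) 0); try reflexivity; nia).
      destruct (m mod b =? 0)%nat; ring.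
    - rewrite (csum_ext _ (fun _ => 0)), csum_0; [ring|]. intros b Hb.
      destruct (Nat.eqb_spec (n mod (p * b)) 0) as [E'|E']; [|reflexivity].
      exfalso; apply E. apply Nat.Lcm0.mod_divide in E'. apply Nat.Lcm0.mod_divide.
      apply (Nat.divide_trans _ (p * b)); [apply Nat.divide_factor_l|exact E']. }
  rewrite E1, E3. replace (csum D (p * n)) with (Sig 1 n - csum B (p * n)) by (rewrite E2; ring).
  rewrite E4. ring.
Qed.

Lemma fE2_hecke n :
  cn p * fE2 (p * n)%nat + cn p * cn p * fV p fE2 n = (cn p * cn p + cn p) * fE2 n.
Proof.
  assert (C0 : fV p fE2 0%nat = 1) by (rewrite fV_coef0; apply fE2_0).
  destruct n as [|n].
  - rewrite Nat.mul_0_r, C0, fE2_0. ring.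
  - assert (H : forall k, (1 <= k)%nat -> fE2 k = -24 * Sig 1 k).
    { intros k Hk. unfold fE2, fZ. rewrite coef_sub, fmul_scal_coef.
      destruct k; [lia|]. simpl (fcst 1 (S k)). ring. }
    assert (HV : fV p fE2 (S n) = -24 * fV p (Sig 1) (S n)).
    { unfold fV. destruct (Nat.eqb_spec (S n mod p) 0) as [E|E]; [|ring].
      apply H. pose proof (Nat.div_mod_eq (S n) p). nia. }
    rewrite HV, !H, sigma1_hecke by nia. ring.
Qed.
End HeckeRelation.

Lemma fV_fV m a : (0 < m)%nat -> fV m (fV m a) = fV (m * m) a.
Proof.
  intros Hm. apply fps_ext; intros n. unfold fV.
  destruct (Nat.eqb_spec (n mod m) 0) as [E|E].
  - pose proof (Nat.div_mod_eq n m) as D. rewrite E, Nat.add_0_r in D.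
    rewrite <- Nat.Div0.div_div. set (k := (n / m)%nat) in *. rewrite D.
    rewrite Nat.Div0.mul_mod_distr_l.
    destruct (Nat.eqb_spec (k mod m) 0), (Nat.eqb_spec (m * (k mod m)) 0); try reflexivity; nia.
  - destruct (Nat.eqb_spec (n mod (m * m)) 0) as [E'|E']; [|reflexivity].
    exfalso; apply E. apply Nat.Lcm0.mod_divide in E'. apply Nat.Lcm0.mod_divide.
    apply (Nat.divide_trans _ (m * m)); [apply Nat.divide_factor_l|exact E'].
Qed.

Lemma gcd_mod_2 a : (a mod 2 <> 0)%nat -> Nat.gcd a 2 = 1%nat.
Proof.
  intros H. rewrite Nat.gcd_comm, <- Nat.Lcm0.gcd_mod, Nat.gcd_comm.
  pose proof (Nat.mod_upper_bound a 2 ltac:(lia)).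
  replace (a mod 2) with 1%nat by lia. reflexivity.
Qed.

Lemma gcd_mod_3 a : (a mod 3 <> 0)%nat -> Nat.gcd a 3 = 1%nat.
Proof.
  intros H. rewrite Nat.gcd_comm, <- Nat.Lcm0.gcd_mod, Nat.gcd_comm.
  pose proof (Nat.mod_upper_bound a 3 ltac:(lia)).
  assert (D : (a mod 3 = 1 \/ a mod 3 = 2)%nat) by lia.
  destruct D as [-> | ->]; reflexivity.
Qed.

Lemma hecke2 : (fZ 4 * fV 4 fE2 + fE2 + ftw (-1) fE2 = fZ 6 * fV 2 fE2)%fps.
Proof.
  change 4%nat with (2 * 2)%nat. rewrite <- fV_fV by lia.
  apply fps_ext; intros n. unfold fZ. rewrite !coef_add, !fmul_scal_coef.
  pose proof (Nat.div_mod_eq n 2) as D. pose proof (Nat.mod_upper_bound n 2 ltac:(lia)) as U.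
  unfold ftw, fV at 1 3. destruct (Nat.eqb_spec (n mod 2) 0) as [E|E].
  - set (k := (n / 2)%nat) in *. clearbody k.
    assert (En : n = (2 * k)%nat) by lia.
    pose proof (fE2_hecke 2 ltac:(lia) gcd_mod_2 k) as H. rewrite <- En in H.
    replace (cn 2) with (RtoC 2) in H by (unfold cn; simpl; f_equal; ring).
    replace ((-1) ^ n) with (RtoC 1).
    + replace (6 * fE2 k) with ((2 * 2 + 2) * fE2 k) by ring. rewrite <- H. ring.
    + rewrite En, Cpow_mult_r. replace ((-1) ^ 2) with (RtoC 1) by ring. symmetry; apply Cpow_1_l.
  - replace ((-1) ^ n) with (RtoC (-1)); [ring|].
    replace n with (S (2 * (n / 2))) by lia. rewrite Cpow_S, Cpow_mult_r.
    replace ((-1) ^ 2) with (RtoC 1) by ring. rewrite Cpow_1_l. ring.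
Qed.

Lemma hecke3 w : w ^ 2 + w + 1 = 0 ->
  (fZ 9 * fV 9 fE2 + ftw (w ^ 0)%C fE2 + ftw (w ^ 1)%C fE2 + ftw (w ^ 2)%C fE2 = fZ 12 * fV 3 fE2)%fps.
Proof.
  intros Hw. change 9%nat with (3 * 3)%nat. rewrite <- fV_fV by lia.
  assert (Hw3 : w ^ 3 = 1).
  { transitivity ((w - 1) * (w ^ 2 + w + 1) + 1); [ring|rewrite Hw; ring]. }
  apply fps_ext; intros n. unfold fZ. rewrite !coef_add, !fmul_scal_coef.
  pose proof (Nat.div_mod_eq n 3) as D. pose proof (Nat.mod_upper_bound n 3 ltac:(lia)) as U.
  unfold ftw, fV at 1 3. rewrite <- !Cpow_mult_r.
  assert (Hwn : forall i, w ^ (i * n) = w ^ (i * (n mod 3))).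
  { intros i. rewrite D at 1. replace (i * (3 * (n / 3) + n mod 3))%nat with
      (3 * (i * (n / 3)) + i * (n mod 3))%nat by lia.
    rewrite Cpow_add_r, Cpow_mult_r, Hw3, Cpow_1_l. ring. }
  rewrite !Hwn.
  destruct (Nat.eqb_spec (n mod 3) 0) as [E|E].
  - rewrite E. set (k := (n / 3)%nat) in *. clearbody k.
    assert (En : n = (3 * k)%nat) by lia.
    pose proof (fE2_hecke 3 ltac:(lia) gcd_mod_3 k) as H. rewrite <- En in H.
    replace (cn 3) with (RtoC 3) in H by (unfold cn; simpl; f_equal; ring).
    replace (12 * fE2 k) with ((3 * 3 + 3) * fE2 k) by ring. rewrite <- H. simpl. ring.
  - assert (E' : (n mod 3 = 1 \/ n mod 3 = 2)%nat) by lia. destruct E' as [-> | ->].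
    + transitivity ((w ^ 2 + w + 1) * fE2 n); [simpl; ring|rewrite Hw; simpl; ring].
    + transitivity ((w ^ 2 + w + w * w ^ 3 - w + 1) * fE2 n); [simpl; ring|].
      rewrite Hw3. transitivity ((w ^ 2 + w + 1) * fE2 n); [ring|rewrite Hw; simpl; ring].
Qed.

Lemma qexp_add_1 tau : qexp (tau + 1) = qexp tau.
Proof. rewrite qexp_plus, qexp_1. ring. Qed.

Lemma E2_add_1 tau : E2 (tau + 1) = E2 tau.
Proof. unfold E2, sigma_series. rewrite qexp_add_1. reflexivity. Qed.
Lemma E4_add_1 tau : E4 (tau + 1) = E4 tau.
Proof. unfold E4, sigma_series. rewrite qexp_add_1. reflexivity. Qed.
Lemma E6_add_1 tau : E6 (tau + 1) = E6 tau.
Proof. unfold E6, sigma_series. rewrite qexp_add_1. reflexivity. Qed.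

Lemma sqrt3_sqr : sqrt_neg 3 * sqrt_neg 3 = -3.
Proof.
  unfold sqrt_neg. transitivity (Ci * Ci * RtoC (sqrt 3 * sqrt 3)).
  - rewrite RtoC_mult; ring.
  - rewrite Ci_sqr, sqrt_sqrt by lra. rewrite <- RtoC_mult. f_equal; ring.
Qed.

Lemma rho_root : rho ^ 2 + rho + 1 = 0.
Proof.
  unfold rho. transitivity ((sqrt_neg 3 * sqrt_neg 3 + 3) / 4); [field|].
  rewrite sqrt3_sqr. field.
Qed.

Lemma qexp_third : qexp (1 / 3) = rho.
Proof.
  replace (1 / 3) with (RtoC (1 / 3)) by (rewrite RtoC_div by lra; reflexivity).
  rewrite qexp_real. replace (2 * PI * (1 / 3))%R with (2 * (PI / 3))%R by field.
  rewrite cos_2PI3, sin_2PI3. unfold rho, sqrt_neg.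
  replace ((-1 + Ci * RtoC (sqrt 3)) / 2) with
    (RtoC (-1 / 2) + Ci * RtoC (sqrt 3 / 2)) by (rewrite !RtoC_div by lra; field).
  unfold Ci, Cmult, Cplus, RtoC; simpl. f_equal; field.
Qed.

Lemma CpowerZ_succ (z : C) j : z <> 0 -> CpowerZ z (j + 1) = z * CpowerZ z j.
Proof.
  intros Hz. destruct j as [|p|p].
  - simpl. ring.
  - replace (Z.pos p + 1)%Z with (Z.pos (Pos.succ p)) by lia.
    unfold CpowerZ. rewrite Pos2Nat.inj_succ. reflexivity.
  - destruct (Pos.eq_dec p 1) as [->|H].
    + simpl. field. exact Hz.
    + rewrite <- (Pos.succ_pred p H).
      replace (Z.neg (Pos.succ (Pos.pred p)) + 1)%Z with (Z.neg (Pos.pred p)) by lia.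
      unfold CpowerZ. rewrite Pos2Nat.inj_succ, Cpow_S.
      pose proof (Cpow_nz z (Pos.to_nat (Pos.pred p)) Hz). field. split; assumption.
Qed.

Lemma m1_neq0 : RtoC (-1) <> 0.
Proof. apply RtoC_neq0; lra. Qed.

Lemma sign_succ j : CpowerZ (-1) (j + 1) = - CpowerZ (-1) j.
Proof. rewrite CpowerZ_succ by apply m1_neq0. ring. Qed.

Lemma sign_cases j : CpowerZ (-1) j = 1 \/ CpowerZ (-1) j = -1.
Proof.
  induction j as [|j IH|j IH] using Z.peano_ind; [left; reflexivity| |].
  - unfold Z.succ. rewrite sign_succ. destruct IH as [-> | ->]; [right|left]; ring.
  - pose proof (sign_succ (Z.pred j)) as H. unfold Z.pred in *.
    replace (j + -1 + 1)%Z with j in H by ring. rewrite H in IH.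
    destruct IH as [E|E]; [right|left].
    + transitivity (- - CpowerZ (-1) (j + -1)); [ring|rewrite E; ring].
    + transitivity (- - CpowerZ (-1) (j + -1)); [ring|rewrite E; ring].
Qed.

Lemma sign_sqr j : CpowerZ (-1) j * CpowerZ (-1) j = 1.
Proof. destruct (sign_cases j) as [-> | ->]; ring. Qed.

Lemma Im_div (tau : C) (r : R) : (0 < r)%R -> (0 < Im tau)%R -> (0 < Im (tau / RtoC r))%R.
Proof.
  intros Hr H. unfold Cdiv. rewrite <- RtoC_inv by lra.
  assert (0 < / r)%R by (apply Rinv_0_lt_compat; lra).
  destruct tau as [x y]. simpl in *. nra.
Qed.

Lemma Im_add_real (tau : C) (r : R) : Im (tau + RtoC r) = Im tau.
Proof. destruct tau as [x y]. simpl. ring. Qed.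

Lemma Im_scal (tau : C) (r : R) : (0 < r)%R -> (0 < Im tau)%R -> (0 < Im (RtoC r * tau))%R.
Proof. intros Hr H. destruct tau as [x y]. simpl in *. nra. Qed.

Section Level2.
Variable tau : C.
Hypothesis Htau : (0 < Im tau)%R.
Let u := qexp (tau / 2).

Lemma level2_Im : (0 < Im (tau / 2))%R.
Proof. apply (Im_div tau 2); [lra|exact Htau]. Qed.

Lemma level2_Cmod : (Cmod u < 1)%R.
Proof. apply Cmod_qexp_lt_1, level2_Im. Qed.

Lemma level2_q : qexp tau = u ^ 2.
Proof. unfold u. rewrite (proj1 (qexp_halves tau)). ring. Qed.

Lemma level2_E2 : E2 tau = ev u (fV 2 fE2).
Proof.
  rewrite E2_ev, level2_q, ev_fV by (try lia; auto using good_fE2, level2_Cmod). reflexivity.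
Qed.

Lemma level2_E2_half : E2 (tau / 2) = ev u fE2.
Proof. apply E2_ev, level2_Im. Qed.

Lemma level2_E2_half_shift : E2 ((tau + 1) / 2) = ev u (ftw (-1) fE2).
Proof.
  rewrite ev_ftw, E2_ev by (apply (Im_div (tau + 1) 2); [lra|rewrite Im_add_real; exact Htau]).
  rewrite (proj2 (qexp_halves tau)). fold u. f_equal. ring.
Qed.

Lemma level2_E2_double : E2 (2 * tau) = ev u (fV 4 fE2).
Proof.
  rewrite E2_ev, ev_fV
    by first [lia|apply good_fE2|apply level2_Cmod|apply Im_scal; [lra|exact Htau]].
  f_equal. replace (2 * tau) with (tau + tau) by ring. rewrite qexp_plus, level2_q. ring.
Qed.

Lemma level2_eta : eta tau ^ 12 = ev u (fX * fV 2 feuler ^ 12)%fps.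
Proof.
  pose proof level2_Cmod as Hu.
  assert (G : good (fV 2 feuler)) by (apply good_fV; [lia|apply good_feuler]).
  rewrite ev_mul, ev_fX, ev_pow, ev_fV by (try lia; auto using good_pow, good_fX, good_feuler).
  rewrite eta_ev, level2_q, Cpow_mult_l by exact Htau. f_equal.
  rewrite <- qexp_mult_nat. unfold u. f_equal.
  replace (INR 12) with 12%R by (simpl; ring). field.
Qed.

Lemma hecke2_E2 : 4 * E2 (2 * tau) = 6 * E2 tau - E2 (tau / 2) - E2 ((tau + 1) / 2).
Proof.
  pose proof level2_Cmod as Hu. pose proof (f_equal (ev u) hecke2) as H.
  assert (G4 : good (fV 4 fE2)) by (apply good_fV; [lia|apply good_fE2]).
  assert (G2 : good (fV 2 fE2)) by (apply good_fV; [lia|apply good_fE2]).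
  assert (Gt : good (ftw (-1) fE2)).
  { apply good_ftw; [|apply good_fE2]. rewrite Cmod_R, Rabs_left; lra. }
  unfold fZ in H.
  rewrite !ev_add, !ev_scal in H by auto using good_add, good_mul, good_cst, good_fE2.
  rewrite <- level2_E2, <- level2_E2_double, <- level2_E2_half, <- level2_E2_half_shift in H.
  rewrite <- H. ring.
Qed.

Lemma f1_level2 j (c := CpowerZ (-1) j * sqrt_neg 3) :
  f1 j tau ^ 3 = E6 tau + 24 * c * eta tau ^ 12 /\ f1 j tau * f1 (j + 1) tau = E4 tau.
Proof.
  pose proof level2_Cmod as Hu.
  assert (Hc : c * c = -3).
  { unfold c. transitivity ((CpowerZ (-1) j * CpowerZ (-1) j) * (sqrt_neg 3 * sqrt_neg 3)); [ring|].
    rewrite sign_sqr, sqrt3_sqr. ring. }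
  destruct (level2_identity c Hc) as [H1 H2]. cbv zeta in H1, H2.
  assert (G2 : good (fV 2 fE2)) by (apply good_fV; [lia|apply good_fE2]).
  assert (Gt : good (ftw (-1) fE2)).
  { apply good_ftw; [|apply good_fE2]. rewrite Cmod_R, Rabs_left; lra. }
  assert (G6 : good (fV 2 fE6)) by (apply good_fV; [lia|apply good_fE6]).
  assert (G4 : good (fV 2 fE4)) by (apply good_fV; [lia|apply good_fE4]).
  assert (Ge : good (fX * fV 2 feuler ^ 12)%fps).
  { apply good_mul; [apply good_fX|]. apply good_pow, good_fV; [lia|apply good_feuler]. }
  set (f := fun e => (fZ 12 * fV 2 fE2 - fcst (3 + e)%C * fE2 - fcst (3 - e)%C * ftw (-1) fE2)%fps).
  assert (Gf : forall e, good (f e)).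
  { intros e. unfold f. auto 10 using good_sub, good_mul, good_Z, good_cst, good_fE2. }
  assert (Ef : forall i, ev u (f (CpowerZ (-1) i * sqrt_neg 3)) = 6 * f1 i tau).
  { intros i. unfold f, fZ. rewrite !ev_sub, !ev_scal by auto using good_sub, good_mul, good_cst, good_fE2.
    rewrite <- level2_E2, <- level2_E2_half, <- level2_E2_half_shift. unfold f1. field. }
  fold (f c) in H1, H2. fold (f (- c)) in H2.
  apply (f_equal (ev u)) in H1, H2.
  assert (E6' : ev u (fV 2 fE6) = E6 tau).
  { rewrite E6_ev, level2_q, ev_fV by (try lia; auto using good_fE6). reflexivity. }
  assert (E4' : ev u (fV 2 fE4) = E4 tau).
  { rewrite E4_ev, level2_q, ev_fV by (try lia; auto using good_fE4). reflexivity. }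
  assert (Ec : - c = CpowerZ (-1) (j + 1) * sqrt_neg 3) by (rewrite sign_succ; unfold c; ring).
  unfold fZ in H1, H2. split.
  - rewrite ev_pow, ev_scal, ev_add, ev_scal in H1 by auto using good_add, good_mul, good_cst.
    unfold c in H1 at 1. rewrite Ef, E6', <- level2_eta in H1.
    apply (Cmult_cancel 216); [apply RtoC_neq0; lra|]. rewrite <- H1. ring.
  - rewrite ev_mul, ev_scal, Ec in H2 by auto.
    unfold c in H2. rewrite !Ef, E4' in H2.
    apply (Cmult_cancel 36); [apply RtoC_neq0; lra|]. rewrite <- H2. ring.
Qed.
End Level2.

Lemma E2_sub_1 tau : E2 (tau - 1) = E2 tau.
Proof. rewrite <- E2_add_1. f_equal. ring. Qed.

(* [(tau - 1) / (n tau)] is [S T^(-n) S] applied to [(tau - 1) / n]. *)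
Lemma E2_STS (n : nat) tau : (1 <= n)%nat -> (0 < Im tau)%R ->
  E2 ((tau - 1) / (cn n * tau)) = tau ^ 2 * E2 ((tau - 1) / cn n) - 6 * Ci * (cn n * tau) / RtoC PI.
Proof.
  intros Hn H. assert (Hn0 : (0 < INR n)%R) by (apply lt_0_INR; lia).
  assert (Hc : cn n <> 0) by (apply RtoC_neq0; lra).
  set (v := (tau - 1) / cn n).
  assert (Ht1 : (0 < Im (tau - 1))%R).
  { replace (tau - 1) with (tau + RtoC (-1)) by ring. rewrite Im_add_real. exact H. }
  assert (Hv : (0 < Im v)%R) by (apply (Im_div (tau - 1) (INR n)); assumption).
  pose proof (tau_neq0 _ Ht1) as N1. pose proof (tau_neq0 _ H) as N2.
  set (z := -1 / v - cn n).
  assert (Hz : (0 < Im z)%R).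
  { unfold z. replace (-1 / v - cn n) with (-1 / v + RtoC (- INR n)) by (rewrite RtoC_opp; reflexivity).
    rewrite Im_add_real. apply Im_neg_inv; exact Hv. }
  assert (Ez : z = - (cn n * tau) / (tau - 1)) by (unfold z, v; field; split; assumption).
  replace ((tau - 1) / (cn n * tau)) with (-1 / z)
    by (rewrite Ez; field; repeat split; try assumption).
  assert (Eper : forall m, E2 (-1 / v - cn m) = E2 (-1 / v)).
  { induction m as [|m IH].
    - f_equal. change (cn 0) with (RtoC 0). ring.
    - rewrite <- IH, <- (E2_sub_1 (-1 / v - cn m)), cn_S. f_equal. ring. }
  rewrite E2_inv by exact Hz. unfold z at 2. rewrite Eper, E2_inv by exact Hv.
  rewrite Ez. unfold v at 1 3. field. repeat split; try assumption; exact PI_C_neq0.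
Qed.

Lemma E2_mul_inv (n : nat) tau : (1 <= n)%nat -> (0 < Im tau)%R ->
  E2 (-1 / tau / cn n) = (cn n * tau) ^ 2 * E2 (cn n * tau) - 6 * Ci * (cn n * tau) / RtoC PI.
Proof.
  intros Hn H. assert (Hn0 : (0 < INR n)%R) by (apply lt_0_INR; lia).
  assert (Hc : cn n <> 0) by (apply RtoC_neq0; lra).
  rewrite <- E2_inv by (apply Im_scal; assumption). f_equal. field.
  split; [exact (tau_neq0 _ H)|exact Hc].
Qed.

Lemma cn_2 : cn 2 = 2.
Proof. unfold cn; simpl; f_equal; ring. Qed.
Lemma cn_3 : cn 3 = 3.
Proof. unfold cn; simpl; f_equal; ring. Qed.

Lemma f1_add_1 j tau : f1 j (tau + 1) = f1 (j + 1) tau.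
Proof.
  unfold f1. rewrite E2_add_1, sign_succ.
  replace ((tau + 1 + 1) / 2) with (tau / 2 + 1) by field. rewrite E2_add_1. field.
Qed.

Lemma f1_inv j tau : (0 < Im tau)%R ->
  f1 j (-1 / tau) = (-1 - CpowerZ (-1) j * sqrt_neg 3) / 2 * tau ^ 2 * f1 (j + 1) tau.
Proof.
  intros H. pose proof (tau_neq0 _ H) as Ht.
  pose proof (hecke2_E2 tau H) as Hh.
  pose proof (E2_mul_inv 2 tau ltac:(lia) H) as E1. pose proof (E2_STS 2 tau ltac:(lia) H) as E3.
  rewrite cn_2 in E1, E3.
  assert (E4' : E2 ((-1 / tau + 1) / 2) = tau ^ 2 * E2 ((tau + 1) / 2) - 6 * Ci * (2 * tau) / RtoC PI).
  { replace ((-1 / tau + 1) / 2) with ((tau - 1) / (2 * tau)) by (field; exact Ht). rewrite E3.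
    replace ((tau + 1) / 2) with ((tau - 1) / 2 + 1) by field. rewrite E2_add_1. reflexivity. }
  unfold f1. rewrite E1, E4', E2_inv, sign_succ by exact H.
  replace ((2 * tau) ^ 2 * E2 (2 * tau)) with (tau ^ 2 * (4 * E2 (2 * tau))) by ring.
  rewrite Hh.
  assert (Hc : (CpowerZ (-1) j * sqrt_neg 3) * (CpowerZ (-1) j * sqrt_neg 3) = -3).
  { transitivity ((CpowerZ (-1) j * CpowerZ (-1) j) * (sqrt_neg 3 * sqrt_neg 3)); [ring|].
    rewrite sign_sqr, sqrt3_sqr. ring. }
  replace (- CpowerZ (-1) j * sqrt_neg 3) with (- (CpowerZ (-1) j * sqrt_neg 3)) by ring.
  set (c := CpowerZ (-1) j * sqrt_neg 3) in *.
  set (a := E2 tau). set (b := E2 (tau / 2)). set (e := E2 ((tau + 1) / 2)).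
  transitivity (tau ^ 2 * ((-1 - c) * a + (6 + 2 * c) / 12 * b + (4 * c) / 12 * e)).
  - field. exact PI_C_neq0.
  - transitivity (tau ^ 2 * ((-1 - c) * a + (3 + 2 * c - c * c) / 12 * b + (3 + 4 * c + c * c) / 12 * e)).
    + rewrite Hc. field.
    + field.
Qed.

Lemma Im_sqrt3_half (x : R) : (0 < Im ((RtoC x + sqrt_neg 3) / 2))%R.
Proof.
  apply (Im_div _ 2); [lra|]. unfold sqrt_neg, Ci. simpl.
  assert (0 < sqrt 3)%R by (apply sqrt_lt_R0; lra). lra.
Qed.

Lemma f1_add_2 j tau : f1 (j + 1 + 1) tau = f1 j tau.
Proof. unfold f1. rewrite !sign_succ. field. Qed.

Lemma eq_mul_0 (k z : C) : k <> 1 -> z = k * z -> z = 0.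
Proof.
  intros Hk H. destruct (Ceq_dec z 0) as [|Hz]; [assumption|]. exfalso; apply Hk.
  apply (Cmult_cancel z); [exact Hz|]. rewrite Cmult_1_r. rewrite H at 2. ring.
Qed.

Lemma sqrt_neg3_neq (x : R) : sqrt_neg 3 <> RtoC x.
Proof.
  intros E. apply (f_equal Im) in E. unfold sqrt_neg, Ci in E. simpl in E.
  assert (0 < sqrt 3)%R by (apply sqrt_lt_R0; lra). lra.
Qed.

(* The point is fixed by an elliptic element of order three. *)
Lemma f1_zero j : f1 j ((CpowerZ (-1) j + sqrt_neg 3) / 2) = 0.
Proof.
  pose proof sqrt3_sqr as H3.
  destruct (sign_cases j) as [Hj|Hj]; rewrite Hj.
  - set (t := (1 + sqrt_neg 3) / 2).
    assert (Ht : (0 < Im t)%R) by apply Im_sqrt3_half. pose proof (tau_neq0 _ Ht) as Hn.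
    assert (Et : t * t = t - 1).
    { transitivity ((1 + 2 * sqrt_neg 3 + sqrt_neg 3 * sqrt_neg 3) / 4); [unfold t; field|].
      rewrite H3. unfold t; field. }
    pose proof (f1_inv (j + 1) t Ht) as H. rewrite f1_add_2, sign_succ, Hj in H.
    replace (-1 / t) with (t - 1) in H.
    + rewrite <- (f1_add_1 j (t - 1)) in H. replace (t - 1 + 1) with t in H by ring.
      replace (t ^ 2) with (t - 1) in H by (rewrite <- Et; ring).
      refine (eq_mul_0 _ _ _ H). intros E. apply (sqrt_neg3_neq (-3)).
      assert (E2 : (-1 - sqrt_neg 3) / 2 = 1).
      { etransitivity; [|exact E]. unfold t.
        transitivity ((1 - 2 * sqrt_neg 3 + sqrt_neg 3 * sqrt_neg 3) / 4); [rewrite H3|]; field. }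
      transitivity (-1 - 2 * ((-1 - sqrt_neg 3) / 2)); [field|rewrite E2; ring].
    + apply (Cmult_cancel t); [exact Hn|]. transitivity (t * t - t); [ring|].
      rewrite Et. field. exact Hn.
  - set (t := (-1 + sqrt_neg 3) / 2).
    assert (Ht : (0 < Im t)%R) by apply Im_sqrt3_half. pose proof (tau_neq0 _ Ht) as Hn.
    assert (Et : t * t = - t - 1).
    { transitivity ((1 - 2 * sqrt_neg 3 + sqrt_neg 3 * sqrt_neg 3) / 4); [unfold t; field|].
      rewrite H3. unfold t; field. }
    pose proof (f1_inv (j + 1) t Ht) as H. rewrite f1_add_2, sign_succ, Hj in H.
    replace (-1 / t) with (t + 1) in H.
    + rewrite f1_add_1, f1_add_2 in H.
      replace (t ^ 2) with (- t - 1) in H by (transitivity (t * t); [rewrite Et|]; ring).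
      refine (eq_mul_0 _ _ _ H). intros E.
      apply (sqrt_neg3_neq 3).
      assert (E2 : (sqrt_neg 3 - 1) / 2 = 1).
      { etransitivity; [|exact E]. unfold t.
        transitivity ((2 * sqrt_neg 3 + 1 + sqrt_neg 3 * sqrt_neg 3) / 4); [rewrite H3|]; field. }
      transitivity (2 * ((sqrt_neg 3 - 1) / 2) + 1); [field|rewrite E2; ring].
    + apply (Cmult_cancel t); [exact Hn|]. transitivity (t * t + t); [ring|].
      rewrite Et. field. exact Hn.
Qed.

Lemma g1_unfold tau :
  g1 0 tau = 3 / 2 * E2 tau - 1 / 4 * (E2 ((tau + 1) / 3) + E2 ((tau + 2) / 3)) /\
  g1 1 tau = 3 / 2 * E2 tau - 1 / 4 * (E2 (tau / 3) + E2 ((tau + 2) / 3)) /\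
  g1 2 tau = 3 / 2 * E2 tau - 1 / 4 * (E2 (tau / 3) + E2 ((tau + 1) / 3)).
Proof.
  unfold g1. simpl. rewrite !Cplus_0_r. repeat split; reflexivity.
Qed.

Section Level3.
Variable tau : C.
Hypothesis Htau : (0 < Im tau)%R.
Let u := qexp (tau / 3).

Lemma level3_Im : (0 < Im (tau / 3))%R.
Proof. apply (Im_div tau 3); [lra|exact Htau]. Qed.

Lemma level3_Cmod : (Cmod u < 1)%R.
Proof. apply Cmod_qexp_lt_1, level3_Im. Qed.

Lemma level3_q : qexp tau = u ^ 3.
Proof.
  unfold u. rewrite <- qexp_mult_nat. fold (cn 3). rewrite cn_3. f_equal. field.
Qed.

Lemma level3_E2 : E2 tau = ev u (fV 3 fE2).
Proof.
  rewrite E2_ev, level3_q, ev_fV by (try lia; auto using good_fE2, level3_Cmod). reflexivity.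
Qed.

Lemma level3_E2_third i : E2 ((tau + cn i) / 3) = ev u (ftw (rho ^ i) fE2).
Proof.
  rewrite ev_ftw, E2_ev by (apply (Im_div (tau + cn i) 3); [lra|unfold cn; rewrite Im_add_real; exact Htau]).
  f_equal. rewrite <- qexp_third, <- qexp_mult_nat. fold (cn i). unfold u. rewrite <- qexp_plus.
  f_equal. field.
Qed.

Lemma level3_E2_triple : E2 (3 * tau) = ev u (fV 9 fE2).
Proof.
  rewrite E2_ev, ev_fV
    by first [lia|apply good_fE2|apply level3_Cmod|apply Im_scal; [lra|exact Htau]].
  f_equal. replace (3 * tau) with (RtoC (INR 3) * tau) by (fold (cn 3); rewrite cn_3; reflexivity).
  rewrite qexp_mult_nat, level3_q, <- Cpow_mult_r. reflexivity.
Qed.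

Lemma level3_eta : eta tau ^ 8 = ev u (fX * fV 3 feuler ^ 8)%fps.
Proof.
  pose proof level3_Cmod as Hu.
  assert (G : good (fV 3 feuler)) by (apply good_fV; [lia|apply good_feuler]).
  rewrite ev_mul, ev_fX, ev_pow, ev_fV by (try lia; auto using good_pow, good_fX, good_feuler).
  rewrite eta_ev, level3_q, Cpow_mult_l by exact Htau. f_equal.
  rewrite <- qexp_mult_nat. unfold u. f_equal.
  replace (INR 8) with 8%R by (simpl; ring). field.
Qed.

Lemma Cmod_rho_pow i : (Cmod (rho ^ i) <= 1)%R.
Proof.
  rewrite <- qexp_third, <- qexp_mult_nat, Cmod_qexp.
  replace (RtoC (INR i) * (1 / 3)) with (RtoC (INR i * (1 / 3)))
    by (rewrite RtoC_mult, RtoC_div by lra; reflexivity).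
  simpl Im. rewrite Rmult_0_r, exp_0. lra.
Qed.

Lemma good_rho_twist i : good (ftw (rho ^ i) fE2).
Proof. apply good_ftw; [apply Cmod_rho_pow|apply good_fE2]. Qed.

Lemma hecke3_E2 : 9 * E2 (3 * tau) =
  12 * E2 tau - E2 (tau / 3) - E2 ((tau + 1) / 3) - E2 ((tau + 2) / 3).
Proof.
  pose proof level3_Cmod as Hu. pose proof (f_equal (ev u) (hecke3 rho rho_root)) as H.
  assert (G9 : good (fV 9 fE2)) by (apply good_fV; [lia|apply good_fE2]).
  assert (G3 : good (fV 3 fE2)) by (apply good_fV; [lia|apply good_fE2]).
  pose proof good_rho_twist. unfold fZ in H.
  rewrite !ev_add, !ev_scal in H by auto using good_add, good_mul, good_cst.
  rewrite <- !level3_E2_third, <- level3_E2, <- level3_E2_triple, cn_2 in H.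
  change (cn 0) with (RtoC 0) in H. change (cn 1) with (RtoC 1) in H.
  rewrite Cplus_0_r in H. rewrite <- H. ring.
Qed.

Lemma g1_level3 : g1 0 tau ^ 2 = E4 tau - 12 * eta tau ^ 8 /\
  g1 0 tau * g1 1 tau * g1 2 tau = E6 tau.
Proof.
  pose proof level3_Cmod as Hu.
  destruct (level3_identity rho rho_root) as [H1 H2]. cbv zeta in H1, H2.
  assert (G3 : good (fV 3 fE2)) by (apply good_fV; [lia|apply good_fE2]).
  assert (G4 : good (fV 3 fE4)) by (apply good_fV; [lia|apply good_fE4]).
  assert (G6 : good (fV 3 fE6)) by (apply good_fV; [lia|apply good_fE6]).
  assert (Ge : good (fX * fV 3 feuler ^ 8)%fps).
  { apply good_mul; [apply good_fX|]. apply good_pow, good_fV; [lia|apply good_feuler]. }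
  pose proof good_rho_twist as Gt.
  set (g := fun i j => (fZ 12 * fV 3 fE2 - fZ 2 * (ftw (rho ^ i)%C fE2 + ftw (rho ^ j)%C fE2))%fps).
  fold (g 1%nat 2%nat) (g 0%nat 2%nat) (g 0%nat 1%nat) in H1, H2.
  assert (Gg : forall i j, good (g i j)) by (intros; unfold g; auto 10 using good_sub, good_mul, good_Z, good_add).
  assert (Eg : forall i j, ev u (g i j) =
    8 * (3 / 2 * E2 tau - 1 / 4 * (E2 ((tau + cn i) / 3) + E2 ((tau + cn j) / 3)))).
  { intros i j. unfold g, fZ. rewrite ev_sub, !ev_scal, ev_add by auto using good_mul, good_cst, good_add.
    rewrite <- !level3_E2_third, <- level3_E2. field. }
  destruct (g1_unfold tau) as (U0 & U1 & U2).
  assert (E12 : ev u (g 1%nat 2%nat) = 8 * g1 0 tau) by (rewrite Eg, U0, cn_2; reflexivity).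
  assert (E02 : ev u (g 0%nat 2%nat) = 8 * g1 1 tau).
  { rewrite Eg, U1, cn_2. change (cn 0) with (RtoC 0). rewrite Cplus_0_r. reflexivity. }
  assert (E01 : ev u (g 0%nat 1%nat) = 8 * g1 2 tau).
  { rewrite Eg, U2. change (cn 0) with (RtoC 0). rewrite Cplus_0_r. reflexivity. }
  apply (f_equal (ev u)) in H1, H2.
  assert (E6' : ev u (fV 3 fE6) = E6 tau).
  { rewrite E6_ev, level3_q, ev_fV by (try lia; auto using good_fE6). reflexivity. }
  assert (E4' : ev u (fV 3 fE4) = E4 tau).
  { rewrite E4_ev, level3_q, ev_fV by (try lia; auto using good_fE4). reflexivity. }
  unfold fZ in H1, H2. split.
  - rewrite ev_pow, ev_scal, ev_sub, ev_scal, E12, E4', <- level3_eta in H1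
      by auto using good_sub, good_mul, good_cst.
    apply (Cmult_cancel 64); [apply RtoC_neq0; lra|]. rewrite <- H1. ring.
  - rewrite !ev_mul, ev_scal, E12, E02, E01, E6' in H2 by auto using good_mul.
    apply (Cmult_cancel 512); [apply RtoC_neq0; lra|]. rewrite <- H2. ring.
Qed.

Lemma E2_thirds_inv (k := 6 * Ci * (3 * tau) / RtoC PI) :
  E2 (-1 / tau / 3) = tau ^ 2 * (9 * E2 (3 * tau)) - k /\
  E2 ((-1 / tau + 1) / 3) = tau ^ 2 * E2 ((tau + 2) / 3) - k /\
  E2 ((-1 / tau + 2) / 3) = tau ^ 2 * E2 ((tau + 1) / 3) - k.
Proof.
  pose proof (tau_neq0 _ Htau) as Ht.
  assert (A : forall t, (0 < Im t)%R ->
    E2 ((-1 / t + 1) / 3) = t ^ 2 * E2 ((t + 2) / 3) - 6 * Ci * (3 * t) / RtoC PI).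
  { intros t H. pose proof (tau_neq0 _ H). pose proof (E2_STS 3 t ltac:(lia) H) as E. rewrite cn_3 in E.
    replace ((-1 / t + 1) / 3) with ((t - 1) / (3 * t)) by (field; assumption). rewrite E.
    replace ((t + 2) / 3) with ((t - 1) / 3 + 1) by field. rewrite E2_add_1. reflexivity. }
  split; [|split].
  - pose proof (E2_mul_inv 3 tau ltac:(lia) Htau) as E. rewrite cn_3 in E. rewrite E. unfold k. ring.
  - apply A; exact Htau.
  - pose proof (A (-1 / tau) (Im_neg_inv tau Htau)) as E.
    replace (-1 / (-1 / tau)) with tau in E by (field; exact Ht). rewrite E. unfold k. field.
    split; [exact PI_C_neq0|exact Ht].
Qed.

Lemma g1_inv_012 : g1 0 (-1 / tau) = tau ^ 2 * g1 0 tau /\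
  g1 1 (-1 / tau) = - tau ^ 2 * g1 1 tau /\ g1 2 (-1 / tau) = - tau ^ 2 * g1 2 tau.
Proof.
  destruct E2_thirds_inv as (X0 & X1 & X2). rewrite hecke3_E2 in X0.
  destruct (g1_unfold tau) as (U0 & U1 & U2).
  destruct (g1_unfold (-1 / tau)) as (V0 & V1 & V2).
  rewrite U0, U1, U2, V0, V1, V2, X0, X1, X2, E2_inv by exact Htau.
  repeat split; field; exact PI_C_neq0.
Qed.
End Level3.

Lemma g1_mod j tau : g1 j tau = g1 (j mod 3) tau.
Proof. unfold g1. rewrite Z.mod_mod by lia. reflexivity. Qed.

Lemma mod3_cases j : (j mod 3 = 0 \/ j mod 3 = 1 \/ j mod 3 = 2)%Z.
Proof. pose proof (Z.mod_pos_bound j 3 ltac:(lia)). lia. Qed.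

Lemma g1_add_1 j tau : g1 j (tau + 1) = g1 (j + 1) tau.
Proof.
  rewrite g1_mod, (g1_mod (j + 1)), (Z.add_mod j 1 3) by lia.
  destruct (mod3_cases j) as [-> | [-> | ->]]; unfold g1; simpl;
    rewrite !Cplus_0_r, E2_add_1;
    replace ((tau + 1 + 2) / 3) with (tau / 3 + 1) by field;
    replace (tau + 1 + 1) with (tau + 2) by ring; rewrite ?E2_add_1; ring.
Qed.

Lemma g1_shift j tau : g1 j tau = g1 0 (tau + RtoC (IZR j)).
Proof.
  revert tau; induction j as [|j IH|j IH] using Z.peano_ind; intros tau.
  - f_equal. ring.
  - unfold Z.succ. rewrite <- g1_add_1, IH, plus_IZR, RtoC_plus. f_equal. ring.
  - replace tau with (tau - 1 + 1) at 1 by ring. rewrite g1_add_1.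
    replace (Z.pred j + 1)%Z with j by lia. rewrite IH.
    unfold Z.pred. rewrite plus_IZR, RtoC_plus. f_equal. ring.
Qed.

Lemma periodic_IZR (F : C -> C) : (forall t, F (t + 1) = F t) ->
  forall j t, F (t + RtoC (IZR j)) = F t.
Proof.
  intros H j. induction j as [|j IH|j IH] using Z.peano_ind; intros t.
  - f_equal. ring.
  - transitivity (F (t + RtoC (IZR j))); [|apply IH]. rewrite <- (H (t + RtoC (IZR j))).
    f_equal. unfold Z.succ. rewrite plus_IZR, RtoC_plus. ring.
  - rewrite <- (IH t), <- H. f_equal. unfold Z.pred. rewrite plus_IZR, RtoC_plus. ring.
Qed.

Lemma rho_neq0 : rho <> 0.
Proof. rewrite <- qexp_third. apply qexp_neq0. Qed.

Lemma eta8_add_1 tau : eta (tau + 1) ^ 8 = rho * eta tau ^ 8.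
Proof.
  unfold eta. rewrite qexp_add_1. set (e := Clim _).
  replace ((tau + 1) / 24) with (tau / 24 + 1 / 24) by field.
  rewrite qexp_plus, !Cpow_mult_l, <- qexp_third.
  replace (1 / 3) with (RtoC (INR 8) * (1 / 24)).
  - rewrite qexp_mult_nat. ring.
  - replace (INR 8) with 8%R by (simpl; ring). field.
Qed.

Lemma eta8_shift j tau : eta (tau + RtoC (IZR j)) ^ 8 = CpowerZ rho j * eta tau ^ 8.
Proof.
  induction j as [|j IH|j IH] using Z.peano_ind.
  - simpl CpowerZ. rewrite Cplus_0_r. ring.
  - unfold Z.succ. rewrite CpowerZ_succ by exact rho_neq0.
    rewrite <- Cmult_assoc, <- IH, <- eta8_add_1, plus_IZR, RtoC_plus. do 2 f_equal. ring.
  - apply (Cmult_cancel rho); [exact rho_neq0|].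
    rewrite <- eta8_add_1, Cmult_assoc, <- CpowerZ_succ by exact rho_neq0.
    replace (Z.pred j + 1)%Z with j by lia. rewrite <- IH. do 2 f_equal.
    unfold Z.pred. rewrite plus_IZR, RtoC_plus. ring.
Qed.

Lemma sqrt_neg_1 : sqrt_neg 1 = Ci.
Proof. unfold sqrt_neg. rewrite sqrt_1. ring. Qed.

Lemma Im_Ci : (0 < Im Ci)%R.
Proof. simpl. lra. Qed.

Lemma g1_zero_Ci : g1 0 Ci = 0.
Proof.
  pose proof (proj1 (g1_inv_012 Ci Im_Ci)) as H.
  replace (-1 / Ci) with Ci in H.
  - apply (eq_mul_0 (Ci ^ 2)); [|exact H].
    replace (Ci ^ 2) with (Ci * Ci) by ring. rewrite Ci_sqr. intros E. apply RtoC_inj in E. lra.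
  - apply (Cmult_cancel Ci); [exact Ci_nz|]. rewrite Ci_sqr. field. exact Ci_nz.
Qed.

Lemma sqrt_neg_1728 : sqrt_neg 1728 = 24 * sqrt_neg 3.
Proof.
  unfold sqrt_neg. replace (sqrt 1728) with (24 * sqrt 3)%R; [rewrite RtoC_mult; ring|].
  replace 1728%R with (24 * 24 * 3)%R by ring. rewrite sqrt_mult by lra.
  rewrite sqrt_square by lra. reflexivity.
Qed.

Theorem mainTheorem2 :
  (forall (j : Z) (tau : C), (0 < Im tau)%R ->
     f1 j tau ^ 3 = F1 (j + 1)%Z tau
     /\ f1 j tau * f1 (j + 1)%Z tau = E4 tau
     /\ f1 j ((CpowerZ (-1) j + sqrt_neg 3) / 2) = 0
     /\ f1 j (tau + 1) = f1 (j + 1)%Z tau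
     /\ f1 j (-1 / tau)
        = (-1 - CpowerZ (-1) j * sqrt_neg 3) / 2 * tau ^ 2 * f1 (j + 1)%Z tau)
  /\
  (forall (j : Z) (tau : C), (0 < Im tau)%R ->
     g1 j tau ^ 2 = G1 j tau
     /\ g1 j tau * g1 (j + 1)%Z tau * g1 (j + 2)%Z tau = E6 tau
     /\ g1 j (- RtoC (IZR j) + sqrt_neg 1) = 0
     /\ g1 j (tau + 1) = g1 (j + 1)%Z tau
     /\ g1 j (-1 / tau) = epsilon j * tau ^ 2 * g1 j tau).
Proof.
  split; intros j tau H.
  - destruct (f1_level2 tau H j) as [A1 A2].
    repeat split; [|exact A2|apply f1_zero|apply f1_add_1|apply f1_inv; exact H].
    rewrite A1. unfold F1. rewrite sign_succ, sqrt_neg_1728. ring.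
  - assert (Hj : (0 < Im (tau + RtoC (IZR j)))%R) by (rewrite Im_add_real; exact H).
    destruct (g1_level3 _ Hj) as [B1 B2].
    split; [|split; [|split; [|split; [apply g1_add_1|]]]].
    + rewrite g1_shift, B1, eta8_shift, (periodic_IZR E4 E4_add_1). unfold G1. ring.
    + rewrite (periodic_IZR E6 E6_add_1) in B2. rewrite <- B2.
      rewrite (g1_shift j), (g1_shift (j + 1)), (g1_shift (j + 2)).
      rewrite (g1_shift 1), (g1_shift 2), !plus_IZR, !RtoC_plus, !Cplus_assoc. reflexivity.
    + rewrite g1_shift, sqrt_neg_1, <- g1_zero_Ci. f_equal. ring.
    + destruct (g1_inv_012 tau H) as (I0 & I1 & I2).
      rewrite !(g1_mod j). unfold epsilon.
      destruct (Znumtheory.Zdivide_dec 3 j) as [D|D].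
      * apply Z.mod_divide in D; [|lia]. rewrite D, I0. ring.
      * destruct (mod3_cases j) as [E|[E|E]].
        -- exfalso; apply D, Z.mod_divide; [lia|exact E].
        -- rewrite E, I1. ring.
        -- rewrite E, I2. ring.
Qed.
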